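(* If $T\subset\mathbb{R}^2$ is a triangle and $B\subset\mathbb{R}^2$ is a disk with the same area, then for any $\tau\geq0$, $$\Gamma(T,\tau)\geq\Gamma(B,\tau).$$
   Context: For $\tau\in\mathbb{R}$ and an open set $\Omega\subset\mathbb{R}^d$ of finite volume, $\Gamma(\Omega,\tau)$ denotes the first eigenvalue of $\Delta^2-\tau\Delta$ over $\Omega$ with Dirichlet boundary conditions $u=\partial_nu=0$ on $\partial\Omega$, that is $$\Gamma(\Omega,\tau)=\min_{v\in H_0^2(\Omega),\,v\neq0}\frac{\int_\Omega(\Delta v)^2+\tau\int_\Omega|\nabla v|^2}{\int_\Omega v^2}.$$ A triangle is understood as an open (nondegenerate) triangular domain. *)

(* Defs.v *)
From mathcomp Require Import all_boot all_order all_algebra.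
From mathcomp Require Import all_classical all_reals all_analysis.

Set Implicit Arguments.
Unset Strict Implicit.
Unset Printing Implicit Defensive.

Import Order.TTheory GRing.Theory Num.Theory.
Import numFieldNormedType.Exports.

Local Open Scope classical_set_scope.
Local Open Scope ring_scope.

Section Plane.
Context {R : realType}.
Implicit Types (Omega : set (R * R)) (f g u v phi : R * R -> R).

Definition area :
    {measure set (measurableTypeR R * measurableTypeR R) -> \bar R} :=
  (@lebesgue_measure R \x @lebesgue_measure R)%E.

Definition basis_vec (i : 'I_2) : R * R := ((i == 0)%:R, (i == 1)%:R).

Definition partial (i : 'I_2) f : R * R -> R :=
  fun x => 'D_(basis_vec i) f x.

(* [:: i1; ..; ik] stands for the operator d_{i1} ... d_{ik}. *)
Definition partials (s : seq 'I_2) f : R * R -> R := foldr partial f s.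

(* Total differentiability of every iterated partial derivative makes all of
   them continuous, so this is exactly C^oo. *)
Definition smooth f : Prop :=
  forall (s : seq 'I_2) (x : R * R), differentiable (partials s f) x.

Definition test_function Omega phi : Prop :=
  [/\ smooth phi,
      compact (closure [set x | phi x != 0]) &
      closure [set x | phi x != 0] `<=` Omega].

Definition L2 Omega f : Prop :=
  measurable_fun (Omega : set (measurableTypeR R * measurableTypeR R)) f /\
  (\int[area]_(x in Omega) ((f x) ^+ 2)%:E < +oo)%E.

Definition is_weak_partials Omega (s : seq 'I_2) u g : Prop :=
  forall phi, test_function Omega phi ->
    \int[area]_(x in Omega) (u x * partials s phi x) =
    (-1) ^+ size s * \int[area]_(x in Omega) (g x * phi x).

(* A representative of the square-integrable weak derivative, which is unique
   up to a null subset of Omega; the zero function if there is none. *)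
Definition weak_partials Omega (s : seq 'I_2) u : R * R -> R :=
  xget (fun=> 0) [set g | L2 Omega g /\ is_weak_partials Omega s u g].

Definition H2 Omega u : Prop :=
  L2 Omega u /\
  forall s : seq 'I_2, (size s <= 2)%N ->
    exists g, L2 Omega g /\ is_weak_partials Omega s u g.

(* H^2_0(Omega): the closure of the test functions in H^2(Omega). *)
Definition H20 Omega u : Prop :=
  H2 Omega u /\
  exists phi : nat -> R * R -> R,
    (forall n, test_function Omega (phi n)) /\
    forall s : seq 'I_2, (size s <= 2)%N ->
      (\int[area]_(x in Omega)
         ((partials s (phi n) x - weak_partials Omega s u x) ^+ 2)%:E)%E
        @[n --> \oo] --> 0%E.

Definition nonzero_on Omega u : Prop :=
  ~ {ae area, forall x, Omega x -> u x = 0}.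

Definition laplacian Omega u : R * R -> R :=
  fun x => \sum_(i < 2) weak_partials Omega [:: i; i] u x.

Definition sqr_norm_grad Omega u : R * R -> R :=
  fun x => \sum_(i < 2) (weak_partials Omega [:: i] u x) ^+ 2.

Definition rayleigh Omega (tau : R) v : R :=
  (\int[area]_(x in Omega) (laplacian Omega v x) ^+ 2 +
     tau * \int[area]_(x in Omega) sqr_norm_grad Omega v x) /
  \int[area]_(x in Omega) (v x) ^+ 2.

(* For Omega open and nonempty of finite area the infimum is a minimum. It is
   taken over a nonempty set, which is bounded below by 0 if 0 <= tau. *)
Definition Gamma Omega (tau : R) : R :=
  inf [set rayleigh Omega tau v | v in [set v | H20 Omega v /\
                                               nonzero_on Omega v]].

Definition noncollinear (a b c : R * R) : Prop :=
  (b.1 - a.1) * (c.2 - a.2) - (b.2 - a.2) * (c.1 - a.1) != 0.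

(* The interior of the convex hull of a, b, c: all barycentric coordinates are
   positive. *)
Definition open_triangle (a b c : R * R) : set (R * R) :=
  [set p | exists l m n : R,
     [/\ 0 < l, 0 < m, 0 < n, l + m + n = 1 &
         p = l *: a + m *: b + n *: c]].

Definition is_triangle (T : set (R * R)) : Prop :=
  exists a b c, noncollinear a b c /\ T = open_triangle a b c.

(* Written with coordinates because the norm of R * R is the maximum norm. *)
Definition open_disk (c : R * R) (r : R) : set (R * R) :=
  [set p | (p.1 - c.1) ^+ 2 + (p.2 - c.2) ^+ 2 < r ^+ 2].

Definition is_disk (B : set (R * R)) : Prop :=
  exists c r, 0 < r /\ B = open_disk c r.

End Plane.

(* Main.v *)
(* On the disk of radius r, the trial function 5 y^2 - y^3 with
   y = 1 - |x - c|^2 / r^2 yields Gamma <= K1 / r^4 + K2 tau / r^2, where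
   K1 = 41216/365 and K2 = 2366/365. It remains to show that on a triangle of
   the same area the two Rayleigh quotients of Delta^2 and -Delta are at least
   K1 / r^4 and K2 / r^2; it suffices to do so for test functions.

   Place the longest side on the base and let t be the distance to the apex in
   units of the height h. On each slice parallel to the base, the Poincare and
   the clamped beam inequalities bound the base derivatives of f from below by
   weights c f^2 / t^2 and d f^2 / t^4; the remaining inequalities in the
   direction of h are of Hardy and Rellich type on (0, 1). (For Delta^2, two
   integrations by parts turn the product of the two pure second derivatives
   into the square of the mixed one.) Each one-dimensional inequality is
   certified by completing squares, up to the derivative of a function of
   compact support. The ratio of the height to the base lies in [0, sqrt 3 / 2],
   and the constants suffice for every such ratio. *)
Require Import Defs.
From mathcomp Require Import all_boot all_order all_algebra.
From mathcomp Require Import all_classical all_reals all_analysis.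
From mathcomp Require Import measurable_realfun.
From mathcomp Require Import ring lra.

Set Implicit Arguments.
Unset Strict Implicit.
Unset Printing Implicit Defensive.
Import Order.TTheory GRing.Theory Num.Theory.
Import numFieldNormedType.Exports.
Local Open Scope classical_set_scope.
Local Open Scope ring_scope.

(** * Smooth functions *)

Lemma near_eq_differentiable (K : numFieldType) (V W : normedModType K)
    (f g : V -> W) (x : V) : {near x, f =1 g} ->
  differentiable f x -> differentiable g x.
Proof.
move=> fg df; have [cdf fE] := (diff_locallyP x f).1 df.
have gE : g \o shift x = cst (g x) + 'd f x +o_ 0 id.
  apply/eqaddoP => e e0; move/eqaddoP: fE => /(_ _ e0).
  have : \forall y \near 0, f (y + x) = g (y + x).
    by move: fg; rewrite (near_shift 0) subr0.
  by apply: filterS2 => y /=; rewrite !fctE /= => ->; rewrite (nbhs_singleton fg).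
by apply/diff_locallyP; rewrite (diff_unique cdf gE).
Qed.

Lemma ord2_cases (i : 'I_2) : i = 0 \/ i = 1.
Proof. by case: i => [[|[|//]] lt]; [left|right]; exact/val_inj. Qed.

Lemma sum_ord2 (V : nmodType) (F : 'I_2 -> V) : \sum_(i < 2) F i = F 0 + F 1.
Proof. by rewrite !big_ord_recl big_ord0 addr0; congr (F _ + F _); exact/val_inj. Qed.

Section SmoothFunctions.
Context {R : realType}.
Implicit Types (f g phi : R * R -> R) (v x : R * R) (Omega : set (R * R)).

Lemma derive_partials f v x : differentiable f x ->
  'D_v f x = v.1 * partial 0 f x + v.2 * partial 1 f x.
Proof.
move=> df; rewrite /partial !deriveE//.
have {1}-> : v = v.1 *: basis_vec 0 + v.2 *: basis_vec 1.
  by case: v => a b; rewrite /basis_vec /=; congr pair => /=;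
    rewrite /GRing.scale /= mulr1 mulr0 ?addr0 ?add0r.
by rewrite linearD !linearZ.
Qed.

Lemma differentiable_fst x : differentiable (fst : R * R -> R) x.
Proof. by apply: linear_differentiable => y; exact: cvg_fst. Qed.

Lemma differentiable_snd x : differentiable (snd : R * R -> R) x.
Proof. by apply: linear_differentiable => y; exact: cvg_snd. Qed.

Lemma is_derive_fst x v : is_derive x v (fst : R * R -> R) v.1.
Proof.
apply: DeriveDef; first exact/diff_derivable/differentiable_fst.
rewrite deriveE; last exact: differentiable_fst.
by rewrite diff_lin// => ?; exact: cvg_fst.
Qed.

Lemma is_derive_snd x v : is_derive x v (snd : R * R -> R) v.2.
Proof.
apply: DeriveDef; first exact/diff_derivable/differentiable_snd.
rewrite deriveE; last exact: differentiable_snd.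
by rewrite diff_lin// => ?; exact: cvg_snd.
Qed.

Lemma partials_rcons s i f : partials (rcons s i) f = partials s (partial i f).
Proof. by rewrite /partials -cats1 foldr_cat. Qed.

Lemma partials_cat s t f : partials (s ++ t) f = partials s (partials t f).
Proof. by rewrite /partials foldr_cat. Qed.

Lemma smooth_partials s f : smooth f -> smooth (partials s f).
Proof. by move=> sf t x; rewrite -partials_cat. Qed.

Lemma smooth_differentiable f x : smooth f -> differentiable f x.
Proof. by move=> /(_ [::] x). Qed.

Lemma smooth_continuous f : smooth f -> continuous f.
Proof. by move=> sf x; exact/differentiable_continuous/smooth_differentiable. Qed.

Inductive alg (base : set (R * R -> R)) : set (R * R -> R) :=
| alg_base f : base f -> alg base f
| alg_cst c : alg base (cst c)
| alg_add f g : alg base f -> alg base g -> alg base (f + g)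
| alg_mul f g : alg base f -> alg base g -> alg base (f * g).

Lemma partialD i f g : (forall x, differentiable f x) ->
  (forall x, differentiable g x) -> partial i (f + g) = partial i f + partial i g.
Proof.
move=> df dg; apply/funext => x; rewrite /partial deriveD//;
  exact: diff_derivable.
Qed.

Lemma partialM i f g : (forall x, differentiable f x) ->
  (forall x, differentiable g x) ->
  partial i (f * g) = f * partial i g + g * partial i f.
Proof.
move=> df dg; apply/funext => x; rewrite /partial deriveM//;
  exact: diff_derivable.
Qed.

Lemma partial_cst i (c : R) : partial i (cst c) = cst 0.
Proof. by apply/funext => x; rewrite /partial derive_cst. Qed.

Lemma alg_smooth (base : set (R * R -> R)) :
  (forall f, base f -> (forall x, differentiable f x) /\
     forall i, alg base (partial i f)) ->
  forall f, alg base f -> smooth f.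
Proof.
move=> hb.
have H f : alg base f -> (forall x, differentiable f x) /\
    forall i, alg base (partial i f).
  elim=> {f}[f /hb//|c|f g _ [df pf] _ [dg pg]|f g af [df pf] ag [dg pg]].
  - split=> [x|i]; first exact: differentiable_cst.
    by rewrite partial_cst; exact: alg_cst.
  - split=> [x|i]; first exact: differentiableD.
    by rewrite partialD//; exact: alg_add.
  - split=> [x|i]; first exact: differentiableM.
    by rewrite partialM//; apply: alg_add; exact: alg_mul.
move=> f af s x; suff : alg base (partials s f) by move=> /H[].
by elim: s => [//|i s IH] /=; have [_] := H _ IH.
Qed.

Definition derivs (fs : set (R * R -> R)) : set (R * R -> R) :=
  [set g | exists2 f, fs f & exists s, g = partials s f].

Lemma alg_derivs_smooth fs : (forall f, fs f -> smooth f) ->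
  forall g, alg (derivs fs) g -> smooth g.
Proof.
move=> sf; apply: alg_smooth => g [f hf [s gE]]; rewrite {}gE.
split=> [x|i]; first exact: (sf _ hf).
by apply: alg_base; exists f => //; exists (i :: s).
Qed.

Lemma smoothD f g : smooth f -> smooth g -> smooth (f + g).
Proof.
move=> sf sg; apply: (@alg_derivs_smooth [set f; g]); first by move=> h; case=> ->.
by apply: alg_add; apply: alg_base; [exists f|exists g]; [left|exists [::]|right|exists [::]].
Qed.

Lemma smoothM f g : smooth f -> smooth g -> smooth (f * g).
Proof.
move=> sf sg; apply: (@alg_derivs_smooth [set f; g]); first by move=> h; case=> ->.
by apply: alg_mul; apply: alg_base; [exists f|exists g]; [left|exists [::]|right|exists [::]].
Qed.

Lemma smooth_cst c : smooth (cst c : R * R -> R).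
Proof. by apply: (@alg_derivs_smooth set0) => //; exact: alg_cst. Qed.

Lemma partial_fst i : partial i (fst : R * R -> R) = cst (basis_vec i).1.
Proof. by apply/funext => x; rewrite /partial (@derive_val _ _ _ _ _ _ _ (is_derive_fst _ _)). Qed.

Lemma partial_snd i : partial i (snd : R * R -> R) = cst (basis_vec i).2.
Proof. by apply/funext => x; rewrite /partial (@derive_val _ _ _ _ _ _ _ (is_derive_snd _ _)). Qed.

Lemma smooth_fst : smooth (fst : R * R -> R).
Proof.
apply: (@alg_smooth [set (fst : R * R -> R)]); last exact: alg_base.
move=> _ ->; split=> [|i]; first exact: differentiable_fst.
by rewrite partial_fst; exact: alg_cst.
Qed.

Lemma smooth_snd : smooth (snd : R * R -> R).
Proof.
apply: (@alg_smooth [set (snd : R * R -> R)]); last exact: alg_base.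
move=> _ ->; split=> [|i]; first exact: differentiable_snd.
by rewrite partial_snd; exact: alg_cst.
Qed.

Definition affine (a b c : R) : R * R -> R := fun x => a * x.1 + b * x.2 + c.

Lemma smooth_affine a b c : smooth (affine a b c).
Proof.
have -> : affine a b c = cst a * fst + cst b * snd + cst c :> (R * R -> R) by [].
by do ![exact: smooth_cst|exact: smooth_fst|exact: smooth_snd|apply: smoothD|apply: smoothM].
Qed.

Lemma is_derive_affine a b c x v :
  is_derive x v (affine a b c) (a * v.1 + b * v.2).
Proof.
have -> : affine a b c = a \*: fst + b \*: snd + cst c :> (R * R -> R) by [].
have h1 := is_derive_fst x v; have h2 := is_derive_snd x v.
by apply: is_derive_eq; rewrite addr0.
Qed.

Lemma smooth_derive f v : smooth f -> smooth (fun x => 'D_v f x).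
Proof.
move=> sf.
have -> : (fun x => 'D_v f x) = cst v.1 * partial 0 f + cst v.2 * partial 1 f.
  by apply/funext => x; rewrite derive_partials//; exact: smooth_differentiable.
by apply: smoothD; apply: smoothM; rewrite ?smooth_cst//;
  [exact: smooth_cst|exact: (@smooth_partials [:: 0])|exact: smooth_cst|exact: (@smooth_partials [:: 1])].
Qed.

End SmoothFunctions.

(** * Test functions *)

Section TestFunctions.
Context {R : realType}.
Implicit Types (f g phi psi : R * R -> R) (v x : R * R) (Omega K : set (R * R)).

Lemma partials_out K s f : closed K -> (forall x, ~ K x -> f x = 0) ->
  forall x, ~ K x -> partials s f x = 0.
Proof.
move=> cK f0; elim: s => [//|i s IH] x Kx /=.
rewrite /partial (@near_eq_derive _ _ _ _ (cst 0)) ?derive_cst//.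
by apply: filterS (open_nbhs_nbhs (conj (closed_openC cK) Kx)) => y /IH.
Qed.

Lemma test_functionI Omega K f : smooth f -> compact K -> K `<=` Omega ->
  (forall x, ~ K x -> f x = 0) -> test_function Omega f.
Proof.
move=> sf cK KO f0.
have clK : closed K by apply: compact_closed cK; exact: norm_hausdorff.
have sub : closure [set x | f x != 0] `<=` K.
  rewrite closureE => x; apply; split=> // y /= /eqP fy.
  by apply: contrapT => /f0.
split=> //; last exact: subset_trans KO.
by apply: subclosed_compact cK sub; exact: closed_closure.
Qed.

Lemma test_out Omega phi x : test_function Omega phi ->
  ~ closure [set x | phi x != 0] x -> phi x = 0.
Proof.
by move=> _ /(contra_not (@subset_closure _ _ _)) /negP; rewrite negbK => /eqP.
Qed.

Lemma test_partials_out Omega s phi x : test_function Omega phi ->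
  ~ closure [set x | phi x != 0] x -> partials s phi x = 0.
Proof.
move=> tphi; apply: partials_out; first exact: closed_closure.
by move=> y; exact: test_out tphi.
Qed.

Lemma test_eq0 Omega phi x : test_function Omega phi -> ~ Omega x -> phi x = 0.
Proof. by move=> tphi Ox; apply: (test_out tphi) => Kx; case: tphi => _ _ /(_ _ Kx). Qed.

Lemma test_smooth Omega phi : test_function Omega phi -> smooth phi.
Proof. by case. Qed.

Lemma test_differentiable Omega phi x : test_function Omega phi -> differentiable phi x.
Proof. by move=> /test_smooth; exact: smooth_differentiable. Qed.

Lemma test_partials Omega s phi : test_function Omega phi ->
  test_function Omega (partials s phi).
Proof.
move=> tphi; have [sphi cphi sub] := tphi.
apply: (test_functionI _ cphi sub); first exact: smooth_partials.
by move=> x; exact: test_partials_out tphi.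
Qed.

Lemma test_derive Omega v phi : test_function Omega phi ->
  test_function Omega (fun x => 'D_v phi x).
Proof.
move=> tphi; have [sphi cphi sub] := tphi.
apply: (test_functionI _ cphi sub); first exact: smooth_derive.
move=> x Kx; rewrite derive_partials; last exact: smooth_differentiable.
have p0 i : partial i phi x = 0 by exact: (test_partials_out [:: i] tphi Kx).
by rewrite !p0 !mulr0 addr0.
Qed.

Lemma testD Omega f g : test_function Omega f -> test_function Omega g ->
  test_function Omega (f + g).
Proof.
move=> tf tg; have [sf cf subf] := tf; have [sg cg subg] := tg.
apply: (@test_functionI _ (closure [set x | f x != 0] `|` closure [set x | g x != 0])).
- exact: smoothD.
- exact: compactU.
- by rewrite subUset.
- by move=> x /not_orP[fx gx]; rewrite !fctE (test_out tf fx) (test_out tg gx) addr0.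
Qed.

Lemma testMl Omega f g : smooth f -> test_function Omega g ->
  test_function Omega (f * g).
Proof.
move=> sf tg; have [sg cg subg] := tg.
apply: (test_functionI _ cg subg); first exact: smoothM.
by move=> x gx; rewrite !fctE (test_out tg gx) mulr0.
Qed.

Lemma testM Omega f g : test_function Omega f -> test_function Omega g ->
  test_function Omega (f * g).
Proof. by move=> /test_smooth; exact: testMl. Qed.

Lemma testZ Omega c f : test_function Omega f -> test_function Omega (cst c * f).
Proof. by apply: testMl; exact: smooth_cst. Qed.

Section Quotient.
Variables (Omega : set (R * R)) (a b c : R).
Let l := affine a b c.
Hypothesis l_neq0 : forall x, Omega x -> l x != 0.
Let q k psi : R * R -> R := (fun x => (l x)^-1) ^+ k * psi.

Let is_derive_q k psi x v : test_function Omega psi -> Omega x ->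
  differentiable (q k psi) x /\ 'D_v (q k psi) x = q k (fun y => 'D_v psi y) x +
    (- k%:R * (a * v.1 + b * v.2)) * q k.+1 psi x.
Proof.
move=> tpsi Ox.
have dl : differentiable l x by exact/smooth_differentiable/smooth_affine.
have dlV : differentiable (fun x => (l x)^-1) x by apply: differentiableV => //; exact: l_neq0.
have dlX : differentiable ((fun x => (l x)^-1) ^+ k) x.
  by case: k => [|k]; [rewrite expr0; exact: differentiable_cst|exact: differentiableX].
have dpsi := test_differentiable x tpsi.
split; first exact: differentiableM.
rewrite /q deriveM; [|exact: diff_derivable..].
rewrite (@deriveX _ _ (fun x => (l x)^-1)); last exact: diff_derivable.
rewrite (@deriveV _ _ l); [|exact: l_neq0|exact: diff_derivable].
rewrite (@derive_val _ _ _ _ _ _ _ (is_derive_affine a b c x v)).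
rewrite !fctE /GRing.scale /=; congr (_ + _).
case: k {dlX} => [|k]; first by rewrite mul0r !mul0r oppr0 !mul0r mulr0.
move=> /=; rewrite -[(l x ^+ 2)^-1]exprVn !exprS; ring.
Qed.

Let q_out k psi x : test_function Omega psi -> ~ Omega x ->
  \forall y \near x, q k psi y = 0.
Proof.
move=> tpsi Ox; have [_ _ sub] := tpsi.
have Kx : (~` closure [set x | psi x != 0]) x by move/sub.
have oK := closed_openC (@closed_closure _ [set x | psi x != 0]).
apply: filterS (open_nbhs_nbhs (conj oK Kx)) => y Ky.
by rewrite /q fctE (test_out tpsi Ky) mulr0.
Qed.

Let q_smooth psi : test_function Omega psi -> smooth (q 1 psi).
Proof.
move=> tpsi; apply: (@alg_smooth _
  [set g | exists k f, test_function Omega f /\ g = q k f]); last first.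
  by apply: alg_base; exists 1%N, psi.
move=> _ [k [f [tf ->]]]; split=> [x|i].
  have [Ox|Ox] := pselect (Omega x); first by case: (is_derive_q k 0 tf Ox).
  apply: (near_eq_differentiable (f := cst 0)) (differentiable_cst _ _).
  by apply: filterS (q_out k tf Ox).
pose w : R := a * (basis_vec i).1 + b * (basis_vec i).2.
have -> : partial i (q k f) = q k (partials [:: i] f) + cst (- k%:R * w) * q k.+1 f.
  apply/funext => x; have [Ox|Ox] := pselect (Omega x).
    by case: (is_derive_q k (basis_vec i) tf Ox).
  rewrite /partial (near_eq_derive _ (q_out k tf Ox)) derive_cst.
  have p0 : partials [:: i] f x = 0 by exact: (test_eq0 (test_partials [:: i] tf)).
  by rewrite /q !fctE p0 (test_eq0 tf Ox) !mulr0 addr0.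
apply: alg_add; first by apply: alg_base; exists k, (partials [:: i] f); split=> //; exact: test_partials.
by apply: alg_mul; [exact: alg_cst|apply: alg_base; exists k.+1, f].
Qed.

Lemma test_div psi : test_function Omega psi ->
  test_function Omega ((fun x => (affine a b c x)^-1) * psi).
Proof.
move=> tpsi; have [_ cK sub] := tpsi.
apply: (test_functionI _ cK sub) => [|x Kx].
  exact: q_smooth.
by rewrite fctE (test_out tpsi Kx) mulr0.
Qed.

End Quotient.

(* c is a multiplier if multiplication by c maps test functions on Omega to
   test functions on Omega: it may blow up at the boundary. *)
Definition multiplier Omega (c : R * R -> R) : Prop :=
  forall psi, test_function Omega psi -> test_function Omega (c * psi).

Lemma multiplierD Omega f g : multiplier Omega f -> multiplier Omega g -> multiplier Omega (f + g).
Proof. by move=> cf cg psi t; rewrite mulrDl; apply: testD; [exact: cf|exact: cg]. Qed.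

Lemma multiplierM Omega f g : multiplier Omega f -> multiplier Omega g -> multiplier Omega (f * g).
Proof. by move=> cf cg psi t; rewrite -mulrA; exact/cf/cg. Qed.

Lemma multiplier_smooth Omega f : smooth f -> multiplier Omega f.
Proof. by move=> sf psi; exact: testMl. Qed.

Lemma multiplier_cst Omega c : multiplier Omega (cst c).
Proof. exact/multiplier_smooth/smooth_cst. Qed.

Lemma multiplier_affine Omega a b c : multiplier Omega (affine a b c).
Proof. exact/multiplier_smooth/smooth_affine. Qed.

Lemma multiplier_inv Omega a b c : (forall x, Omega x -> affine a b c x != 0) ->
  multiplier Omega (fun x => (affine a b c x)^-1).
Proof. by move=> l0 psi; exact: test_div. Qed.

End TestFunctions.

(** * Integration by parts in the plane *)

Section Slices.
Context {R : realType}.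
Implicit Types (f : R * R -> R).

Lemma is_derive_slice1 f (x y : R) : differentiable f (x, y) ->
  is_derive x 1 (fun t => f (t, y)) (partial 0 f (x, y)).
Proof.
move=> df; have [d <-] : is_derive (x, y) (basis_vec 0) f (partial 0 f (x, y)).
  by apply: derivableP; exact: diff_derivable.
have E : (fun h => h^-1 *: (f (h *: basis_vec 0 + (x, y)) - f (x, y))) =
  (fun h => h^-1 *: ((fun t => f (t, y)) (h *: (1 : R) + x) - f (x, y))).
  apply/funext => h; congr (_ *: (f _ - _)).
  by congr pair; rewrite /= ?[_ *: 0]mulr0 ?add0r.
apply: DeriveDef; first by move: d; rewrite /derivable /= E.
by rewrite /derive /= -E.
Qed.

Lemma is_derive_slice2 f (x y : R) : differentiable f (x, y) ->
  is_derive y 1 (fun t => f (x, t)) (partial 1 f (x, y)).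
Proof.
move=> df; have [d <-] : is_derive (x, y) (basis_vec 1) f (partial 1 f (x, y)).
  by apply: derivableP; exact: diff_derivable.
have E : (fun h => h^-1 *: (f (h *: basis_vec 1 + (x, y)) - f (x, y))) =
  (fun h => h^-1 *: ((fun t => f (x, t)) (h *: (1 : R) + y) - f (x, y))).
  apply/funext => h; congr (_ *: (f _ - _)).
  by congr pair; rewrite /= ?[_ *: 0]mulr0 ?add0r.
apply: DeriveDef; first by move: d; rewrite /derivable /= E.
by rewrite /derive /= -E.
Qed.

Lemma continuous_slice1 f y : continuous f -> continuous (fun t => f (t, y)).
Proof.
move=> cf t; apply: (cvg_comp (fun t => (t, y)) f _ (cf (t, y))).
exact: (cvg_pair cvg_id (cvg_cst _)).
Qed.

Lemma continuous_slice2 f x : continuous f -> continuous (fun t => f (x, t)).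
Proof.
move=> cf t; apply: (cvg_comp (fun t => (x, t)) f _ (cf (x, t))).
exact: (cvg_pair (cvg_cst _) cvg_id).
Qed.

Lemma integral_derive_compact (g g' : R -> R) (M : R) : 0 < M ->
  (forall t : R, is_derive t (1 : R) g (g' t)) -> continuous g' ->
  (forall t : R, M <= `|t| -> g t = 0 /\ g' t = 0) ->
  (\int[lebesgue_measure]_t (g' t)%:E = 0)%E.
Proof.
move=> M0 dg cg' gM.
have cg : continuous g.
  by move=> t; apply: differentiable_continuous; apply/derivable1_diffP; case: (dg t).
have -> : (fun t => (g' t)%:E) = (fun t => (g' t)%:E) \_ `[- M, M].
  apply/funext => t; rewrite /patch; case: ifPn => // /negP tM.
  rewrite (gM t _).2// leNgt; apply/negP; rewrite ltr_norml => /andP[h1 h2].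
  by apply: tM; rewrite inE /= in_itv /= !ltW.
rewrite -integral_mkcond (@continuous_FTC2 _ g' g).
- by rewrite !(gM _ _).1 ?subee// ?normrN ger0_norm// ltW.
- by lra.
- exact: continuous_subspaceT.
- split; first by move=> t _; case: (dg t).
  + by apply: cvg_at_right_filter; exact: cg.
  + by apply: cvg_at_left_filter; exact: cg.
- by move=> t _; rewrite derive1E; case: (dg t).
Qed.

End Slices.

Section PlaneMeasure.
Context {R : realType}.
Notation plane := (measurableTypeR R * measurableTypeR R)%type.
Notation mu := (@lebesgue_measure R).
Implicit Types (f phi : R * R -> R) (v x : R * R) (Omega : set (R * R)) (a b c d : R).

Definition box a b c d : set (R * R) := `]a, b[ `*` `]c, d[.

Definition closed_box a b c d : set (R * R) := `[a, b] `*` `[c, d].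

Lemma measurable_box a b c d : measurable (box a b c d : set plane).
Proof. exact: measurableX. Qed.

Lemma open_rat_box (U : set (R * R)) x : open U -> U x ->
  exists q : rat * rat * (rat * rat),
    box (ratr q.1.1) (ratr q.1.2) (ratr q.2.1) (ratr q.2.2) x /\
    closed_box (ratr q.1.1) (ratr q.1.2) (ratr q.2.1) (ratr q.2.2) `<=` U.
Proof.
move=> oU Ux; have /nbhs_ballP[e /= e0 xe] := open_nbhs_nbhs (conj oU Ux).
have ex (z : R) : exists q : rat * rat,
    (z - e < ratr q.1 < z) /\ (z < ratr q.2 < z + e).
  have /rat_in_itvoo[q1 h1] : z - e < z by lra.
  have /rat_in_itvoo[q2 h2] : z < z + e by lra.
  by exists (q1, q2); rewrite !in_itv /= in h1 h2.
have [q1 [/andP[? ?] /andP[? ?]]] := ex x.1.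
have [q2 [/andP[? ?] /andP[? ?]]] := ex x.2.
exists (q1, q2); split; first by split; rewrite /= in_itv /=; apply/andP; split; lra.
move=> y [] /=; rewrite !in_itv /= => /andP[? ?] /andP[? ?]; apply: xe.
by split; rewrite /ball /= ltr_norml; lra.
Qed.

Lemma measurable_open_plane (U : set (R * R)) : open U -> measurable (U : set plane).
Proof.
move=> oU.
pose P (q : rat * rat * (rat * rat)) (C : R -> R -> R -> R -> set (R * R)) :=
  C (ratr q.1.1) (ratr q.1.2) (ratr q.2.1) (ratr q.2.2).
have -> : U = \bigcup_q (if `[< P q closed_box `<=` U >] then P q box else set0).
  apply/seteqP; split=> [x Ux|x [q _]].
    by have [q [qx sub]] := open_rat_box oU Ux; exists q => //; case: asboolP.
  by case: asboolP => // sub [x1 x2]; apply: sub; split; [move: x1|move: x2];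
    rewrite /= !in_itv /= => /andP[/ltW -> /ltW ->].
apply: countable_bigcupT_measurable; first exact: countableP.
by move=> q; case: ifP => // _; exact: measurable_box.
Qed.

Lemma measurable_fun_continuous f : continuous f ->
  measurable_fun setT (f : plane -> R).
Proof.
move=> cf; apply: (measurability _ (measurable_realfun.RGenOpens.measurableE R)).
move=> _ [_ [a [b ->] <-]]; rewrite setTI; apply: measurable_open_plane.
by move/continuousP: cf; apply; exact: interval_open.
Qed.

Lemma area_setX (A B : set (measurableTypeR R)) : measurable A -> measurable B ->
  area (A `*` B) = (mu A * mu B)%E.
Proof. by move=> mA mB; exact: product_measure1E. Qed.

Lemma area_closed_box a b c d : (area (closed_box a b c d : set plane) < +oo)%E.
Proof.
rewrite area_setX// !lebesgue_measure_itv /=.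
by case: ifP; case: ifP => _ _; rewrite -?EFinM ?ltry ?mule0 ?mul0e.
Qed.

Lemma test_bounded Omega phi : test_function Omega phi ->
  exists2 M, 0 < M & forall x, `|phi x| <= M /\
    (M <= `|x.1| \/ M <= `|x.2| -> forall s, partials s phi x = 0).
Proof.
move=> tphi; have [sphi cK _] := tphi; set K := closure _ in cK.
have [M1 [_ hM1]] := compact_bounded cK.
have cphi : {within K, continuous phi}.
  by apply: continuous_subspaceT; exact: smooth_continuous.
have [M2 [_ hM2]] := compact_bounded (continuous_compact cphi cK).
pose N := Num.max M1 M2 + 1; pose M := Num.max N 0 + 1.
have N1 : M1 < N by rewrite ltr_pwDr// le_max lexx.
have N2 : M2 < N by rewrite ltr_pwDr// le_max lexx orbT.
have NM : N < M by rewrite ltr_pwDr// le_max lexx.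
have M0 : 0 < M by rewrite ltr_pwDr// le_max lexx orbT.
exists M => // x; have [Kx|Kx] := pselect (K x); last first.
  by rewrite (test_out tphi Kx) normr0; split=> [|_ s];
    [exact: ltW|exact: test_partials_out tphi Kx].
split; first by apply: (le_trans _ (ltW NM)); apply: (hM2 N) => //; exists x.
have := hM1 N N1 _ Kx; rewrite /= prod_normE ge_max => /andP[x1 x2].
by case=> h; exfalso; lra.
Qed.

Lemma test_integrable Omega phi (D : set plane) : measurable D ->
  test_function Omega phi -> area.-integrable D (EFin \o phi).
Proof.
move=> mD tphi; have [M M0 hM] := test_bounded tphi.
pose Q : set plane := closed_box (- M) M (- M) M.
have mQ : measurable Q by exact: measurableX.
have -> : phi = phi \_ Q.
  apply/funext => x; rewrite patchE; case: ifPn => // /negP xM.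
  apply: ((hM x).2 _ [::]); apply: contrapT => /not_orP[] /negP h1 /negP h2.
  move: h1 h2; rewrite -!ltNge !ltr_norml => /andP[? ?] /andP[? ?].
  by apply: xM; rewrite inE; split; rewrite /= in_itv /= !ltW.
apply: (integrableS measurableT) => //; rewrite -restrict_EFin.
apply/(integrable_mkcond _ mQ).1/measurable_bounded_integrable.
- exact: mQ.
- exact: area_closed_box.
- apply: measurable_funS (measurable_fun_continuous _) => //.
  exact/smooth_continuous/(test_smooth tphi).
- exists M; split; first exact: num_real.
  by move=> N MN x _ /=; apply: le_trans (ltW MN); case: (hM x).
Qed.

Lemma integral_test_partial Omega phi i : test_function Omega phi ->
  \int[area]_x partial i phi x = 0.
Proof.
move=> tphi; have [M M0 hM] := test_bounded tphi.
have tp := test_partials [:: i] tphi.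
have ip := test_integrable measurableT tp.
have sp := test_smooth tp; have cp := smooth_continuous sp.
have [i0|i1] := ord2_cases i.
- rewrite /Rintegral -integral21_prod_meas1//= [X in fine X](_ : _ = 0%E)//.
  apply: integral0_eq => y _.
  apply: (@integral_derive_compact _ (fun t => phi (t, y)) (fun t => partial i phi (t, y)) M) => //.
    + by move=> t; rewrite i0; exact/is_derive_slice1/(test_differentiable _ tphi).
    + exact: continuous_slice1.
    + by move=> t tM; split; [apply: ((hM (t, y)).2 _ [::])|apply: ((hM (t, y)).2 _ [:: i])]; left.
- rewrite /Rintegral -integral12_prod_meas1//= [X in fine X](_ : _ = 0%E)//.
  apply: integral0_eq => y _.
  apply: (@integral_derive_compact _ (fun t => phi (y, t)) (fun t => partial i phi (y, t)) M) => //.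
    + by move=> t; rewrite i1; exact/is_derive_slice2/(test_differentiable _ tphi).
    + exact: continuous_slice2.
    + by move=> t tM; split; [apply: ((hM (y, t)).2 _ [::])|apply: ((hM (y, t)).2 _ [:: i])]; right.
Qed.

Lemma Rintegral_test_setT Omega phi : test_function Omega phi ->
  \int[area]_(x in (Omega : set plane)) phi x = \int[area]_x phi x.
Proof.
move=> tphi; rewrite Rintegral_mkcond; apply: eq_Rintegral => x _.
by rewrite patchE; case: ifPn => // /negP h; rewrite (test_eq0 tphi)// => Ox; apply: h; rewrite inE.
Qed.

Lemma integral_test_derive Omega phi v : test_function Omega phi ->
  \int[area]_(x in (Omega : set plane)) 'D_v phi x = 0.
Proof.
move=> tphi; rewrite (Rintegral_test_setT (test_derive v tphi)).
under eq_Rintegral => x _ do rewrite (derive_partials _ (test_differentiable _ tphi)).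
have ip i := test_integrable measurableT (test_partials [:: i] tphi).
have ipz i c := test_integrable measurableT (testZ c (test_partials [:: i] tphi)).
rewrite RintegralD//; [|exact: ipz|exact: ipz].
rewrite !RintegralZl//; [|exact: ip|exact: ip].
by rewrite !(integral_test_partial _ tphi) !mulr0 addr0.
Qed.

End PlaneMeasure.

(** * Certificates for one-dimensional inequalities *)

Section HasDerive.
Context {R : realType}.
Implicit Types (f g : R * R -> R) (v x : R * R).

Definition dird v f : R * R -> R := fun x => 'D_v f x.

(* Not a type class, unlike [is_derive]: instance resolution is slow here. *)
Variant has_derive v f x (df : R) : Prop := HasDerive of derivable f x v & 'D_v f x = df.

Lemma has_deriveP v f x df : is_derive x v f df -> has_derive v f x df.
Proof. by case. Qed.

Lemma has_derive_cst v c x : has_derive v (cst c) x 0.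
Proof. by split; [exact: derivable_cst|exact: derive_cst]. Qed.

Lemma has_deriveD v f g x df dg : has_derive v f x df -> has_derive v g x dg ->
  has_derive v (f + g) x (df + dg).
Proof.
move=> [hf <-] [hg <-]; split; first by have := derivableD hf hg.
by rewrite /dird; have -> := deriveD hf hg.
Qed.

Lemma has_deriveN v f x df : has_derive v f x df -> has_derive v (- f) x (- df).
Proof. by move=> [? <-]; split; [exact: derivableN|exact: deriveN]. Qed.

Lemma has_deriveM v f g x df dg : has_derive v f x df -> has_derive v g x dg ->
  has_derive v (f * g) x (df * g x + f x * dg).
Proof.
move=> [hf <-] [hg <-]; split; first by have := derivableM hf hg.
by rewrite /dird; have -> := deriveM hf hg; rewrite addrC; congr (_ + _); exact: mulrC.
Qed.

Lemma has_derive_eq v f x df df' : has_derive v f x df -> df = df' ->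
  has_derive v f x df'.
Proof. by move=> ? <-. Qed.

Lemma has_deriveX k v f x (df : R) : has_derive v f x df ->
  has_derive v (f ^+ k.+1) x (k.+1%:R * f x ^+ k * df).
Proof.
move=> h; elim: k => [|k IH]; first by rewrite expr0 !mul1r.
rewrite exprS; apply: has_derive_eq (has_deriveM h IH) _.
by rewrite !fctE -!natr1 !exprS; ring.
Qed.

Lemma has_derive_affine (a b c : R) v x : has_derive v (affine a b c) x (a * v.1 + b * v.2).
Proof. exact/has_deriveP/is_derive_affine. Qed.

Lemma has_derive_inv_affine (a b c : R) v x : affine a b c x != 0 ->
  has_derive v (fun y => (affine a b c y)^-1) x
    (- (a * v.1 + b * v.2) * (affine a b c x)^-1 ^+ 2).
Proof.
move=> l0; have [dl dE] := has_derive_affine a b c v x.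
split; first exact: derivableV.
by rewrite /dird deriveV// /GRing.scale /= [X in _ * X]dE exprVn mulNr mulNr mulrC.
Qed.

End HasDerive.

Ltac der := lazymatch goal with
  | |- has_derive _ (_ + _) _ _ => eapply has_deriveD; der
  | |- has_derive _ (_ * _) _ _ => eapply has_deriveM; der
  | |- has_derive _ (- _) _ _ => eapply has_deriveN; der
  | |- has_derive _ (cst _) _ _ => eapply has_derive_cst
  | |- _ => eassumption end.

Section Certificates.
Context {R : realType}.
Notation plane := (measurableTypeR R * measurableTypeR R)%type.
Variables (Omega : set (R * R)).
Hypothesis mOmega : measurable (Omega : set plane).
Implicit Types (f g phi psi A B C : R * R -> R) (v x : R * R).

Notation "''d_' v f" := (dird v f) (at level 10, v at level 8, f at level 8).
Notation test := (test_function Omega).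
Notation "'\I' f" := (\int[area]_(x in (Omega : set plane)) f x)
  (at level 36, f at level 36).

Lemma multiplierN f : multiplier Omega f -> multiplier Omega (- f).
Proof.
move=> cf; have -> : - f = cst (-1) * f by apply/funext => x; rewrite !fctE mulN1r.
refine (multiplierM (multiplier_cst (-1)) cf).
Qed.

Lemma test_dird v f : test f -> test ('d_v f).
Proof. exact: test_derive. Qed.

Lemma RintegralD_test f g : test f -> test g -> \I (f + g) = \I f + \I g.
Proof.
move=> tf tg.
by rewrite -(RintegralD mOmega (test_integrable mOmega tf) (test_integrable mOmega tg)).
Qed.

Lemma RintegralZ_test c f : test f -> \I (cst c * f) = c * \I f.
Proof.
by move=> tf; rewrite -(RintegralZl _ mOmega (test_integrable mOmega tf)).
Qed.

Lemma test_le f g G v : test f -> test g -> test G ->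
  (forall x, Omega x -> f x + 'd_v G x <= g x) -> \I f <= \I g.
Proof.
move=> tf tg tG le_fg.
rewrite -[leLHS]addr0 -(integral_test_derive v tG) -RintegralD_test//; last exact: test_dird.
have tfG := testD tf (test_dird v tG).
exact: (le_Rintegral mOmega (test_integrable mOmega tfG) (test_integrable mOmega tg)).
Qed.

Lemma has_derive_test v f x : test f -> has_derive v f x ('d_v f x).
Proof. by move=> tf; split=> //; apply/diff_derivable; exact: test_differentiable tf. Qed.

Lemma derive_quadratic v phi c1 c2 c3 x (d1 d2 d3 : R) : test phi ->
  has_derive v c1 x d1 -> has_derive v c2 x d2 -> has_derive v c3 x d3 ->
  let p := phi x in let p1 := 'd_v phi x in let p2 := 'd_v ('d_v phi) x in
  'd_v (c1 * ('d_v phi * 'd_v phi) + c2 * (phi * 'd_v phi) + c3 * (phi * phi)) x =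
  d1 * p1 ^+ 2 + c1 x * (2 * p1 * p2) + d2 * (p * p1) + c2 x * (p1 ^+ 2 + p * p2) +
  d3 * p ^+ 2 + c3 x * (2 * p * p1).
Proof.
move=> tphi h1 h2 h3 p p1 p2.
have hp := has_derive_test v x tphi.
have hp1 := has_derive_test v x (test_dird v tphi).
suff [] : has_derive v (c1 * ('d_v phi * 'd_v phi) + c2 * (phi * 'd_v phi) +
  c3 * (phi * phi)) x (d1 * p1 ^+ 2 + c1 x * (2 * p1 * p2) + d2 * (p * p1) +
  c2 x * (p1 ^+ 2 + p * p2) + d3 * p ^+ 2 + c3 x * (2 * p * p1)) by [].
by eapply has_derive_eq; [der|rewrite !fctE -/p1 -/p -/p2; ring].
Qed.

Lemma quadratic_le v phi c1 c2 c3 f g :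
  test phi -> multiplier Omega c1 -> multiplier Omega c2 -> multiplier Omega c3 ->
  test f -> test g ->
  (forall x, Omega x -> exists d1 d2 d3, [/\ has_derive v c1 x d1,
    has_derive v c2 x d2, has_derive v c3 x d3 & forall p p1 p2 : R,
    phi x = p -> 'd_v phi x = p1 -> 'd_v ('d_v phi) x = p2 ->
    f x + (d1 * p1 ^+ 2 + c1 x * (2 * p1 * p2) + d2 * (p * p1) +
    c2 x * (p1 ^+ 2 + p * p2) + d3 * p ^+ 2 + c3 x * (2 * p * p1)) <= g x]) ->
  \I f <= \I g.
Proof.
move=> tphi k1 k2 k3 tf tg hd.
have tphi' := test_dird v tphi.
apply: (@test_le _ _ (c1 * ('d_v phi * 'd_v phi) + c2 * (phi * 'd_v phi) + c3 * (phi * phi)) v) => //.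
  by apply: testD; [apply: testD; [apply: k1|apply: k2]|apply: k3]; exact: testM.
move=> x Ox; have [d1 [d2 [d3 [h1 h2 h3 le_fg]]]] := hd x Ox.
by rewrite (derive_quadratic tphi h1 h2 h3); exact: le_fg.
Qed.

Lemma linear_le v phi c f g : test phi -> multiplier Omega c -> test f -> test g ->
  (forall x, Omega x -> exists2 d, has_derive v c x d & forall p p1 : R,
    phi x = p -> 'd_v phi x = p1 ->
    f x + (d * p ^+ 2 + c x * (2 * p * p1)) <= g x) ->
  \I f <= \I g.
Proof.
move=> tphi mc tf tg hd.
have m0 := multiplier_cst (Omega := Omega) 0.
apply: (@quadratic_le v phi (cst 0) (cst 0) c) => // x Ox.
have [d h le_fg] := hd x Ox; exists 0, 0, d; split=> //; try exact: has_derive_cst.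
by move=> p p1 p2 pE p1E p2E; rewrite /= !mul0r !add0r; exact: le_fg.
Qed.

Ltac multac := lazymatch goal with
  | |- multiplier _ (_ + _) => apply: multiplierD; multac
  | |- multiplier _ (_ * _) => apply: multiplierM; multac
  | |- multiplier _ (- _) => apply: multiplierN; multac
  | |- multiplier _ (cst _) => exact: multiplier_cst
  | |- _ => assumption end.

(* Substituting [phi = (l1 l2)^2 f], with [A = 1 / l1] and [B = 1 / l2], makes
   [phi'' ^2 - 24 A^2 B^2 phi^2] a sum of squares up to a divergence. *)
Lemma second_derivative_ge v A B phi :
  multiplier Omega A -> multiplier Omega B ->
  (forall x, Omega x -> [/\ 0 < A x, 0 < B x, has_derive v A x (A x ^+ 2) &
     has_derive v B x (- B x ^+ 2)]) ->
  test phi ->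
  \I (cst 24 * (A * B) * (A * B) * (phi * phi)) <= \I ('d_v ('d_v phi) * 'd_v ('d_v phi)).
Proof.
move=> cA cB AB tphi.
have tphi1 := test_dird v tphi; have tphi2 := test_dird v tphi1.
pose c1 := cst 4 * (B - A).
pose c2 := cst 2 * (cst 8 * (A * B) - cst 6 * (A * A + B * B)).
pose c3 := cst 12 * (B * B * B - A * A * A) + cst 16 * (A * A * B - A * B * B).
have m1 : multiplier Omega c1 by rewrite /c1; multac.
have m2 : multiplier Omega c2 by rewrite /c2; multac.
have m3 : multiplier Omega c3 by rewrite /c3; multac.
have m4 : multiplier Omega (cst 24 * (A * B) * (A * B)) by multac.
have t1 : test (cst 24 * (A * B) * (A * B) * (phi * phi)) by apply: m4; exact: testM.
have t2 : test ('d_v ('d_v phi) * 'd_v ('d_v phi)) by exact: testM.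
apply: (@quadratic_le v phi c1 c2 c3 _ _ tphi m1 m2 m3 t1 t2) => x Ox.
have [A0 B0 hA hB] := AB x Ox.
do 3 eexists; split; [by rewrite /c1; der|by rewrite /c2; der|by rewrite /c3; der|].
move=> p p1 p2 pE p1E p2E; rewrite /c1 /c2 /c3 !fctE pE p2E.
set a := A x in A0 hA *; set b := B x in B0 hB *.
rewrite -subr_ge0; set X := (X in 0 <= X).
have -> : X = (p2 - 4 * (b - a) * p1 - (8 * a * b - 6 * (a ^+ 2 + b ^+ 2)) * p) ^+ 2 +
  16 * a * b * (p1 - 2 * (b - a) * p) ^+ 2 by rewrite /X; ring.
by rewrite addr_ge0 ?sqr_ge0// mulr_ge0 ?sqr_ge0// !mulr_ge0// ltW.
Qed.

(* On a segment of length 1 / C = l1 + l2, parametrized by l2, this is the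
   Poincare inequality with the constant pi^2 lowered to 49/5. *)
Lemma poincare_ge v A B C D phi :
  multiplier Omega A -> multiplier Omega B -> multiplier Omega C -> multiplier Omega D ->
  (forall x, Omega x -> exists a b, [/\ 0 < a /\ 0 < b, A x = a^-1 /\ B x = b^-1,
    C x = (a + b)^-1 /\ D x = b - a,
    has_derive v A x (A x ^+ 2) /\ has_derive v B x (- B x ^+ 2) &
    has_derive v C x 0 /\ has_derive v D x 2]) ->
  test phi ->
  \I (cst (49 / 5) * (C * C) * (phi * phi)) <= \I ('d_v phi * 'd_v phi).
Proof.
move=> mA mB mC mD ABCD tphi; have tphi1 := test_dird v tphi.
pose c := B - A - cst (23 / 25) * (D * C * C).
have mc : multiplier Omega c by rewrite /c; multac.
have mN : multiplier Omega (cst (49 / 5) * (C * C)) by multac.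
have t1 : test (cst (49 / 5) * (C * C) * (phi * phi)) by apply: mN; exact: testM.
have t2 : test ('d_v phi * 'd_v phi) by exact: testM.
apply: (@linear_le v phi c _ _ tphi mc t1 t2) => x Ox.
have [a [b [[a0 b0] [AE BE] [CE DE] [hA hB] [hC hD]]]] := ABCD x Ox.
eexists; first by rewrite /c; der.
move=> p p1 pE p1E; rewrite /c !fctE pE p1E AE BE CE DE.
rewrite -subr_ge0; set X := (X in 0 <= X).
have ab0 : 0 < a + b by rewrite addr_gt0.
have -> : X = (p1 - (b^-1 - a^-1 - 23 / 25 * (b - a) / (a + b) ^+ 2) * p) ^+ 2 +
   ((2 / 5 * (a + b) ^+ 2 - 46 / 25 * (a * b)) ^+ 2 / (a * b * (a + b) ^+ 4) +
    16 / 625 / (a + b) ^+ 2) * p ^+ 2.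
  by rewrite /X; field; rewrite !gt_eqF.
apply: addr_ge0 (sqr_ge0 _) (mulr_ge0 (addr_ge0 _ _) (sqr_ge0 _)).
  by rewrite divr_ge0 ?sqr_ge0// !mulr_ge0 ?exprn_ge0// ltW.
by apply: divr_ge0 (sqr_ge0 _); lra.
Qed.

(* A rational substitute for the first eigenvalue of -f'' + a (a - 1) / t^2 f on
   (0, 1): the test function t^a (1 - t^2) exp (- (a - 1/16) t^2 / 2) is a
   supersolution. *)
Lemma hardy_ge v A B E T (a : R) phi :
  multiplier Omega A -> multiplier Omega B -> multiplier Omega E -> multiplier Omega T ->
  (forall x, Omega x -> [/\ 0 < T x < 1,
    A x = (T x)^-1 /\ B x = (1 - T x)^-1, E x = (1 + T x)^-1,
    has_derive v A x (- A x ^+ 2) /\ has_derive v B x (B x ^+ 2) &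
    has_derive v E x (- E x ^+ 2) /\ has_derive v T x 1]) ->
  test phi ->
  \I (cst ((a - 1 / 16) * (a + 129 / 16)) * (phi * phi)) <=
  \I ('d_v phi * 'd_v phi + cst (a * (a - 1)) * (A * A) * (phi * phi)).
Proof.
move=> mA mB mE mT ABET tphi; have tphi1 := test_dird v tphi.
pose c := cst a * A - cst (a - 1 / 16) * T - (B - E).
have mc : multiplier Omega c by rewrite /c; multac.
have mN : multiplier Omega (cst (a * (a - 1)) * (A * A)) by multac.
have t1 : test (cst ((a - 1 / 16) * (a + 129 / 16)) * (phi * phi)) by apply: testZ; exact: testM.
have t2 : test ('d_v phi * 'd_v phi + cst (a * (a - 1)) * (A * A) * (phi * phi)).
  by apply: testD; [|apply: mN]; exact: testM.
apply: (@linear_le v phi c _ _ tphi mc t1 t2) => x Ox.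
have [T01 [AE BE] EE [hA hB] [hE hT]] := ABET x Ox; have /andP[T0 T1] := T01.
eexists; first by rewrite /c; der.
move=> p p1 pE p1E; rewrite /c !fctE pE p1E AE BE EE.
set t := T x in T0 T1 *.
rewrite -subr_ge0; set X := (X in 0 <= X).
have u0 : 0 < 1 - t by rewrite subr_gt0.
have w0 : 0 < 1 + t by rewrite addr_gt0.
have -> : X = (p1 - (a / t - (a - 1 / 16) * t - ((1 - t)^-1 - (1 + t)^-1)) * p) ^+ 2 +
   ((a - 1 / 16) * ((1 - t) * (1 + t)) - 3 / 2) ^+ 2 / ((1 - t) * (1 + t)) * p ^+ 2.
  by rewrite /X; field; rewrite !gt_eqF.
by rewrite addr_ge0 ?sqr_ge0// mulr_ge0 ?sqr_ge0// divr_ge0 ?sqr_ge0// mulr_ge0// ltW.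
Qed.

Definition rellich_exp (c d s : R) : R :=
  (s * (s - 3)) ^+ 2 - (c - 2) * (s * (s - 3)) + d.

(* [t^4 (1 - t)^2] times the potential left over by the two squares in the proof
   of [rellich_ge]. *)
Definition rellich_num (c d s j k t : R) : R :=
  let u := 1 - t in
  let b := c + 4 * s - 2 * s ^+ 2 in
  let m := (b * u + 8 * s * t) * (j - k * t ^+ 2) in
  let m' := (8 * s - b) * (j - k * t ^+ 2) - 2 * k * t * (b * u + 8 * s * t) in
  rellich_exp c d s - 2 * rellich_exp c d (s + 1) * t + rellich_exp c d (s + 2) * t ^+ 2 -
  (m' * t * u - m * (3 * u - t)) - m * (2 * s * u - 4 * t + (j - k * t ^+ 2) * u).

(* The first square vanishes on w = t^s (1 - t)^2 and the second one on
   w t^j exp (- k t^2 / 2). *)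
Lemma rellich_ge v A B T (c d s j k m : R) phi :
  multiplier Omega A -> multiplier Omega B -> multiplier Omega T ->
  (forall x, Omega x -> [/\ 0 < T x < 1, A x = (T x)^-1, B x = (1 - T x)^-1,
    has_derive v A x (- A x ^+ 2) /\ has_derive v B x (B x ^+ 2) &
    has_derive v T x 1]) ->
  0 <= s -> 0 <= c + 4 * s - 2 * s ^+ 2 ->
  (forall t, 0 < t < 1 -> m * (t ^+ 4 * (1 - t) ^+ 2) <= rellich_num c d s j k t) ->
  test phi ->
  \I (cst m * (phi * phi)) <=
  \I ('d_v ('d_v phi) * 'd_v ('d_v phi) + cst c * (A * A) * ('d_v phi * 'd_v phi) +
      cst d * (A * A * A * A) * (phi * phi)).
Proof.
move=> mA mB mT ABT s0 b0 hm tphi.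
have tphi1 := test_dird v tphi; have tphi2 := test_dird v tphi1.
pose P := cst s * A - cst 2 * B.
pose q := cst (4 * s) * (A * B) - cst (s + s * s) * (A * A) - cst 6 * (B * B).
pose q' := cst (2 * (s + s * s)) * (A * A * A) + cst (4 * s) * (A * B * B - A * A * B) -
  cst 12 * (B * B * B).
pose al := cst (c + 4 * s - 2 * s ^+ 2) * (A * A) + cst (8 * s) * (A * B).
pose r := P + cst j * A - cst k * T.
pose c1 := cst 2 * P; pose c2 := cst 2 * q; pose c3 := al * r - q' - c1 * q.
have m1 : multiplier Omega c1 by rewrite /c1 /P; multac.
have m2 : multiplier Omega c2 by rewrite /c2 /q; multac.
have m3 : multiplier Omega c3 by rewrite /c3 /al /r /q' /q /c1 /P; multac.
have m4 : multiplier Omega (cst c * (A * A)) by multac.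
have m5 : multiplier Omega (cst d * (A * A * A * A)) by multac.
have t1 : test (cst m * (phi * phi)) by apply: testZ; exact: testM.
have t2 : test ('d_v ('d_v phi) * 'd_v ('d_v phi) + cst c * (A * A) * ('d_v phi * 'd_v phi) +
      cst d * (A * A * A * A) * (phi * phi)).
  by apply: testD; [apply: testD; [|apply: m4]|apply: m5]; exact: testM.
apply: (@quadratic_le v phi c1 c2 c3 _ _ tphi m1 m2 m3 t1 t2) => x Ox.
have [T01 AE BE [hA hB] hT] := ABT x Ox; have := hm _ T01; have /andP[T0 T1] := T01.
do 3 eexists; split; [by rewrite /c1 /P; der|by rewrite /c2 /q; der|
  by rewrite /c3 /al /r /q' /q /c1 /P; der|].
move=> p p1 p2 pE p1E p2E.
rewrite /c1 /c2 /c3 /al /r /q' /q /P /c1 /P !fctE pE p1E p2E AE BE.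
set t := T x in T0 T1 *; move: (hm t); rewrite T0 T1 => /(_ isT) {}hm.
rewrite -subr_ge0; set X := (X in 0 <= X).
have u0 : 0 < 1 - t by rewrite subr_gt0.
have -> : X = (p2 - 2 * (s / t - 2 / (1 - t)) * p1 -
    (4 * s / (t * (1 - t)) - (s + s * s) / t ^+ 2 - 6 / (1 - t) ^+ 2) * p) ^+ 2 +
  ((c + 4 * s - 2 * s ^+ 2) / t ^+ 2 + 8 * s / (t * (1 - t))) *
    (p1 - (s / t - 2 / (1 - t) + j / t - k * t) * p) ^+ 2 +
  (rellich_num c d s j k t - m * (t ^+ 4 * (1 - t) ^+ 2)) / (t ^+ 4 * (1 - t) ^+ 2) * p ^+ 2.
  by rewrite /X /rellich_num /rellich_exp; field; rewrite !gt_eqF.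
rewrite !addr_ge0 ?sqr_ge0// mulr_ge0 ?sqr_ge0//.
  by rewrite addr_ge0// divr_ge0 ?sqr_ge0// !mulr_ge0// ltW.
by rewrite divr_ge0 ?subr_ge0// mulr_ge0 ?exprn_ge0 ?sqr_ge0// ltW.
Qed.

End Certificates.

Section RellichNumerator.
Context {R : realType}.

(* The coefficients of p0 + .. + p6 t^6 in the Bernstein basis of degree 6 of
   the interval [0, 1/2] are nonnegative. *)
Definition bernstein_half (p0 p1 p2 p3 p4 p5 p6 : R) : Prop :=
  0 <= p0 /\
  0 <= p0 + p1 / 12 /\
  0 <= p0 + p1 / 6 + p2 / 60 /\
  0 <= p0 + p1 / 4 + p2 / 20 + p3 / 160 /\
  0 <= p0 + p1 / 3 + p2 / 10 + p3 / 40 + p4 / 240 /\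
  0 <= p0 + 5 / 12 * p1 + p2 / 6 + p3 / 16 + p4 / 48 + p5 / 192 /\
  0 <= p0 + p1 / 2 + p2 / 4 + p3 / 8 + p4 / 16 + p5 / 32 + p6 / 64.

Lemma bernstein_half_ge0 (p0 p1 p2 p3 p4 p5 p6 t : R) :
  bernstein_half p0 p1 p2 p3 p4 p5 p6 -> 0 <= t <= 1 / 2 ->
  0 <= p0 + p1 * t + p2 * t ^+ 2 + p3 * t ^+ 3 + p4 * t ^+ 4 + p5 * t ^+ 5 + p6 * t ^+ 6.
Proof.
rewrite /bernstein_half.
set b0 := p0.
set b1 := p0 + p1 / 12.
set b2 := p0 + p1 / 6 + p2 / 60.
set b3 := p0 + p1 / 4 + p2 / 20 + p3 / 160.
set b4 := p0 + p1 / 3 + p2 / 10 + p3 / 40 + p4 / 240.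
set b5 := p0 + 5 / 12 * p1 + p2 / 6 + p3 / 16 + p4 / 48 + p5 / 192.
set b6 := p0 + p1 / 2 + p2 / 4 + p3 / 8 + p4 / 16 + p5 / 32 + p6 / 64.
move=> [h0 [h1 [h2 [h3 [h4 [h5 h6]]]]]] /andP[t0 t1].
have u0 : 0 <= 2 * t by lra.
have w0 : 0 <= 1 - 2 * t by lra.
rewrite (_ : _ + _ = b0 * (1 - 2 * t) ^+ 6 + 6 * b1 * (2 * t * (1 - 2 * t) ^+ 5) +
  15 * b2 * ((2 * t) ^+ 2 * (1 - 2 * t) ^+ 4) + 20 * b3 * ((2 * t) ^+ 3 * (1 - 2 * t) ^+ 3) +
  15 * b4 * ((2 * t) ^+ 4 * (1 - 2 * t) ^+ 2) + 6 * b5 * ((2 * t) ^+ 5 * (1 - 2 * t)) +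
  b6 * (2 * t) ^+ 6); last by rewrite /b0 /b1 /b2 /b3 /b4 /b5 /b6; field.
by rewrite !addr_ge0//; do ?[assumption|exact: exprn_ge0|apply: mulr_ge0|lra].
Qed.

Lemma bernstein_ge0 (p0 p1 p2 p3 p4 p5 p6 t : R) :
  bernstein_half p0 p1 p2 p3 p4 p5 p6 ->
  bernstein_half (p0 + p1 + p2 + p3 + p4 + p5 + p6) (- (p1 + 2 * p2 + 3 * p3 + 4 * p4 + 5 * p5 + 6 * p6))
    (p2 + 3 * p3 + 6 * p4 + 10 * p5 + 15 * p6) (- (p3 + 4 * p4 + 10 * p5 + 20 * p6)) (p4 + 5 * p5 + 15 * p6)
    (- (p5 + 6 * p6)) (p6) ->
  0 <= t <= 1 ->
  0 <= p0 + p1 * t + p2 * t ^+ 2 + p3 * t ^+ 3 + p4 * t ^+ 4 + p5 * t ^+ 5 + p6 * t ^+ 6.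
Proof.
move=> h1 h2 /andP[t0 t1]; have [th|th] := leP t (1 / 2).
  by apply: bernstein_half_ge0 h1 _; rewrite t0.
have /(bernstein_half_ge0 h2) : 0 <= 1 - t <= 1 / 2 by lra.
by congr (_ <= _); ring.
Qed.

Lemma rellich_num_ge_bernstein (c d s j k m t : R) :
  let e0 := rellich_exp c d s in let e1 := rellich_exp c d (s + 1) in
  let e2 := rellich_exp c d (s + 2) in
  let b := c + 4 * s - 2 * s ^+ 2 in let f := 8 * s - b in let g := 2 * s + j in
  let p0 := e0 - b * j * (g - 3) in
  let p1 := - 2 * e1 - f * j * (g - 2) + b * j * g in
  let p2 := e2 + b * k * (g - 1) + f * j * (g + 1) + b * j * k in
  let p3 := f * k * g - b * k * (g + 2) + f * j * k - b * j * k in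
  let p4 := - f * k * (g + 3) - b * k ^+ 2 - f * j * k - m in
  let p5 := b * k ^+ 2 - f * k ^+ 2 + 2 * m in
  let p6 := f * k ^+ 2 - m in
  bernstein_half p0 p1 p2 p3 p4 p5 p6 ->
  bernstein_half (p0 + p1 + p2 + p3 + p4 + p5 + p6) (- (p1 + 2 * p2 + 3 * p3 + 4 * p4 + 5 * p5 + 6 * p6))
    (p2 + 3 * p3 + 6 * p4 + 10 * p5 + 15 * p6) (- (p3 + 4 * p4 + 10 * p5 + 20 * p6)) (p4 + 5 * p5 + 15 * p6)
    (- (p5 + 6 * p6)) (p6) ->
  0 < t < 1 -> m * (t ^+ 4 * (1 - t) ^+ 2) <= rellich_num c d s j k t.
Proof.
move=> e0 e1 e2 b f g p0 p1 p2 p3 p4 p5 p6 h1 h2 /andP[t0 t1].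
have : 0 <= t <= 1 by rewrite !ltW.
move/(bernstein_ge0 h1 h2) => h; rewrite -subr_ge0; move: h; congr (_ <= _).
by rewrite /rellich_num -/e0 -/e1 -/e2 /p0 /p1 /p2 /p3 /p4 /p5 /p6 /g /f /b; ring.
Qed.

(* Replacing x^2 by its tangent at x0 makes the Bernstein coefficients affine in
   x, so that it suffices to check them at the ends of an interval. *)
Lemma rellich_num_tangent (x0 m x s j k t : R) :
  m <= rellich_num (98 / 5 * x) (24 * 16 * (2 * x * x0 - x0 ^+ 2)) s j k t ->
  m <= rellich_num (98 / 5 * x) (24 * 16 * x ^+ 2) s j k t.
Proof.
move=> /le_trans; apply; rewrite -subr_ge0.
have -> : forall c d d', rellich_num c d s j k t - rellich_num c d' s j k t =
    (d - d') * (1 - t) ^+ 2 by move=> *; rewrite /rellich_num /rellich_exp; ring.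
apply: mulr_ge0 (sqr_ge0 _).
have -> : 24 * 16 * x ^+ 2 - 24 * 16 * (2 * x * x0 - x0 ^+ 2) = 24 * 16 * (x - x0) ^+ 2 by ring.
by apply: mulr_ge0 (sqr_ge0 _); lra.
Qed.

Lemma rellich_num_ge1 (x t : R) : 1 / 12 <= x <= 1 / 6 -> 0 < t < 1 ->
  x * (16 * 22 * 13) * (t ^+ 4 * (1 - t) ^+ 2) <=
  rellich_num (98 / 5 * x) (24 * 16 * x ^+ 2) (9 / 4) (1 / 2) (3 / 4) t.
Proof.
move=> /andP[x0 x1] t01; apply: (@rellich_num_tangent (1 / 8)).
by apply: rellich_num_ge_bernstein t01;
  rewrite /bernstein_half /rellich_exp; do 6 (split; first lra); lra.
Qed.

Lemma rellich_num_ge2 (x t : R) : 1 / 6 <= x <= 1 / 4 -> 0 < t < 1 ->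
  x * (16 * 22 * 13) * (t ^+ 4 * (1 - t) ^+ 2) <=
  rellich_num (98 / 5 * x) (24 * 16 * x ^+ 2) (9 / 4) (1) (5 / 4) t.
Proof.
move=> /andP[x0 x1] t01; apply: (@rellich_num_tangent (5 / 24)).
by apply: rellich_num_ge_bernstein t01;
  rewrite /bernstein_half /rellich_exp; do 6 (split; first lra); lra.
Qed.

Lemma rellich_num_ge3 (x t : R) : 1 / 4 <= x <= 9 / 25 -> 0 < t < 1 ->
  x * (16 * 22 * 13) * (t ^+ 4 * (1 - t) ^+ 2) <=
  rellich_num (98 / 5 * x) (24 * 16 * x ^+ 2) (5 / 2) (5 / 4) (3 / 2) t.
Proof.
move=> /andP[x0 x1] t01; apply: (@rellich_num_tangent (61 / 200)).
by apply: rellich_num_ge_bernstein t01;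
  rewrite /bernstein_half /rellich_exp; do 6 (split; first lra); lra.
Qed.

Lemma rellich_num_ge4 (x t : R) : 9 / 25 <= x <= 7 / 16 -> 0 < t < 1 ->
  x * (16 * 22 * 13) * (t ^+ 4 * (1 - t) ^+ 2) <=
  rellich_num (98 / 5 * x) (24 * 16 * x ^+ 2) (9 / 4) (2) (2) t.
Proof.
move=> /andP[x0 x1] t01; apply: (@rellich_num_tangent (319 / 800)).
by apply: rellich_num_ge_bernstein t01;
  rewrite /bernstein_half /rellich_exp; do 6 (split; first lra); lra.
Qed.

Lemma rellich_num_ge5 (x t : R) : 7 / 16 <= x <= 1 / 2 -> 0 < t < 1 ->
  x * (16 * 22 * 13) * (t ^+ 4 * (1 - t) ^+ 2) <=
  rellich_num (98 / 5 * x) (24 * 16 * x ^+ 2) (9 / 4) (9 / 4) (9 / 4) t.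
Proof.
move=> /andP[x0 x1] t01; apply: (@rellich_num_tangent (15 / 32)).
by apply: rellich_num_ge_bernstein t01;
  rewrite /bernstein_half /rellich_exp; do 6 (split; first lra); lra.
Qed.

Lemma rellich_num_ge6 (x t : R) : 1 / 2 <= x <= 5 / 8 -> 0 < t < 1 ->
  x * (16 * 22 * 13) * (t ^+ 4 * (1 - t) ^+ 2) <=
  rellich_num (98 / 5 * x) (24 * 16 * x ^+ 2) (5 / 2) (9 / 4) (5 / 2) t.
Proof.
move=> /andP[x0 x1] t01; apply: (@rellich_num_tangent (9 / 16)).
by apply: rellich_num_ge_bernstein t01;
  rewrite /bernstein_half /rellich_exp; do 6 (split; first lra); lra.
Qed.

Lemma rellich_num_ge7 (x t : R) : 5 / 8 <= x <= 3 / 4 -> 0 < t < 1 ->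
  x * (16 * 22 * 13) * (t ^+ 4 * (1 - t) ^+ 2) <=
  rellich_num (98 / 5 * x) (24 * 16 * x ^+ 2) (9 / 4) (3) (11 / 4) t.
Proof.
move=> /andP[x0 x1] t01; apply: (@rellich_num_tangent (11 / 16)).
by apply: rellich_num_ge_bernstein t01;
  rewrite /bernstein_half /rellich_exp; do 6 (split; first lra); lra.
Qed.

(* s, j and k were found numerically. *)
Lemma rellich_num_ge (x : R) : 1 / 12 <= x <= 3 / 4 ->
  exists s j k, [/\ 0 <= s, 0 <= 98 / 5 * x + 4 * s - 2 * s ^+ 2 &
    forall t, 0 < t < 1 -> x * (16 * 22 * 13) * (t ^+ 4 * (1 - t) ^+ 2) <=
      rellich_num (98 / 5 * x) (24 * 16 * x ^+ 2) s j k t].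
Proof.
move=> /andP[x0 x1].
have [x2|x2] := leP x (1 / 6).
  exists (9 / 4), (1 / 2), (3 / 4); split=> [||t t01]; [lra|lra|].
  by apply: rellich_num_ge1 => //; apply/andP; split; lra.
have [x3|x3] := leP x (1 / 4).
  exists (9 / 4), (1), (5 / 4); split=> [||t t01]; [lra|lra|].
  by apply: rellich_num_ge2 => //; apply/andP; split; lra.
have [x4|x4] := leP x (9 / 25).
  exists (5 / 2), (5 / 4), (3 / 2); split=> [||t t01]; [lra|lra|].
  by apply: rellich_num_ge3 => //; apply/andP; split; lra.
have [x5|x5] := leP x (7 / 16).
  exists (9 / 4), (2), (2); split=> [||t t01]; [lra|lra|].
  by apply: rellich_num_ge4 => //; apply/andP; split; lra.
have [x6|x6] := leP x (1 / 2).
  exists (9 / 4), (9 / 4), (9 / 4); split=> [||t t01]; [lra|lra|].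
  by apply: rellich_num_ge5 => //; apply/andP; split; lra.
have [x7|x7] := leP x (5 / 8).
  exists (5 / 2), (9 / 4), (5 / 2); split=> [||t t01]; [lra|lra|].
  by apply: rellich_num_ge6 => //; apply/andP; split; lra.
exists (9 / 4), (3), (11 / 4); split=> [||t t01]; [lra|lra|].
by apply: rellich_num_ge7 => //; apply/andP; split; lra.
Qed.

Lemma hardy_const_ge (a x : R) : 1 <= a -> a * (a - 1) = 49 / 5 * x ->
  1700 * x <= ((a - 1 / 16) * (a + 129 / 16)) ^+ 2.
Proof.
move=> a1 aE; have -> : x = 5 / 49 * (a * (a - 1)) by rewrite aE; field.
have a0 : 0 <= a by lra.
have P : 0 <= a * (a - 11 / 4) ^+ 2 * (a + 43 / 2).
  by apply: mulr_ge0; [apply: mulr_ge0 (sqr_ge0 _)|lra].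
by have := sqr_ge0 a; nra.
Qed.

End RellichNumerator.

(** * Symmetry of second derivatives *)

Section Schwarz.
Context {R : realType}.
Implicit Types (f : R * R -> R).

Lemma MVT_everywhere (g g' : R -> R) x d : (forall t : R, is_derive t (1 : R) g (g' t)) ->
  0 < d -> exists2 u, x < u < x + d & g (x + d) - g x = g' u * d.
Proof.
move=> dg d0; have xd : x < x + d by rewrite ltrDl.
have cg : continuous g.
  by move=> t; apply: differentiable_continuous; apply/derivable1_diffP; case: (dg t).
have [u ux E] := @MVT _ g g' _ _ xd (fun t _ => dg t) (continuous_subspaceT cg).
by exists u; [move: ux; rewrite in_itv|rewrite E; congr (_ * _); ring].
Qed.

Lemma MVT_mixed01 f x y d : smooth f -> 0 < d -> exists u w,
  [/\ x < u < x + d, y < w < y + d &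
  f (x + d, y + d) - f (x + d, y) - (f (x, y + d) - f (x, y)) =
  partial 1 (partial 0 f) (u, w) * d * d].
Proof.
move=> sf d0.
have df p : differentiable f p by exact: smooth_differentiable.
have d0f p : differentiable (partial 0 f) p by exact: (sf [:: 0]).
have [t|u ux ->] := @MVT_everywhere (fun t => f (t, y + d) - f (t, y))
  (fun t => partial 0 f (t, y + d) - partial 0 f (t, y)) x d _ d0.
  by apply: is_deriveB; exact: is_derive_slice1.
have [t|w wy ->] := @MVT_everywhere (fun t => partial 0 f (u, t))
  (fun t => partial 1 (partial 0 f) (u, t)) y d _ d0; first exact: is_derive_slice2.
by exists u, w.
Qed.

Lemma MVT_mixed10 f x y d : smooth f -> 0 < d -> exists u w,
  [/\ x < u < x + d, y < w < y + d &
  f (x + d, y + d) - f (x + d, y) - (f (x, y + d) - f (x, y)) =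
  partial 0 (partial 1 f) (u, w) * d * d].
Proof.
move=> sf d0.
have df p : differentiable f p by exact: smooth_differentiable.
have d1f p : differentiable (partial 1 f) p by exact: (sf [:: 1]).
have [t|w wy E] := @MVT_everywhere (fun t => f (x + d, t) - f (x, t))
  (fun t => partial 1 f (x + d, t) - partial 1 f (x, t)) y d _ d0.
  by apply: is_deriveB; exact: is_derive_slice2.
have [t|u ux E'] := @MVT_everywhere (fun t => partial 1 f (t, w))
  (fun t => partial 0 (partial 1 f) (t, w)) x d _ d0; first exact: is_derive_slice1.
exists u, w; split=> //; rewrite -E' -E; ring.
Qed.

Lemma ball_corner (x y u w d d' : R) : d <= d' -> x < u < x + d -> y < w < y + d ->
  ball (x, y) d' (u, w).
Proof. by move=> dd /andP[? ?] /andP[? ?]; split; rewrite /ball /= ltr_norml; lra. Qed.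

Lemma partial_comm f : smooth f -> partial 0 (partial 1 f) = partial 1 (partial 0 f).
Proof.
move=> sf; apply/funext => -[x y].
have c01 : {for (x, y), continuous (partial 0 (partial 1 f))}.
  exact/differentiable_continuous/(sf [:: 0; 1]).
have c10 : {for (x, y), continuous (partial 1 (partial 0 f))}.
  exact/differentiable_continuous/(sf [:: 1; 0]).
apply/eqP; rewrite -subr_eq0 -normr_le0; apply/ler_addgt0Pl => e e0; rewrite addr0.
have e2 : 0 < e / 2 by rewrite divr_gt0.
move/cvgrPdist_lt : c01 => /(_ _ e2) /nbhs_ballP[d1 /= d10 h1].
move/cvgrPdist_lt : c10 => /(_ _ e2) /nbhs_ballP[d2 /= d20 h2].
have d0 : 0 < Num.min d1 d2 by rewrite lt_min d10.
have [u [w [ux wy E]]] := MVT_mixed10 x y sf d0.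
have [u' [w' [ux' wy' E']]] := MVT_mixed01 x y sf d0.
have {E'} E' := etrans (esym E) E'; clear E.
set p := partial 0 (partial 1 f) (x, y); set q := partial 1 (partial 0 f) (x, y).
have dd1 : Num.min d1 d2 <= d1 by rewrite ge_min lexx.
have dd2 : Num.min d1 d2 <= d2 by rewrite ge_min lexx orbT.
have := h1 _ (ball_corner dd1 ux wy).
have := h2 _ (ball_corner dd2 ux' wy').
move: (partial 0 (partial 1 f) (u, w)) (partial 1 (partial 0 f) (u', w')) E' => r r'.
move=> /(mulIf (lt0r_neq0 d0)) /(mulIf (lt0r_neq0 d0)) <-.
rewrite -/p -/q; move: p q {h1 h2} => p q qr pr.
have -> : p - q = (p - r) - (q - r) by ring.
by rewrite (le_trans (ler_normB _ _))// [leRHS]splitr lerD// ltW.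
Qed.

Lemma dirdE v f : smooth f -> dird v f = cst v.1 * partial 0 f + cst v.2 * partial 1 f.
Proof.
by move=> sf; apply/funext => x; rewrite /dird derive_partials//; exact: smooth_differentiable.
Qed.

Lemma partial_dird i v f : smooth f -> partial i (dird v f) =
  cst v.1 * partial i (partial 0 f) + cst v.2 * partial i (partial 1 f).
Proof.
move=> sf.
have ds g (x : R * R) : smooth g -> differentiable g x by exact: smooth_differentiable.
have sp j : smooth (partial j f) by exact: (@smooth_partials _ [:: j]).
have sz (c : R) (g : R * R -> R) : smooth g -> smooth (cst c * g) by apply: smoothM; exact: smooth_cst.
have pz (c : R) (g : R * R -> R) : smooth g -> partial i (cst c * g) = cst c * partial i g.
  move=> sg; rewrite (partialM i (fun x => ds _ x (smooth_cst c)) (fun x => ds _ x sg)).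
  by rewrite partial_cst; apply/funext => x; rewrite !fctE mulr0 addr0.
rewrite (dirdE v sf) (partialD i (fun x => ds _ x (sz _ _ (sp 0))) (fun x => ds _ x (sz _ _ (sp 1)))).
by rewrite (pz _ _ (sp 0)) (pz _ _ (sp 1)).
Qed.

Lemma dird_dird v w f : smooth f -> dird v (dird w f) =
  cst (v.1 * w.1) * partial 0 (partial 0 f) + cst (v.1 * w.2 + v.2 * w.1) * partial 1 (partial 0 f) +
  cst (v.2 * w.2) * partial 1 (partial 1 f).
Proof.
move=> sf; have sw : smooth (dird w f) by exact: smooth_derive.
rewrite (dirdE v sw) !(partial_dird _ w sf) (partial_comm sf).
move: (partial 0 (partial 0 f)) (partial 1 (partial 0 f)) (partial 1 (partial 1 f)) => g h k.
by apply/funext => x; rewrite !fctE; ring.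
Qed.

Lemma dird_comm v w f : smooth f -> dird v (dird w f) = dird w (dird v f).
Proof.
move=> sf; rewrite (dird_dird v w sf) (dird_dird w v sf).
by congr (cst _ * _ + cst _ * _ + cst _ * _); ring.
Qed.

End Schwarz.

(** * Slices of a triangle *)

Section Slicing.
Context {R : realType}.
Notation plane := (measurableTypeR R * measurableTypeR R)%type.
Implicit Types (phi : R * R -> R).

(* l1, l2, l3 are the barycentric coordinates of a triangle, w is its base and v
   is orthogonal to w, from the apex to the base; t = 1 - l3. *)
Variables (Omega : set (R * R)) (v w : R * R).
Variables (a1 b1 c1 a2 b2 c2 a3 b3 c3 : R).
Let l1 := affine a1 b1 c1.
Let l2 := affine a2 b2 c2.
Let l3 := affine a3 b3 c3.
Let t := affine (- a3) (- b3) (1 - c3).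
Hypothesis mOmega : measurable (Omega : set plane).
Hypothesis pos : forall x, Omega x -> [/\ 0 < l1 x, 0 < l2 x & 0 < l3 x].
Hypothesis sum1 : forall x, l1 x + l2 x + l3 x = 1.
Hypothesis w1 : a1 * w.1 + b1 * w.2 = -1.
Hypothesis w2 : a2 * w.1 + b2 * w.2 = 1.
Hypothesis w3 : a3 * w.1 + b3 * w.2 = 0.
Hypothesis v3 : a3 * v.1 + b3 * v.2 = -1.

Notation test := (test_function Omega).
Notation "'\I' f" := (\int[area]_(x in (Omega : set plane)) f x)
  (at level 36, f at level 36).

Let tE x : t x = 1 - l3 x.
Proof. by rewrite /t /l3 /affine; ring. Qed.

Let t_bounds x : Omega x -> 0 < t x < 1.
Proof. by move=> /pos[? ? ?]; rewrite tE; have := sum1 x; lra. Qed.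

Let A1 x := (l1 x)^-1.
Let A2 x := (l2 x)^-1.
Let A3 x := (l3 x)^-1.
Let C x := (t x)^-1.
Let E x := (affine (- a3) (- b3) (2 - c3) x)^-1.
Let D := affine (a2 - a1) (b2 - b1) (c2 - c1).

Let EE x : E x = (1 + t x)^-1.
Proof. by rewrite /E /t /affine; congr (_^-1); ring. Qed.

Let mA1 : multiplier Omega A1.
Proof. by apply: multiplier_inv => x /pos[? ? ?]; rewrite gt_eqF. Qed.
Let mA2 : multiplier Omega A2.
Proof. by apply: multiplier_inv => x /pos[? ? ?]; rewrite gt_eqF. Qed.
Let mA3 : multiplier Omega A3.
Proof. by apply: multiplier_inv => x /pos[? ? ?]; rewrite gt_eqF. Qed.
Let mC : multiplier Omega C.
Proof. by apply: multiplier_inv => x /t_bounds/andP[? ?]; rewrite gt_eqF. Qed.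
Let mE : multiplier Omega E.
Proof.
apply: multiplier_inv => x /t_bounds/andP[t0 _].
have -> : affine (- a3) (- b3) (2 - c3) x = 1 + t x by rewrite /t /affine; ring.
by rewrite gt_eqF// addr_gt0.
Qed.

Lemma slice_poincare phi : test phi ->
  \I (cst (49 / 5) * (C * C) * (phi * phi)) <= \I (dird w phi * dird w phi).
Proof.
move=> tphi.
have mD : multiplier Omega D by exact: multiplier_affine.
refine (poincare_ge mOmega mA1 mA2 mC mD _ tphi) => x Ox.
have [p1 p2 p3] := pos Ox.
exists (l1 x), (l2 x); split=> //.
- split; last by rewrite /D /l1 /l2 /affine; ring.
  by rewrite /C tE; congr (_^-1); have := sum1 x; lra.
- split.
  + have -> : A1 x ^+ 2 = - (a1 * w.1 + b1 * w.2) * A1 x ^+ 2 by rewrite w1 opprK mul1r.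
    by apply: has_derive_inv_affine; rewrite gt_eqF.
  + have -> : - A2 x ^+ 2 = - (a2 * w.1 + b2 * w.2) * A2 x ^+ 2 by rewrite w2 mulN1r.
    by apply: has_derive_inv_affine; rewrite gt_eqF.
- split.
  + have -> : 0 = - (- a3 * w.1 + - b3 * w.2) * C x ^+ 2.
      by rewrite -(mul0r (C x ^+ 2)); congr (_ * _); move: w3; lra.
    by apply: has_derive_inv_affine; case/andP: (t_bounds Ox) => t0 _; rewrite gt_eqF.
  + have -> : 2 = (a2 - a1) * w.1 + (b2 - b1) * w.2 by move: w1 w2; lra.
    exact: has_derive_affine.
Qed.

Let v3N : - a3 * v.1 + - b3 * v.2 = 1.
Proof. by move: v3; lra. Qed.

Let dC x : Omega x -> has_derive v C x (- C x ^+ 2).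
Proof.
move=> Ox; have -> : - C x ^+ 2 = - (- a3 * v.1 + - b3 * v.2) * C x ^+ 2.
  by rewrite v3N mulN1r.
by apply: has_derive_inv_affine; case/andP: (t_bounds Ox) => t0 _; rewrite gt_eqF.
Qed.

Let dA3 x : Omega x -> has_derive v A3 x (A3 x ^+ 2).
Proof.
move=> Ox; have -> : A3 x ^+ 2 = - (a3 * v.1 + b3 * v.2) * A3 x ^+ 2 by rewrite v3 opprK mul1r.
by apply: has_derive_inv_affine; have [_ _ ?] := pos Ox; rewrite gt_eqF.
Qed.

Let dt x : has_derive v t x 1.
Proof.
by rewrite -v3N; exact: has_derive_affine.
Qed.

Let A3E x : A3 x = (1 - t x)^-1.
Proof. by rewrite tE; congr (_^-1); ring. Qed.

Lemma slice_hardy (a : R) phi : test phi ->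
  \I (cst ((a - 1 / 16) * (a + 129 / 16)) * (phi * phi)) <=
  \I (dird v phi * dird v phi + cst (a * (a - 1)) * (C * C) * (phi * phi)).
Proof.
move=> tphi.
have mt : multiplier Omega t by exact: multiplier_affine.
refine (hardy_ge mOmega _ mC mA3 mE mt _ tphi) => x Ox.
have t01 := t_bounds Ox; split=> [//||||].
- by split; [rewrite /C|exact: A3E].
- exact: EE.
- by split; [exact: dC|exact: dA3].
- split=> //.
  have -> : - E x ^+ 2 = - (- a3 * v.1 + - b3 * v.2) * E x ^+ 2.
    by rewrite v3N mulN1r.
  apply: has_derive_inv_affine; case/andP: t01 => t0 _.
  have -> : affine (- a3) (- b3) (2 - c3) x = 1 + t x by rewrite /t /affine; ring.
  by rewrite gt_eqF// addr_gt0.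
Qed.

Lemma slice_rellich (c d s j k m : R) phi : 0 <= s -> 0 <= c + 4 * s - 2 * s ^+ 2 ->
  (forall y, 0 < y < 1 -> m * (y ^+ 4 * (1 - y) ^+ 2) <= rellich_num c d s j k y) ->
  test phi ->
  \I (cst m * (phi * phi)) <=
  \I (dird v (dird v phi) * dird v (dird v phi) + cst c * (C * C) * (dird v phi * dird v phi) +
      cst d * (C * C * C * C) * (phi * phi)).
Proof.
move=> s0 b0 hm tphi.
have mt : multiplier Omega t by exact: multiplier_affine.
refine (rellich_ge mOmega mC mA3 mt _ s0 b0 hm tphi) => x Ox.
by split; [exact: t_bounds|by []|exact: A3E|split; [exact: dC|exact: dA3]|exact: dt].
Qed.

Lemma slice_clamped_w phi : test phi ->
  \I (cst (24 * 16) * (C * C * C * C) * (phi * phi)) <= \I (dird w (dird w phi) * dird w (dird w phi)).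
Proof.
move=> tphi; apply: (@le_trans _ _ (\I (cst 24 * (A1 * A2) * (A1 * A2) * (phi * phi)))).
  have m1 : multiplier Omega (cst (24 * 16) * (C * C * C * C)).
    by do ?[exact: multiplier_cst|assumption|apply: multiplierM].
  have m2 : multiplier Omega (cst 24 * (A1 * A2) * (A1 * A2)).
    by do ?[exact: multiplier_cst|assumption|apply: multiplierM].
  apply: (le_Rintegral mOmega (test_integrable mOmega (m1 _ (testM tphi tphi)))
    (test_integrable mOmega (m2 _ (testM tphi tphi)))) => x Ox.
  rewrite !fctE; have [p1 p2 p3] := pos Ox.
  apply: ler_wpM2r; first by rewrite -expr2 sqr_ge0.
  have t0 : 0 < l1 x + l2 x by exact: addr_gt0.
  have -> : C x = (l1 x + l2 x)^-1.
    by rewrite /C tE; congr (_^-1); have := sum1 x; lra.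
  rewrite /A1 /A2; move: (l1 x) (l2 x) p1 p2 t0 => y z y0 z0 yz0.
  rewrite -subr_ge0; set X := (X in 0 <= X).
  have -> : X = 24 * ((y - z) ^+ 2 * ((y + z) ^+ 2 + 4 * (y * z))) / ((y * z) ^+ 2 * (y + z) ^+ 4).
    by rewrite /X; field; rewrite !gt_eqF.
  apply: divr_ge0; last by rewrite mulr_ge0 ?sqr_ge0// exprn_ge0// ltW.
  apply: mulr_ge0; first by lra.
  apply: mulr_ge0 (sqr_ge0 _) (addr_ge0 (sqr_ge0 _) _); have := mulr_gt0 y0 z0; lra.
refine (second_derivative_ge mOmega mA1 mA2 _ tphi) => x Ox.
have [p1 p2 p3] := pos Ox; split; rewrite ?invr_gt0//.
- have -> : A1 x ^+ 2 = - (a1 * w.1 + b1 * w.2) * A1 x ^+ 2 by rewrite w1 opprK mul1r.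
  by apply: has_derive_inv_affine; rewrite gt_eqF.
- have -> : - A2 x ^+ 2 = - (a2 * w.1 + b2 * w.2) * A2 x ^+ 2 by rewrite w2 mulN1r.
  by apply: has_derive_inv_affine; rewrite gt_eqF.
Qed.

Lemma slice_clamped_v phi : test phi ->
  \I (cst (24 * 16) * (phi * phi)) <= \I (dird v (dird v phi) * dird v (dird v phi)).
Proof.
move=> tphi; apply: (@le_trans _ _ (\I (cst 24 * (A3 * C) * (A3 * C) * (phi * phi)))).
  have m2 : multiplier Omega (cst 24 * (A3 * C) * (A3 * C)).
    by do ?[exact: multiplier_cst|assumption|apply: multiplierM].
  apply: (le_Rintegral mOmega (test_integrable mOmega (testZ _ (testM tphi tphi)))
    (test_integrable mOmega (m2 _ (testM tphi tphi)))) => x Ox.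
  rewrite !fctE; apply: ler_wpM2r; first by rewrite -expr2 sqr_ge0.
  rewrite A3E /C; move: (t x) (t_bounds Ox) => y /andP[y0 y1].
  have z0 : 0 < 1 - y by rewrite subr_gt0.
  rewrite -subr_ge0; set X := (X in 0 <= X).
  have -> : X = 24 * ((1 - 2 * y) ^+ 2 * (1 + 4 * (y * (1 - y)))) / (y * (1 - y)) ^+ 2.
    by rewrite /X; field; rewrite !gt_eqF.
  apply: divr_ge0; last by rewrite sqr_ge0.
  apply: mulr_ge0; first by lra.
  apply: mulr_ge0 (sqr_ge0 _) _; have := mulr_gt0 y0 z0; lra.
refine (second_derivative_ge mOmega mA3 mC _ tphi) => x Ox.
have [_ _ p3] := pos Ox; have /andP[t0 _] := t_bounds Ox; split; rewrite ?invr_gt0//.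
- exact: dA3.
- exact: dC.
Qed.

End Slicing.

(** * Triangles: test functions *)

Section Triangle.
Context {R : realType}.
Notation plane := (measurableTypeR R * measurableTypeR R)%type.
Implicit Types (a b c p : R * R) (phi : R * R -> R).

Definition det3 a b c : R :=
  (b.1 - a.1) * (c.2 - a.2) - (b.2 - a.2) * (c.1 - a.1).

Definition sqr_dist a b : R := (b.1 - a.1) ^+ 2 + (b.2 - a.2) ^+ 2.

Lemma det3_rot a b c : det3 b c a = det3 a b c.
Proof. by rewrite /det3; ring. Qed.

Lemma open_triangle_rot a b c : open_triangle b c a = open_triangle a b c.
Proof.
apply/seteqP; split=> p [l [m [n [l0 m0 n0 s ->]]]].
  by exists n, l, m; split=> //; [rewrite -s; ring|rewrite addrC addrA].
by exists m, n, l; split=> //; [rewrite -s; ring|rewrite -addrA addrC].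
Qed.

Variables (a b c : R * R).
Hypothesis D0 : det3 a b c != 0.
Let D := det3 a b c.
Let w1 := b.1 - a.1.
Let w2 := b.2 - a.2.
Let q1 := c.1 - a.1.
Let q2 := c.2 - a.2.
Let L := w1 ^+ 2 + w2 ^+ 2.
Let T := open_triangle a b c.

Let DE : D = w1 * q2 - w2 * q1. Proof. by []. Qed.

Let L0 : 0 < L.
Proof.
rewrite lt0r addr_ge0 ?sqr_ge0// andbT paddr_eq0 ?sqr_ge0// !sqrf_eq0.
by apply: contra D0 => /andP[/eqP w10 /eqP w20]; rewrite -/D DE w10 w20 !mul0r subr0.
Qed.

Let a2 := q2 / D.
Let b2 := - q1 / D.
Let c2 := (a.2 * q1 - a.1 * q2) / D.
Let a3 := - w2 / D.
Let b3 := w1 / D.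
Let c3 := (a.1 * w2 - a.2 * w1) / D.
Let a1 := - a2 - a3.
Let b1 := - b2 - b3.
Let c1 := 1 - c2 - c3.

Lemma open_triangleE p : open_triangle a b c p <->
  [/\ 0 < affine a1 b1 c1 p, 0 < affine a2 b2 c2 p & 0 < affine a3 b3 c3 p].
Proof.
have dn0 : w1 * q2 - w2 * q1 != 0 by rewrite -DE.
split=> [[l [m [n [l0 m0 n0 s pE]]]]|[h1 h2 h3]].
  have lE : l = 1 - m - n by rewrite -s; ring.
  have E2 : affine a2 b2 c2 p = m.
    rewrite pE /affine /a2 /b2 /c2 /= DE lE /GRing.scale /=.
    by move: dn0; rewrite /w1 /w2 /q1 /q2 => dn0; field.
  have E3 : affine a3 b3 c3 p = n.
    rewrite pE /affine /a3 /b3 /c3 /= DE lE /GRing.scale /=.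
    by move: dn0; rewrite /w1 /w2 /q1 /q2 => dn0; field.
  have E1 : affine a1 b1 c1 p = l.
    have -> : affine a1 b1 c1 p = 1 - affine a2 b2 c2 p - affine a3 b3 c3 p.
      by rewrite /affine /a1 /b1 /c1; ring.
    by rewrite E2 E3 lE.
  by rewrite E1 E2 E3.
exists (affine a1 b1 c1 p), (affine a2 b2 c2 p), (affine a3 b3 c3 p); split=> //.
  by rewrite /affine /a1 /b1 /c1; ring.
rewrite [LHS]surjective_pairing; congr pair; rewrite /= /GRing.scale /=;
  rewrite /affine /a1 /b1 /c1 /a2 /b2 /c2 /a3 /b3 /c3 DE;
  by move: dn0; rewrite /w1 /w2 /q1 /q2 => dn0; field.
Qed.

Lemma open_open_triangle : open (open_triangle a b c).
Proof.
have -> : open_triangle a b c = affine a1 b1 c1 @^-1` [set x | 0 < x] `&`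
    (affine a2 b2 c2 @^-1` [set x | 0 < x] `&` affine a3 b3 c3 @^-1` [set x | 0 < x]).
  apply/seteqP; split=> p; first by move/open_triangleE => [].
  by move=> [? [? ?]]; apply/open_triangleE.
have o x y z : open (affine x y z @^-1` [set t : R | 0 < t]).
  apply: open_comp => [p _|]; last exact: open_gt.
  exact: (smooth_continuous (smooth_affine _ _ _)).
by apply: openI => //; exact: openI.
Qed.

Let mT : measurable (T : set plane).
Proof. by apply: measurable_open_plane; exact: open_open_triangle. Qed.

Let v := (D * w2 / L, - (D * w1 / L)).
Let w := (w1, w2).
Let x := D ^+ 2 / L ^+ 2.
Notation test := (test_function T).
Notation "'\I' f" := (\int[area]_(x in (T : set plane)) f x)
  (at level 36, f at level 36).

Let posT p : T p -> [/\ 0 < affine a1 b1 c1 p, 0 < affine a2 b2 c2 p & 0 < affine a3 b3 c3 p].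
Proof. by move/open_triangleE. Qed.

Let sum1 p : affine a1 b1 c1 p + affine a2 b2 c2 p + affine a3 b3 c3 p = 1.
Proof. by rewrite /affine /a1 /b1 /c1; ring. Qed.

Let Dn0 : w1 * q2 - w2 * q1 != 0. Proof. by rewrite -DE. Qed.
Let Ln0 : w1 ^+ 2 + w2 ^+ 2 != 0. Proof. by rewrite -/L gt_eqF. Qed.

Let hw1 : a1 * w.1 + b1 * w.2 = -1.
Proof. by rewrite /a1 /b1 /a2 /b2 /a3 /b3 /w /= DE; field. Qed.
Let hw2 : a2 * w.1 + b2 * w.2 = 1.
Proof. by rewrite /a2 /b2 /w /= DE; field. Qed.
Let hw3 : a3 * w.1 + b3 * w.2 = 0.
Proof. by rewrite /a3 /b3 /w /= DE; field. Qed.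
Let hv3 : a3 * v.1 + b3 * v.2 = -1.
Proof. by rewrite /a3 /b3 /v /= /L DE; field; rewrite ?Dn0 ?Ln0. Qed.

Let x0 : 0 < x.
Proof. by apply: divr_gt0; [rewrite exprn_even_gt0|exact: exprn_gt0]. Qed.

Let lin (f g : R * R -> R) (k : R) : test f -> test g ->
  \I (f + cst k * g) = \I f + k * \I g.
Proof.
by move=> tf tg; rewrite (RintegralD_test mT tf (testZ k tg)) (RintegralZ_test mT k tg).
Qed.

Let Cf : R * R -> R := fun y => (affine (- a3) (- b3) (1 - c3) y)^-1.

Let mC : multiplier T Cf.
Proof.
apply: multiplier_inv => y /posT[p1 p2 p3]; have := sum1 y.
have -> : affine (- a3) (- b3) (1 - c3) y = 1 - affine a3 b3 c3 y by rewrite /affine; ring.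
by move=> s; rewrite gt_eqF//; lra.
Qed.

Lemma triangle_grad phi : test phi ->
  1700 * (\I (phi * phi)) ^+ 2 <= D ^+ 2 *
    (\I (partial 0 phi * partial 0 phi + partial 1 phi * partial 1 phi)) ^+ 2.
Proof.
move=> tphi; set I := \I (phi * phi); set G := \I _.
have sphi := test_smooth tphi.
have I0 : 0 <= I by apply: Rintegral_ge0 => y _; rewrite fctE -expr2 sqr_ge0.
pose al := (1 + Num.sqrt (1 + 4 * (49 / 5 * x))) / 2.
have s0 : 0 <= 1 + 4 * (49 / 5 * x) by move: x0; lra.
have al1 : 1 <= al.
  have : 1 <= Num.sqrt (1 + 4 * (49 / 5 * x)).
    by rewrite -[leLHS]sqrtr1 ler_sqrt//; move: x0; lra.
  by rewrite /al; lra.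
have alE : al * (al - 1) = 49 / 5 * x.
  have := sqr_sqrtr s0; rewrite /al; set s := Num.sqrt _ => sE.
  have -> : (1 + s) / 2 * ((1 + s) / 2 - 1) = (s ^+ 2 - 1) / 4 by field.
  by rewrite sE; field.
have tw := test_dird w tphi; have tv := test_dird v tphi.
have h1 : \I (cst (49 / 5) * (Cf * Cf) * (phi * phi)) <= \I (dird w phi * dird w phi).
  exact: (slice_poincare mT posT sum1 hw1 hw2 hw3 tphi).
have h2 : \I (cst ((al - 1 / 16) * (al + 129 / 16)) * (phi * phi)) <=
    \I (dird v phi * dird v phi + cst (al * (al - 1)) * (Cf * Cf) * (phi * phi)).
  exact: (slice_hardy mT posT sum1 hv3 al tphi).
have tC : test (Cf * Cf * (phi * phi)) by exact: (multiplierM mC mC (testM tphi tphi)).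
have lam : (al - 1 / 16) * (al + 129 / 16) * I <= D ^+ 2 / L * G.
  rewrite (RintegralZ_test mT _ (testM tphi tphi)) in h2; apply: (le_trans h2).
  rewrite -(mulrA (cst (al * _))) (lin _ (testM tv tv) tC).
  rewrite -(mulrA (cst _)) (RintegralZ_test mT _ tC) in h1.
  apply: (@le_trans _ _ (\I (dird v phi * dird v phi) + x * \I (dird w phi * dird w phi))).
    have xE u : 49 / 5 * x * u = x * (49 / 5 * u) by ring.
    by rewrite lerD2l alE xE; apply: ler_wpM2l h1; exact: ltW.
  rewrite -(lin _ (testM tv tv) (testM tw tw)) -(RintegralZ_test mT).
    rewrite le_eqVlt; apply/orP; left; apply/eqP; congr (Rintegral _ _ _); apply/funext => y.
    rewrite (dirdE v sphi) (dirdE w sphi) !fctE /v /w /x /= /L.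
    by field.
  by apply: testD; apply: testM; [exact: (test_partials [:: 0] tphi)..|
    exact: (test_partials [:: 1] tphi)|exact: (test_partials [:: 1] tphi)].
have lam2 := hardy_const_ge al1 alE.
have la0 : 0 <= (al - 1 / 16) * (al + 129 / 16) by apply: mulr_ge0; lra.
have : ((al - 1 / 16) * (al + 129 / 16) * I) ^+ 2 <= (D ^+ 2 / L * G) ^+ 2.
  have l1 : 0 <= (al - 1 / 16) * (al + 129 / 16) * I by exact: mulr_ge0.
  by rewrite ler_sqr ?nnegrE// (le_trans l1).
rewrite exprMn => lam3.
have : 1700 * x * I ^+ 2 <= (D ^+ 2 / L * G) ^+ 2.
  by apply: le_trans lam3; apply: ler_wpM2r => //; exact: sqr_ge0.
have -> : 1700 * x * I ^+ 2 = x * (1700 * I ^+ 2) by ring.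
have -> : (D ^+ 2 / L * G) ^+ 2 = x * (D ^+ 2 * G ^+ 2) by rewrite /x; field; rewrite gt_eqF.
by rewrite ler_pM2l.
Qed.

Lemma dird_mul u f g : test f -> test g ->
  dird u (f * g) = dird u f * g + f * dird u g.
Proof.
move=> tf tg; apply/funext => y.
by have [_ E] := has_deriveM (has_derive_test u y tf) (has_derive_test u y tg); rewrite -[LHS]/('D_u (f * g) y) E.
Qed.

Lemma integral_hessian (u z : R * R) phi : test phi ->
  \I (dird u (dird u phi) * dird z (dird z phi)) =
  \I (dird u (dird z phi) * dird u (dird z phi)).
Proof.
move=> tphi; have tu := test_dird u tphi; have tz := test_dird z tphi.
have tuu := test_dird u tu; have tzz := test_dird z tz.
have tuz := test_dird u tz; have tzu := test_dird z tu.
have E1 := integral_test_derive u (testM tu tzz).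
have E2 := integral_test_derive z (testM tu tuz).
rewrite -/(dird u _) (dird_mul u tu tzz) in E1.
rewrite -/(dird z _) (dird_mul z tu tuz) in E2.
rewrite (RintegralD_test mT (testM tuu tzz) (testM tu (test_dird u tzz))) in E1.
rewrite (RintegralD_test mT (testM tzu tuz) (testM tu (test_dird z tuz))) in E2.
rewrite (dird_comm u z (test_smooth tz)) in E1.
rewrite (dird_comm z u (test_smooth tphi)) in E2.
exact: addIr (etrans E1 (esym E2)).
Qed.

Hypothesis longest : sqr_dist a c <= L /\ sqr_dist b c <= L.

Let x34 : x <= 3 / 4.
Proof.
have [h1 h2] := longest.
rewrite /x ler_pdivrMr ?exprn_gt0// DE.
move: h1 h2; rewrite /sqr_dist /L -/q1 -/q2.
have -> : c.1 - b.1 = q1 - w1 by rewrite /q1 /w1; ring.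
have -> : c.2 - b.2 = q2 - w2 by rewrite /q2 /w2; ring.
move: w1 w2 q1 q2 => y1 y2 z1 z2 h1 h2.
have Q : z1 ^+ 2 + z2 ^+ 2 <= 2 * (z1 * y1 + z2 * y2) by lra.
have Q2 : (z1 ^+ 2 + z2 ^+ 2) ^+ 2 <= (2 * (z1 * y1 + z2 * y2)) ^+ 2.
  have Q0 : 0 <= z1 ^+ 2 + z2 ^+ 2 by rewrite addr_ge0 ?sqr_ge0.
  by rewrite ler_sqr ?nnegrE// (le_trans Q0).
have P : 0 <= (y1 ^+ 2 + y2 ^+ 2 - (z1 ^+ 2 + z2 ^+ 2)) *
    (3 * (y1 ^+ 2 + y2 ^+ 2) - (z1 ^+ 2 + z2 ^+ 2)).
  apply: mulr_ge0; first by lra.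
  have := sqr_ge0 z1; have := sqr_ge0 z2; lra.
lra.
Qed.

Let small_x : x <= 1 / 12 -> x * (16 * 22 * 13) <= 24 * 16.
Proof. by move: x => y; lra. Qed.

Let twox0 : 0 <= 2 * x. Proof. by move: x0; lra. Qed.

Lemma triangle_lap phi : test phi ->
  16 * 22 * 13 * \I (phi * phi) <= D ^+ 2 *
    \I ((partial 0 (partial 0 phi) + partial 1 (partial 1 phi)) *
        (partial 0 (partial 0 phi) + partial 1 (partial 1 phi))).
Proof.
move=> tphi; set I := \I (phi * phi); set F := partial 0 _ + _; set G := \I _.
have sphi := test_smooth tphi.
have I0 : 0 <= I by apply: Rintegral_ge0 => y _; rewrite fctE -expr2 sqr_ge0.
have tF : test F.
  by apply: testD; [exact: (test_partials [:: 0; 0] tphi)|exact: (test_partials [:: 1; 1] tphi)].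
have tw := test_dird w tphi; have tv := test_dird v tphi.
have tww := test_dird w tw; have tvv := test_dird v tv; have twv := test_dird w tv.
set W := dird w (dird w phi) in tww; set V := dird v (dird v phi) in tvv.
have tVV := testM tvv tvv; have tWW := testM tww tww; have tWV := testM tww tvv.
have E : (D ^+ 2 / L) ^+ 2 * G = \I (V * V) + 2 * x * \I (W * V) + x ^+ 2 * \I (W * W).
  rewrite -(lin _ tVV tWV) -(lin _ (testD tVV (testZ _ tWV)) tWW) -(RintegralZ_test mT _ (testM tF tF)).
  apply: eq_Rintegral => y _.
  rewrite /V /W (dird_dird v v sphi) (dird_dird w w sphi) /F.
  move: (partial 0 (partial 0 phi)) (partial 1 (partial 0 phi)) (partial 1 (partial 1 phi)) => g h k.
  rewrite !fctE /v /w /x /= /L; move: (g y) (h y) (k y) => {}g {}h {}k.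
  by field.
have tC2 := multiplierM mC mC; have tC4 := multiplierM (multiplierM tC2 mC) mC.
have tphi2 := testM tphi tphi; have tv2 := testM tv tv.
have main : x * (16 * 22 * 13) * I <= (D ^+ 2 / L) ^+ 2 * G.
  have hww : \I (cst (24 * 16) * (Cf * Cf * Cf * Cf) * (phi * phi)) <= \I (W * W).
    exact: (slice_clamped_w mT posT sum1 hw1 hw2 tphi).
  have hwv : \I (cst (49 / 5) * (Cf * Cf) * (dird v phi * dird v phi)) <= \I (W * V).
    rewrite (integral_hessian w v tphi).
    exact: (slice_poincare mT posT sum1 hw1 hw2 hw3 tv).
  rewrite -mulrA (RintegralZ_test mT _ (tC4 _ tphi2)) in hww.
  rewrite -mulrA (RintegralZ_test mT _ (tC2 _ tv2)) in hwv.
  have WV0 : 0 <= \I (W * V).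
    rewrite (integral_hessian w v tphi).
    by apply: Rintegral_ge0 => y _; rewrite fctE -expr2 sqr_ge0.
  have WW0 : 0 <= \I (W * W).
    by apply: Rintegral_ge0 => y _; rewrite fctE -expr2 sqr_ge0.
  have [xs|xl] := leP x (1 / 12).
    have hvv : \I (cst (24 * 16) * (phi * phi)) <= \I (V * V).
      exact: (slice_clamped_v mT posT sum1 hv3 tphi).
    rewrite (RintegralZ_test mT _ tphi2) -/I in hvv.
    have h1 := ler_wpM2r I0 (small_x xs).
    apply: (le_trans h1); apply: (le_trans hvv); rewrite E -addrA lerDl.
    exact: addr_ge0 (mulr_ge0 twox0 WV0) (mulr_ge0 (sqr_ge0 _) WW0).
  have x1 : 1 / 12 <= x <= 3 / 4 by rewrite (ltW xl) x34.
  have [s [j [k [s0 b0 hm]]]] := rellich_num_ge x1.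
  have hV : \I (cst (x * (16 * 22 * 13)) * (phi * phi)) <=
      \I (V * V + cst (98 / 5 * x) * (Cf * Cf) * (dird v phi * dird v phi) +
      cst (24 * 16 * x ^+ 2) * (Cf * Cf * Cf * Cf) * (phi * phi)).
    exact: (slice_rellich mT posT sum1 hv3 s0 b0 hm tphi).
  rewrite (RintegralZ_test mT _ tphi2) -/I in hV; apply: (le_trans hV); rewrite E.
  rewrite -(mulrA (cst (98 / 5 * x))) -(mulrA (cst (24 * 16 * x ^+ 2))).
  rewrite (lin _ (testD tVV (testZ _ (tC2 _ tv2))) (tC4 _ tphi2)).
  rewrite (lin _ tVV (tC2 _ tv2)) -!addrA lerD2l.
  apply: lerD.
    have -> u : 98 / 5 * x * u = 2 * x * (49 / 5 * u) by field.
    exact: ler_wpM2l twox0 _ _ hwv.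
  have -> u : 24 * 16 * x ^+ 2 * u = x ^+ 2 * (24 * 16 * u) by ring.
  by apply: ler_wpM2l hww; exact: sqr_ge0.
move: main; have -> : x * (16 * 22 * 13) * I = x * (16 * 22 * 13 * I) by ring.
have -> : (D ^+ 2 / L) ^+ 2 * G = x * (D ^+ 2 * G) by rewrite /x; field; rewrite gt_eqF.
by rewrite ler_pM2l.
Qed.

End Triangle.

(** * Cutoff functions and the fundamental lemma *)

Section Cutoff.
Context {R : realType}.
Implicit Types (d s h : R) (k : nat).

Definition cutoff d k s : R := if 0 < s then s^-1 ^+ k * expR (- (d / s)) else 0.

Lemma cutoff_le0 d k s : s <= 0 -> cutoff d k s = 0.
Proof. by rewrite leNgt /cutoff => /negbTE ->. Qed.

Lemma cutoff_ge0 d k s : 0 <= cutoff d k s.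
Proof.
rewrite /cutoff; case: ifPn => // s0.
by rewrite mulr_ge0 ?expR_ge0// exprn_ge0// invr_ge0 ltW.
Qed.

Lemma exprn_expRN_le (y : R) k : 0 <= y -> y ^+ k * expR (- y) <= k`!%:R.
Proof.
move=> y0; rewrite expRN ler_pdivrMr ?expR_gt0//.
case: k => [|k]; first by rewrite expr0 mul1r -[leLHS]expR0 ler_expR.
have := expR_ge1Dxn k y0; set F := (k.+1`!)%:R => h.
have F0 : 0 < F by rewrite ltr0n fact_gt0.
rewrite mulrC -ler_pdivrMr//; apply: le_trans h.
by rewrite lerDr ler01.
Qed.

Lemma cutoff_le d k s : 0 < d -> `|cutoff d k s| <= k`!%:R / d ^+ k.
Proof.
move=> d0; rewrite ger0_norm ?cutoff_ge0// /cutoff; case: ifPn => [s0|_]; last first.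
  by rewrite divr_ge0// exprn_ge0// ltW.
rewrite ler_pdivlMr ?exprn_gt0// mulrAC -exprMn mulrC [s^-1 * d]mulrC mulrC.
by apply: exprn_expRN_le; rewrite divr_ge0// ltW.
Qed.

Lemma is_derive_cutoff d k s : 0 < d ->
  is_derive s 1 (cutoff d k) (d * cutoff d k.+2 s - k%:R * cutoff d k.+1 s).
Proof.
move=> d0; have [s0|s0|->] := ltgtP s 0.
- rewrite !cutoff_le0 ?(ltW s0)// !mulr0 subr0.
  apply: near_eq_is_derive (is_derive_cst 0 s 1).
  by apply: filterS (lt_nbhsl s0) => t /ltW/cutoff_le0 ->.
- have sn0 : s != 0 by rewrite gt_eqF.
  have hV : is_derive s (1 : R) (fun t => t^-1) (- s^-1 ^+ 2).
    apply: DeriveDef; first exact: derivableV.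
    by rewrite deriveV// derive_id [_ *: _]mulr1 exprVn.
  have hE : is_derive s (1 : R) (expR \o (fun t => - (d / t))) (d * s^-1 ^+ 2 * expR (- (d / s))).
    have hN : is_derive s (1 : R) (fun t => - (d / t)) (d * s^-1 ^+ 2).
      have -> : (fun t => - (d / t)) = (- d) \*: (fun t : R => t^-1).
        by apply/funext => t; rewrite /= /GRing.scale /= mulNr.
      by apply: is_derive_eq; rewrite /GRing.scale /= mulrNN.
    by apply: is_derive_eq; exact: mulrC.
  have hX : is_derive s (1 : R) (fun t : R => t^-1 ^+ k) (- (k%:R * s^-1 ^+ k.+1)).
    have -> : (fun t : R => t^-1 ^+ k) = (fun t : R => t^-1) ^+ k by apply/funext => t; rewrite exprfctE.
    apply: is_derive_eq; rewrite /GRing.scale /=.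
    by case: (k) => [|k']; rewrite ?mul0r ?oppr0// !exprS; ring.
  have hM := is_deriveM hX hE.
  refine (near_eq_is_derive _ (is_derive_eq hM _)).
    by apply: filterS (lt_nbhsr s0) => t t0; rewrite /cutoff t0.
  by rewrite /cutoff s0 /GRing.scale /= !exprS; ring.
- rewrite !cutoff_le0// !mulr0 subr0.
  suff H : (fun h : R => h^-1 *: (cutoff d k (h *: 1 + 0) - cutoff d k 0)) @ 0^' --> (0 : R).
    split; first by apply/cvg_ex; exists 0.
    by apply: cvg_lim.
  pose C : R := (k.+2)`!%:R / d ^+ k.+2.
  have C0 : 0 <= C by rewrite divr_ge0// exprn_ge0// ltW.
  apply/cvgrPdist_le => e e0.
  have C1 : 0 < C + 1 by rewrite ltr_wpDl.
  near=> h.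
  rewrite sub0r normrN addr0 [h *: 1]mulr1 (cutoff_le0 d k (lexx 0)) subr0.
  rewrite /GRing.scale /= normrM normfV.
  have [h0|h0] := leP h 0; first by rewrite cutoff_le0// normr0 mulr0 ltW.
  have -> : cutoff d k h = h ^+ 2 * cutoff d k.+2 h.
    by rewrite /cutoff h0 !exprS; field; rewrite gt_eqF.
  rewrite normrM (gtr0_norm h0) ger0_norm ?sqr_ge0// expr2 !mulrA mulVf ?gt_eqF// mul1r.
  apply: (@le_trans _ _ (h * C)); first by apply: ler_wpM2l; [exact: ltW|exact: cutoff_le].
  have : h * (C + 1) <= e.
    rewrite -ler_pdivlMr//; near: h.
    apply: nbhs_dnbhs; apply: filterS (lt_nbhsl (divr_gt0 e0 C1)) => t /ltW //.
  by apply: le_trans; rewrite ler_wpM2l ?lerDl ?ler01// ltW.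
Unshelve. all: by end_near.
Qed.

Lemma cutoff0_le1 d s : 0 < d -> cutoff d 0 s <= 1.
Proof.
by move=> d0; have := @cutoff_le d 0 s d0; rewrite ger0_norm ?cutoff_ge0// fact0 expr0 divr1.
Qed.

Lemma cvg_cutoff0 s : (fun n : nat => cutoff (n.+1%:R^-1) 0 s) @ \oo --> (((0 < s)%R : bool)%:R : R).
Proof.
rewrite /cutoff; case: (0 < s) => /=; last exact: cvg_cst.
under eq_fun do rewrite expr0 mul1r.
have h : (fun n : nat => - (n.+1%:R^-1 / s)) @ \oo --> (0 : R).
  rewrite -[X in _ --> X]oppr0; apply: cvgN.
  rewrite -[X in _ --> X](mul0r s^-1); apply: cvgM; last exact: cvg_cst.
  exact: cvg_harmonic.
by have := cvg_comp _ _ h (@continuous_expR R 0); rewrite expR0.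
Qed.

Implicit Types (q : R * R -> R).

Lemma differentiable_cutoff d k q x : 0 < d -> differentiable q x ->
  differentiable (cutoff d k \o q) x.
Proof.
move=> d0 dq; apply: differentiable_comp => //.
by apply/derivable1_diffP; case: (is_derive_cutoff k (q x) d0).
Qed.

Lemma partial_cutoff d k q i : 0 < d -> (forall x, differentiable q x) ->
  partial i (cutoff d k \o q) =
  (cst d * (cutoff d k.+2 \o q) + cst (- k%:R) * (cutoff d k.+1 \o q)) * partial i q.
Proof.
move=> d0 dq; apply/funext => x.
have [db dbE] := is_derive_cutoff k (q x) d0.
rewrite /partial deriveE; last exact: differentiable_cutoff.
have dbq : differentiable (cutoff d k) (q x) by exact/derivable1_diffP.
rewrite diff_comp//= diff1E// derive1E dbE /GRing.scale /= !fctE -deriveE//.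
by rewrite mulrC mulNr.
Qed.

Lemma smooth_cutoff d k q : 0 < d -> smooth q -> smooth (cutoff d k \o q).
Proof.
move=> d0 sq; have dq x := smooth_differentiable x sq.
pose base : set (R * R -> R) := [set f | (exists j, f = cutoff d j \o q) \/ exists t : seq 'I_2, f = partials t q].
suff hb f : base f -> (forall x, differentiable f x) /\ forall i, alg base (partial i f).
  by apply: (alg_smooth hb); apply: alg_base; left; exists k.
move=> [[j ->]|[t ->]]; split=> [x|i].
- exact: differentiable_cutoff.
- rewrite (partial_cutoff j i d0 dq); apply: alg_mul.
    by apply: alg_add; (apply: alg_mul; first exact: alg_cst); apply: alg_base; left; [exists j.+2|exists j.+1].
  by apply: alg_base; right; exists [:: i].
- exact: sq.
- by apply: alg_base; right; exists (i :: t).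
Qed.

End Cutoff.

Section FundamentalLemma.
Context {R : realType}.
Notation plane := (measurableTypeR R * measurableTypeR R)%type.
Implicit Types (a b c d : R) (Omega : set (R * R)) (f : R * R -> R).

Definition box_fun a b c d (e : R) : R * R -> R :=
  (cutoff e 0 \o affine 1 0 (- a)) * (cutoff e 0 \o affine (-1) 0 b) *
  ((cutoff e 0 \o affine 0 1 (- c)) * (cutoff e 0 \o affine 0 (-1) d)).

Lemma box_funE a b c d e x : box_fun a b c d e x =
  cutoff e 0 (x.1 - a) * cutoff e 0 (b - x.1) * (cutoff e 0 (x.2 - c) * cutoff e 0 (d - x.2)).
Proof.
rewrite /box_fun !fctE /affine /=; congr (cutoff _ _ _ * cutoff _ _ _ * (cutoff _ _ _ * cutoff _ _ _)); ring.
Qed.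

Lemma box_fun_ge0 a b c d e x : 0 <= box_fun a b c d e x.
Proof. by rewrite box_funE !mulr_ge0 ?cutoff_ge0. Qed.

Lemma box_fun_le1 a b c d e x : 0 < e -> box_fun a b c d e x <= 1.
Proof.
by move=> e0; rewrite box_funE !mulr_ile1// ?cutoff0_le1// ?mulr_ge0// ?cutoff_ge0.
Qed.

Lemma box_test Omega a b c d e : 0 < e -> closed_box a b c d `<=` Omega ->
  test_function Omega (box_fun a b c d e).
Proof.
move=> e0 sub; apply: (@test_functionI _ _ (closed_box a b c d)) => //.
- by do ?[apply: smoothM|apply: smooth_cutoff => //; exact: smooth_affine].
- by apply: compact_setX; exact: segment_compact.
- move=> x xK; rewrite box_funE.
  have [h1|h1] := leP (x.1 - a) 0; first by rewrite (cutoff_le0 _ _ h1) !mul0r.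
  have [h2|h2] := leP (b - x.1) 0; first by rewrite (cutoff_le0 _ _ h2) mulr0 !mul0r.
  have [h3|h3] := leP (x.2 - c) 0; first by rewrite (cutoff_le0 _ _ h3) mul0r mulr0.
  have [h4|h4] := leP (d - x.2) 0; first by rewrite (cutoff_le0 _ _ h4) !mulr0.
  by exfalso; apply: xK; split; rewrite /= in_itv /=; apply/andP; split; lra.
Qed.

Lemma cvg_box_fun a b c d x :
  (fun n : nat => box_fun a b c d n.+1%:R^-1 x) @ \oo --> (\1_(box a b c d) x : R).
Proof.
under eq_fun do rewrite box_funE.
have -> : \1_(box a b c d) x = ((0 < x.1 - a)%R : bool)%:R * ((0 < b - x.1)%R : bool)%:R *
   (((0 < x.2 - c)%R : bool)%:R * ((0 < d - x.2)%R : bool)%:R) :> R.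
  rewrite indicE -!natrM !mulnb; congr (nat_of_bool _)%:R.
  rewrite !subr_gt0; apply/idP/idP; rewrite inE /box /= !in_itv /=.
    by move=> [/= /andP[-> ->] /andP[-> ->]].
  by move=> /andP[/andP[h1 h2] /andP[h3 h4]]; split; rewrite /= ?h1 ?h2 ?h3 ?h4.
by do ?[apply: cvgM]; exact: cvg_cutoff0.
Qed.

Lemma integral_box_eq0 Omega f a b c d : measurable (Omega : set plane) ->
  area.-integrable (Omega : set plane) (EFin \o f) ->
  (forall phi, test_function Omega phi ->
     \int[area]_(x in (Omega : set plane)) (f x * phi x) = 0) ->
  closed_box a b c d `<=` Omega ->
  (\int[area]_(x in (box a b c d : set plane)) (f x)%:E = 0)%E.
Proof.
move=> mO fi f0 sub.
have subO : box a b c d `<=` Omega.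
  by apply: subset_trans sub => x [h1 h2]; split; [move: h1|move: h2];
    rewrite /= !in_itv /= => /andP[/ltW -> /ltW ->].
have mf := measurable_int _ fi.
have e0 n : 0 < n.+1%:R^-1 :> R by rewrite invr_gt0.
have mbf n : measurable_fun (Omega : set plane) (box_fun a b c d n.+1%:R^-1 : plane -> R).
  apply: measurable_funS (measurable_fun_continuous _) => //.
  exact: smooth_continuous (test_smooth (box_test (e0 n) sub)).
have mf' : measurable_fun (Omega : set plane) f by exact/measurable_EFinP.
pose g n := EFin \o (fun x => f x * box_fun a b c d n.+1%:R^-1 x).
have mg n : measurable_fun (Omega : set plane) (g n).
  by apply/measurable_EFinP; exact: measurable_funM.
have gi n : area.-integrable (Omega : set plane) (g n).
  apply: (le_integrable mO (mg n) _ fi) => x Ox /=; rewrite lee_fin normrM.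
  by rewrite ler_piMr// ger0_norm ?box_fun_ge0 ?box_fun_le1.
have g0 n : (\int[area]_(x in (Omega : set plane)) g n x = 0)%E.
  have := f0 _ (box_test (e0 n) sub); rewrite /Rintegral => h.
  by rewrite -[LHS]fineK ?h//; exact: integrable_fin_num.
have mb := measurable_box a b c d.
pose l := (EFin \o f) \_ (box a b c d).
have ml : measurable_fun (Omega : set plane) l.
  by apply/(measurable_restrict _ mb mO); exact: (measurable_funS mO (@subIsetl _ _ _) mf).
have gl x : (g ^~ x) @ \oo --> l x.
  have -> : l x = (f x * \1_(box a b c d) x)%:E.
    by rewrite /l patchE indicE; case: ifP => _; rewrite ?mulr1 ?mulr0.
  by apply/cvg_EFin; [exact: nearW|apply: cvgM; [exact: cvg_cst|exact: cvg_box_fun]].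
have dom n x : (`|g n x| <= `|(EFin \o f) x|)%E.
  by rewrite /= lee_fin normrM ler_piMr// ger0_norm ?box_fun_ge0 ?box_fun_le1.
have aegl : {ae area, forall x : plane, Omega x -> (g ^~ x) @ \oo --> l x}.
  by apply: aeW => x _; exact: gl.
have aedom : {ae area, forall (x : plane) n, Omega x -> (`|g n x| <= (abse \o (EFin \o f)) x)%E}.
  by apply: aeW => x n _; exact: dom.
have [_ _] := dominated_convergence mO mg ml aegl (integrable_abse fi) aedom.
under eq_fun do rewrite g0.
move=> /(cvg_unique _ (cvg_cst _)) => E.
rewrite -(setIidr subO) integral_mkcondr; apply/esym.
exact: E.
Qed.

Definition boxes : set (set (R * R)) := [set A | exists a b c d, A = box a b c d].

Lemma setI_box a b c d a' b' c' d' : box a b c d `&` box a' b' c' d' =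
  box (Num.max a a') (Num.min b b') (Num.max c c') (Num.min d d').
Proof.
apply/seteqP; split=> x; rewrite /box /= !in_itv /= !gt_max !lt_min.
  by move=> [[/andP[-> ->] /andP[-> ->]] [/andP[-> ->] /andP[-> ->]]].
by move=> [/andP[/andP[-> ->] /andP[-> ->]] /andP[/andP[-> ->] /andP[-> ->]]].
Qed.

Lemma setI_closed_boxes : setI_closed boxes.
Proof.
move=> _ _ [a [b [c [d ->]]]] [a' [b' [c' [d' ->]]]]; rewrite setI_box.
by exists (Num.max a a'), (Num.min b b'), (Num.max c c'), (Num.min d d').
Qed.

Lemma measurable_boxes : @measurable _ plane = <<s boxes >>.
Proof.
apply/seteqP; split; last first.
  apply: smallest_sub; first exact: sigma_algebra_measurable.
  by move=> _ [a [b [c [d ->]]]]; exact: measurable_box.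
rewrite measurable_prod_measurableType.
apply: smallest_sub; first exact: smallest_sigma_algebra.
pose U := g_sigma_algebraType boxes.
have mfst : measurable_fun setT (fst : U -> measurableTypeR R).
  apply: (measurability _ (RGenOpens.measurableE R)).
  move=> _ [_ [a [b ->] <-]]; rewrite setTI.
  have -> : fst @^-1` `]a, b[ = \bigcup_n (box a b (- n%:R) n%:R : set U).
    apply/seteqP; split=> [x /= xab|x [n _] []//].
    have [n _ xn] : exists2 n : nat, True & `|x.2| < n%:R.
      by exists (Num.truncn `|x.2|).+1 => //; exact: truncnS_gt.
    by exists n => //; split=> //=; rewrite in_itv /= -ltr_norml.
  by apply: bigcupT_measurable => n; apply: sub_sigma_algebra; exists a, b, (- n%:R), n%:R.
have msnd : measurable_fun setT (snd : U -> measurableTypeR R).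
  apply: (measurability _ (RGenOpens.measurableE R)).
  move=> _ [_ [c [d ->] <-]]; rewrite setTI.
  have -> : snd @^-1` `]c, d[ = \bigcup_n (box (- n%:R) n%:R c d : set U).
    apply/seteqP; split=> [x /= xab|x [n _] []//].
    have [n _ xn] : exists2 n : nat, True & `|x.1| < n%:R.
      by exists (Num.truncn `|x.1|).+1 => //; exact: truncnS_gt.
    by exists n => //; split=> //=; rewrite in_itv /= -ltr_norml.
  by apply: bigcupT_measurable => n; apply: sub_sigma_algebra; exists (- n%:R), n%:R, c, d.
move=> _ [A mA [B mB <-]].
have -> : A `*` B = (setT `&` fst @^-1` A) `&` (setT `&` snd @^-1` B) :> set U.
  by rewrite !setTI.
by apply: (@measurableI _ U); [exact: mfst|exact: msnd].
Qed.

Lemma integral_subbox_eq0 f a b c d (E : set plane) :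
  area.-integrable (box a b c d : set plane) (EFin \o f) ->
  (forall a' b' c' d', closed_box a' b' c' d' `<=` closed_box a b c d ->
     (\int[area]_(x in (box a' b' c' d' : set plane)) (f x)%:E = 0)%E) ->
  measurable E ->
  (\int[area]_(x in E `&` box a b c d) (f x)%:E = 0)%E.
Proof.
set Q : set plane := box a b c d => fi f0; rewrite measurable_boxes.
have mQ : measurable Q by exact: measurable_box.
have fiS A : measurable A -> area.-integrable (A `&` Q) (EFin \o f).
  by move=> mA; apply: integrableS fi => //; exact: measurableI.
apply: (@dynkin_induction _ plane boxes (fun A => (\int[area]_(x in A `&` Q) (f x)%:E = 0)%E)
  measurable_boxes setI_closed_boxes).
- by rewrite setTI; exact: f0.
- move=> _ [a' [b' [c' [d' ->]]]]; rewrite setI_box; apply: f0 => x.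
  rewrite /closed_box /= !in_itv /= !ge_max !le_min.
  by move=> [/andP[/andP[_ ->] /andP[_ ->]] /andP[/andP[_ ->] /andP[_ ->]]].
- move=> A mA A0; have mAC : measurable (~` A) by exact: measurableC.
  have mAQ : measurable (A `&` Q) by exact: measurableI.
  have mACQ : measurable (~` A `&` Q) by exact: measurableI.
  have QE : (A `&` Q) `|` (~` A `&` Q) = Q by rewrite -setIUl setUv setTI.
  have mfU : measurable_fun ((A `&` Q) `|` (~` A `&` Q)) (EFin \o f).
    by rewrite QE; exact: measurable_int fi.
  have dAQ : [disjoint A `&` Q & ~` A `&` Q].
    by rewrite /disj_set; apply/eqP; rewrite setIACA setICr set0I.
  have := integral_setU area mAQ mACQ mfU dAQ; rewrite QE A0 add0e => <-.
  exact: f0.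
- move=> F mF tF F0; rewrite setI_bigcupl integral_bigcup.
  + by rewrite eseries0// => i _ _; exact: F0.
  + exact: trivIset_setIr.
  + by move=> k; exact: measurableI.
  + by rewrite -setI_bigcupl; apply: fiS; exact: bigcupT_measurable.
Qed.

Lemma fundamental_lemma Omega f : open Omega ->
  area.-integrable (Omega : set plane) (EFin \o f) ->
  (forall phi, test_function Omega phi ->
     \int[area]_(x in (Omega : set plane)) (f x * phi x) = 0) ->
  {ae area, forall x : plane, Omega x -> f x = 0}.
Proof.
move=> oO fi f0; have mO := measurable_open_plane oO.
pose P (q : rat * rat * (rat * rat)) (x : plane) :=
  closed_box (ratr q.1.1) (ratr q.1.2) (ratr q.2.1) (ratr q.2.2) `<=` Omega ->
  box (ratr q.1.1) (ratr q.1.2) (ratr q.2.1) (ratr q.2.2) x -> f x = 0.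
have aeP q : {ae area, forall x : plane, P q x}.
  have [sub|nsub] := pselect
    (closed_box (ratr q.1.1) (ratr q.1.2) (ratr q.2.1) (ratr q.2.2) `<=` Omega); last first.
    by apply: aeW => x /nsub.
  set a := ratr _ in sub; set b := ratr _ in sub; set c := ratr _ in sub; set d := ratr _ in sub.
  have mQ := measurable_box a b c d.
  have QO : box a b c d `<=` Omega.
    by apply: subset_trans sub => x [h1 h2]; split; [move: h1|move: h2];
      rewrite /= !in_itv /= => /andP[/ltW -> /ltW ->].
  have fiQ : area.-integrable (box a b c d : set plane) (EFin \o f) by exact: integrableS fi.
  have : ae_eq area (box a b c d : set plane) (EFin \o f) (cst 0%E).
    apply: integral_ae_eq => // E EQ mE; rewrite integral0 -(setIidl EQ).
    apply: integral_subbox_eq0 => // a' b' c' d' sub'.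
    exact: integral_box_eq0 (subset_trans sub' sub).
  by apply: filterS => x /= h _ /h [].
have aeA : {ae area, forall x : plane, forall n q, unpickle n = Some q -> P q x}.
  apply: ae_foralln => n; case: (unpickle n) => [q|]; last by apply: aeW.
  by apply: filterS (aeP q) => x Px _ [<-].
apply: filterS aeA => x h Ox; have [q [xq sub]] := open_rat_box oO Ox.
exact: (h (pickle q) q (pickleK q) sub xq).
Qed.

End FundamentalLemma.

(** * Weak derivatives *)

Section WeakDerivatives.
Context {R : realType}.
Notation plane := (measurableTypeR R * measurableTypeR R)%type.
Variable Omega : set (R * R).
Hypothesis oOmega : open Omega.
Hypothesis areaOmega : (area (Omega : set plane) < +oo)%E.
Implicit Types (f g u v phi : R * R -> R).

Notation integrable f := (area.-integrable (Omega : set plane) (EFin \o f)).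
Notation test := (test_function Omega).
Notation I f := (\int[area]_(x in (Omega : set plane)) f x).

Let mOmega : measurable (Omega : set plane) := measurable_open_plane oOmega.

Lemma L2_measurable f : L2 Omega f -> measurable_fun (Omega : set plane) f.
Proof. by case. Qed.

Lemma L2_sqr_integrable f : L2 Omega f -> integrable (fun x => f x ^+ 2).
Proof.
move=> [mf fi]; apply/integrableP; split.
  by apply/measurable_EFinP; exact: measurable_funX.
by under eq_integral => x _ do rewrite /= ger0_norm ?sqr_ge0//.
Qed.

Lemma sqr_integrable_L2 f : measurable_fun (Omega : set plane) f ->
  integrable (fun x => f x ^+ 2) -> L2 Omega f.
Proof.
move=> mf /integrableP[_ h]; split=> //; apply: le_lt_trans h.
by under [leRHS]eq_integral => x _ do rewrite /= ger0_norm ?sqr_ge0//.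
Qed.

Lemma integrable_domin f g : measurable_fun (Omega : set plane) f -> integrable g ->
  (forall x, Omega x -> `|f x| <= g x) -> integrable f.
Proof.
move=> mf gi fg; apply: (le_integrable mOmega _ _ gi).
  exact/measurable_EFinP.
by move=> x Ox; rewrite /= lee_fin; apply: le_trans (fg _ Ox) (ler_norm _).
Qed.

Lemma integrableD_real f g : integrable f -> integrable g -> integrable (fun x => f x + g x).
Proof. exact: integrableD. Qed.

Lemma integrableZl_real (c : R) f : integrable f -> integrable (fun x => c * f x).
Proof. exact: integrableZl. Qed.

Lemma L2M_integrable f g : L2 Omega f -> L2 Omega g -> integrable (fun x => f x * g x).
Proof.
move=> Lf Lg.
apply: (integrable_domin (measurable_funM (L2_measurable Lf) (L2_measurable Lg))
  (integrableD_real (L2_sqr_integrable Lf) (L2_sqr_integrable Lg))) => x _.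
rewrite normrM -(real_normK (num_real (f x))) -(real_normK (num_real (g x))).
have := sqr_ge0 (`|f x| - `|g x|); have := mulr_ge0 (normr_ge0 (f x)) (normr_ge0 (g x)); lra.
Qed.

Lemma L2_comb (a b : R) f g : L2 Omega f -> L2 Omega g -> L2 Omega (fun x => a * f x + b * g x).
Proof.
move=> Lf Lg; apply: sqr_integrable_L2.
  by apply: measurable_funD; apply: measurable_funM => //; case: Lf Lg => ? _ [].
apply: integrable_domin (integrableD_real
  (integrableZl_real (2 * a ^+ 2) (L2_sqr_integrable Lf))
  (integrableZl_real (2 * b ^+ 2) (L2_sqr_integrable Lg))) _.
  by apply: measurable_funX;
    apply: measurable_funD; apply: measurable_funM => //; case: Lf Lg => ? _ [].
move=> x _; rewrite ger0_norm ?sqr_ge0//.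
have := sqr_ge0 (a * f x - b * g x); nra.
Qed.

Lemma L2D f g : L2 Omega f -> L2 Omega g -> L2 Omega (f + g).
Proof.
move=> Lf Lg; have -> : f + g = (fun x => 1 * f x + 1 * g x) by apply/funext => x; rewrite !mul1r.
exact: L2_comb.
Qed.

Lemma L2B f g : L2 Omega f -> L2 Omega g -> L2 Omega (f - g).
Proof.
move=> Lf Lg; have -> : f - g = (fun x => 1 * f x + (-1) * g x).
  by apply/funext => x; rewrite mul1r mulN1r.
exact: L2_comb.
Qed.

Lemma L2_cst1 : L2 Omega (cst 1).
Proof.
split; first exact: measurable_cst.
under eq_integral => x _ do rewrite expr1n.
by rewrite integral_cst// mul1e.
Qed.

Lemma L2_integrable f : L2 Omega f -> integrable f.
Proof.
move=> Lf; have -> : f = (fun x => f x * cst 1 x) by apply/funext => x; rewrite mulr1.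
exact: L2M_integrable L2_cst1.
Qed.

Lemma test_L2 phi : test phi -> L2 Omega phi.
Proof.
move=> tphi; apply: sqr_integrable_L2.
  apply: measurable_funS (measurable_fun_continuous _) => //.
  exact/smooth_continuous/(test_smooth tphi).
exact: (test_integrable mOmega (testM tphi tphi)).
Qed.

Lemma L2_ae_eq s u g1 g2 : L2 Omega g1 -> L2 Omega g2 ->
  is_weak_partials Omega s u g1 -> is_weak_partials Omega s u g2 ->
  {ae area, forall x : plane, Omega x -> g1 x = g2 x}.
Proof.
move=> L1 L2' w1 w2.
have := fundamental_lemma oOmega (L2_integrable (L2B L1 L2')).
have h : forall phi, test phi -> I (fun x => (g1 - g2) x * phi x) = 0.
  move=> phi tphi.
  rewrite [LHS](_ : _ = I (fun x => g1 x * phi x - g2 x * phi x)).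
    have Lp := test_L2 tphi.
    rewrite (RintegralB mOmega (L2M_integrable L1 Lp) (L2M_integrable L2' Lp)).
    have := w1 _ tphi; rewrite (w2 _ tphi) => /(mulfI _) -> //; first by rewrite subrr.
    by rewrite expf_neq0// oppr_eq0 oner_neq0.
  by apply: eq_Rintegral => x _; rewrite -mulrBl.
move=> /(_ h); apply: filterS => x hx /hx /eqP.
by rewrite subr_eq0 => /eqP.
Qed.

Lemma partials_smooth_rcons s i phi : smooth phi ->
  partials (rcons s i) phi = partials (i :: s) phi.
Proof.
move=> sphi; elim: s => [//|j s IH] /=; rewrite [partials (rcons s i) phi]IH /=.
have C := partial_comm (smooth_partials s sphi).
case: (ord2_cases i) => ->; case: (ord2_cases j) => ->.
- reflexivity.
- exact: esym C.
- exact: C.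
- reflexivity.
Qed.

Lemma is_weak_partials_test s phi : test phi -> is_weak_partials Omega s phi (partials s phi).
Proof.
elim: s phi => [|i s IH] phi tphi psi tpsi; first by rewrite expr0 mul1r.
have tp t := test_partials t tphi; have tq t := test_partials t tpsi.
have ibp f g : test f -> test g ->
    I (fun x => f x * partial i g x) = - I (fun x => partial i f x * g x).
  move=> tf tg; have tfi := test_partials [:: i] tf; have tgi := test_partials [:: i] tg.
  apply/eqP; rewrite -addr_eq0; apply/eqP.
  rewrite -(RintegralD mOmega (test_integrable mOmega (testM tf tgi))
     (test_integrable mOmega (testM tfi tg))).
  rewrite -[RHS](integral_test_derive (basis_vec i) (testM tf tg)).
  apply: eq_Rintegral => x _.
  have h := partialM i (fun x => test_differentiable x tf) (fun x => test_differentiable x tg).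
  by rewrite -[RHS]/(partial i (f * g) x) h !fctE [X in _ + X]mulrC.
rewrite [LHS](ibp _ _ tphi (tq s)) (IH _ (tp [:: i]) _ tpsi) -partials_rcons.
by rewrite (partials_smooth_rcons _ _ (test_smooth tphi)) exprS mulN1r mulNr.
Qed.

Lemma weak_partialsP s u : (exists g, L2 Omega g /\ is_weak_partials Omega s u g) ->
  L2 Omega (weak_partials Omega s u) /\ is_weak_partials Omega s u (weak_partials Omega s u).
Proof. by move=> h; exact: (xgetPex (fun=> 0) h). Qed.

Lemma weak_partials_nil u : L2 Omega u ->
  {ae area, forall x : plane, Omega x -> weak_partials Omega [::] u x = u x}.
Proof.
move=> Lu; have wu : is_weak_partials Omega [::] u u by move=> phi _; rewrite expr0 mul1r.
have [Lw ww] := @weak_partialsP [::] u (ex_intro _ u (conj Lu wu)).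
exact: L2_ae_eq ww wu.
Qed.

Lemma weak_partials_test s phi : test phi ->
  {ae area, forall x : plane, Omega x -> weak_partials Omega s phi x = partials s phi x}.
Proof.
move=> tphi; have Lp := test_L2 (test_partials s tphi).
have wp := is_weak_partials_test s tphi.
have [Lw ww] := @weak_partialsP s phi (ex_intro _ _ (conj Lp wp)).
exact: L2_ae_eq ww wp.
Qed.

Lemma Rintegral_sqr_ae f g : L2 Omega f -> L2 Omega g ->
  {ae area, forall x : plane, Omega x -> f x = g x} ->
  I (fun x => f x ^+ 2) = I (fun x => g x ^+ 2).
Proof.
move=> Lf Lg fg; rewrite /Rintegral; congr fine; apply: ae_eq_integral => //.
- exact: measurable_int (L2_sqr_integrable Lf).
- exact: measurable_int (L2_sqr_integrable Lg).
- by apply: filterS fg => x h Ox; rewrite h.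
Qed.

Lemma test_H2 phi : test phi -> H2 Omega phi.
Proof.
move=> tphi; split; first exact: test_L2.
move=> s _; exists (partials s phi); split; last exact: is_weak_partials_test.
exact/test_L2/test_partials.
Qed.

Lemma H2_L2 s v : H2 Omega v -> (size s <= 2)%N -> L2 Omega (weak_partials Omega s v).
Proof. by move=> [_ h] /h /weak_partialsP[]. Qed.

Lemma test_H20 phi : test phi -> H20 Omega phi.
Proof.
move=> tphi; have Hphi := test_H2 tphi; split=> //.
exists (fun=> phi); split=> // s s2.
have Lw := H2_L2 Hphi s2; have Lp := test_L2 (test_partials s tphi).
rewrite (_ : (\int[area]_(x in _) _)%E = 0%E); first exact: cvg_cst.
have LB := L2_sqr_integrable (L2B Lp Lw).
rewrite -[RHS](integral0 area (Omega : set plane)); apply: ae_eq_integral => //.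
  exact: measurable_int LB.
by apply: filterS (weak_partials_test s tphi) => x h Ox; rewrite h// subrr expr0n.
Qed.

Lemma nonzero_on_sqr v : L2 Omega v -> nonzero_on Omega v -> 0 < I (fun x => v x ^+ 2).
Proof.
move=> Lv nz; rewrite lt0r; apply/andP; split; last first.
  by apply: Rintegral_ge0 => x _; exact: sqr_ge0.
apply/eqP => h; apply: nz.
have iv := L2_sqr_integrable Lv.
have := (ae_eq_integral_abs area mOmega (measurable_int _ iv)).1.
move=> /(_ _)/wrap[].
  under eq_integral => x _ do rewrite /= ger0_norm ?sqr_ge0//.
  by rewrite -[LHS]fineK; [rewrite -[fine _]/(Rintegral _ _ _) h|exact: integrable_fin_num iv].
by apply: filterS => x hx /hx /= [] /eqP; rewrite sqrf_eq0 => /eqP.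
Qed.

Lemma sqr_nonzero_on v : 0 < I (fun x => v x ^+ 2) -> L2 Omega v -> nonzero_on Omega v.
Proof.
move=> v0 Lv h; move: v0; have L0 : L2 Omega (cst 0).
  have -> : cst 0 = cst 1 - cst 1 :> (R * R -> R) by apply/funext => x; rewrite /= subrr.
  exact: L2B L2_cst1 L2_cst1.
rewrite (Rintegral_sqr_ae Lv L0 h); under eq_Rintegral => x _ do rewrite /= expr0n.
by rewrite Rintegral_cst// mul0r ltxx.
Qed.

End WeakDerivatives.

Section Closure.
Context {R : realType}.
Notation plane := (measurableTypeR R * measurableTypeR R)%type.
Variable Omega : set (R * R).
Hypothesis oOmega : open Omega.
Hypothesis areaOmega : (area (Omega : set plane) < +oo)%E.
Implicit Types (f g u v phi : R * R -> R).

Notation integrable f := (area.-integrable (Omega : set plane) (EFin \o f)).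
Notation test := (test_function Omega).
Notation I f := (\int[area]_(x in (Omega : set plane)) f x).

Let mOmega : measurable (Omega : set plane) := measurable_open_plane oOmega.

Lemma Rintegral_le_comb f g h (c d : R) : integrable f -> integrable g -> integrable h ->
  (forall x, Omega x -> f x <= c * g x + d * h x) -> I f <= c * I g + d * I h.
Proof.
move=> fi gi hi le; have gi' := integrableZl_real oOmega c gi.
have hi' := integrableZl_real oOmega d hi.
rewrite -(RintegralZl _ mOmega gi) -(RintegralZl _ mOmega hi) -(RintegralD mOmega gi' hi').
exact: (le_Rintegral mOmega fi (integrableD_real oOmega gi' hi')).
Qed.

Let sqr_close (f g e : R) : 0 < e ->
  f ^+ 2 <= (1 + e) * g ^+ 2 + (1 + e^-1) * (f - g) ^+ 2.
Proof.
move=> e0; have ei : e * e^-1 = 1 by rewrite divff// gt_eqF.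
have := mulr_ge0 (ltW e0) (sqr_ge0 (g - e^-1 * (f - g))).
have -> : e * (g - e^-1 * (f - g)) ^+ 2 =
  e * g ^+ 2 - 2 * (e * e^-1) * g * (f - g) + (e * e^-1) * e^-1 * (f - g) ^+ 2 by ring.
rewrite ei; nra.
Qed.

Lemma Rintegral_sqr_close f g (e : R) : 0 < e -> L2 Omega f -> L2 Omega g ->
  I (fun x => f x ^+ 2) <= (1 + e) * I (fun x => g x ^+ 2) +
    (1 + e^-1) * I (fun x => (f x - g x) ^+ 2).
Proof.
move=> e0 Lf Lg; have ig := L2_sqr_integrable Lg.
have ifg := L2_sqr_integrable (L2B oOmega Lf Lg).
apply: (Rintegral_le_comb (L2_sqr_integrable Lf) ig ifg) => x _.
exact: sqr_close.
Qed.

Let close_num (A B d e : R) : 0 < e -> e <= 1 -> 0 <= A -> 0 <= B -> 0 <= d ->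
  A <= (1 + e) * B + (1 + e^-1) * d -> B <= (1 + e) * A + (1 + e^-1) * d ->
  `|B - A| <= e * (2 * B) + 2 * (1 + e^-1) * d.
Proof.
move=> e0 e1 A0 B0 d0 h1 h2.
have i0 : 0 < e^-1 by rewrite invr_gt0.
have ei : e * e^-1 = 1 by rewrite divff// gt_eqF.
have k0 : 0 <= (1 + e^-1) * d by rewrite mulr_ge0// addr_ge0// ltW.
have k1 : e * ((1 + e^-1) * d) <= (1 + e^-1) * d by rewrite ler_piMl.
have k2 : e * (e * B) <= e * B by rewrite ler_piMl// mulr_ge0// ltW.
have k3 : 0 <= e * B by rewrite mulr_ge0// ltW.
have h3 := ler_wpM2l (ltW e0) h1.
by rewrite ler_norml; apply/andP; split; nra.
Qed.

Lemma Rintegral_sqr_cvg (f_ : nat -> R * R -> R) f : (forall n, L2 Omega (f_ n)) ->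
  L2 Omega f -> (fun n => I (fun x => (f_ n x - f x) ^+ 2)) @ \oo --> (0 : R) ->
  (fun n => I (fun x => f_ n x ^+ 2)) @ \oo --> I (fun x => f x ^+ 2).
Proof.
move=> Lf_ Lf d0; apply/cvgrPdist_le => e e0.
set B := I (fun x => f x ^+ 2).
have B0 : 0 <= B by apply: Rintegral_ge0 => x _; exact: sqr_ge0.
pose k := Num.min 1 (e / (4 * (B + 1))).
have k0 : 0 < k by rewrite lt_min ltr01 divr_gt0// mulr_gt0// ltr_wpDl.
have k1 : k <= 1 by rewrite ge_min lexx.
have kB : k * (2 * B) <= e / 2.
  have h : k <= e / (4 * (B + 1)) by rewrite ge_min lexx orbT.
  apply: le_trans (ler_wpM2r _ h) _; first by rewrite mulr_ge0.
  rewrite mulrAC ler_pdivrMr; last by rewrite mulr_gt0// ltr_wpDl.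
  have eB : 0 <= e * B by rewrite mulr_ge0// ltW.
  rewrite -subr_ge0 [X in 0 <= X](_ : _ = 2 * e); last by field.
  by rewrite mulr_ge0// ltW.
have c0 : 0 < 4 * (1 + k^-1) by rewrite mulr_gt0// addr_gt0// invr_gt0.
move/cvgr0Pnorm_le: d0 => /(_ _ (divr_gt0 e0 c0)); apply: filterS => n dn.
have D0 : 0 <= I (fun x => (f_ n x - f x) ^+ 2) by apply: Rintegral_ge0 => x _; exact: sqr_ge0.
have A0 : 0 <= I (fun x => f_ n x ^+ 2) by apply: Rintegral_ge0 => x _; exact: sqr_ge0.
have h1 := Rintegral_sqr_close k0 (Lf_ n) Lf.
have h2 := Rintegral_sqr_close k0 Lf (Lf_ n).
have E : I (fun x => (f x - f_ n x) ^+ 2) = I (fun x => (f_ n x - f x) ^+ 2).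
  by apply: eq_Rintegral => x _; rewrite -sqrrN opprB.
rewrite E in h2; apply: le_trans (close_num k0 k1 A0 B0 D0 h1 h2) _.
rewrite (ger0_norm D0) ler_pdivlMr// in dn.
move: (I (fun x => (f_ n x - f x) ^+ 2)) dn => d; clear -kB; nra.
Qed.

Lemma L2_cvgD (f_ g_ : nat -> R * R -> R) f g :
  (forall n, L2 Omega (f_ n)) -> (forall n, L2 Omega (g_ n)) -> L2 Omega f -> L2 Omega g ->
  (fun n => I (fun x => (f_ n x - f x) ^+ 2)) @ \oo --> (0 : R) ->
  (fun n => I (fun x => (g_ n x - g x) ^+ 2)) @ \oo --> (0 : R) ->
  (fun n => I (fun x => ((f_ n + g_ n) x - (f + g) x) ^+ 2)) @ \oo --> (0 : R).
Proof.
move=> Lf_ Lg_ Lf Lg df dg.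
have u0 : (fun n => 2 * I (fun x => (f_ n x - f x) ^+ 2) +
     2 * I (fun x => (g_ n x - g x) ^+ 2)) @ \oo --> (0 : R).
  rewrite -[X in _ --> X]addr0 -[X in _ --> X + _](mulr0 2) -[X in _ --> _ + X](mulr0 2).
  by apply: cvgD; apply: cvgM; [exact: cvg_cst|exact: df|exact: cvg_cst|exact: dg].
apply: (squeeze_cvgr _ (cvg_cst 0) u0); apply: nearW => n; apply/andP; split.
  by apply: Rintegral_ge0 => x _; exact: sqr_ge0.
have i0 := L2_sqr_integrable (L2B oOmega (Lf_ n) Lf).
have i1 := L2_sqr_integrable (L2B oOmega (Lg_ n) Lg).
have i := L2_sqr_integrable (L2B oOmega (L2D oOmega (Lf_ n) (Lg_ n)) (L2D oOmega Lf Lg)).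
apply: (Rintegral_le_comb i i0 i1) => x _; rewrite !fctE.
move: (f_ n x) (g_ n x) (f x) (g x) => p q p' q'.
by have := sqr_ge0 ((p - p') - (q - q')); nra.
Qed.

Lemma H20_cvg v : H20 Omega v -> exists phi : nat -> R * R -> R,
  [/\ forall n, test (phi n),
   (fun n => I (fun x => phi n x ^+ 2)) @ \oo --> I (fun x => v x ^+ 2),
   (fun n => I (fun x => partial 0 (phi n) x ^+ 2) +
      I (fun x => partial 1 (phi n) x ^+ 2)) @ \oo --> I (sqr_norm_grad Omega v) &
   (fun n => I (fun x => (partial 0 (partial 0 (phi n)) x +
      partial 1 (partial 1 (phi n)) x) ^+ 2)) @ \oo --> I (fun x => laplacian Omega v x ^+ 2)].
Proof.
move=> [H [phi [tphi cphi]]]; exists phi.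
have Lw s : (size s <= 2)%N -> L2 Omega (weak_partials Omega s v) by exact: H2_L2.
have Lp s n : L2 Omega (partials s (phi n)) by exact/test_L2/test_partials.
have d0 s : (size s <= 2)%N ->
    (fun n => I (fun x => (partials s (phi n) x - weak_partials Omega s v x) ^+ 2)) @ \oo --> (0 : R).
  by move=> s2; exact: (fine_cvg (cphi s s2)).
split=> //.
- have [Lv _] := H.
  rewrite -(Rintegral_sqr_ae oOmega (Lw [::] isT) Lv (weak_partials_nil oOmega areaOmega Lv)).
  exact: (Rintegral_sqr_cvg (Lp [::]) (Lw [::] isT) (d0 [::] isT)).
- have -> : I (sqr_norm_grad Omega v) =
      I (fun x => weak_partials Omega [:: 0] v x ^+ 2) +
      I (fun x => weak_partials Omega [:: 1] v x ^+ 2).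
    rewrite -(RintegralD mOmega (L2_sqr_integrable (Lw [:: 0] isT))
      (L2_sqr_integrable (Lw [:: 1] isT))).
    by apply: eq_Rintegral => x _; rewrite /sqr_norm_grad sum_ord2.
  apply: cvgD.
    exact: (Rintegral_sqr_cvg (Lp [:: 0]) (Lw [:: 0] isT) (d0 [:: 0] isT)).
  exact: (Rintegral_sqr_cvg (Lp [:: 1]) (Lw [:: 1] isT) (d0 [:: 1] isT)).
- have w0 := Lw [:: 0; 0] isT; have w1 := Lw [:: 1; 1] isT.
  have p0 := Lp [:: 0; 0]; have p1 := Lp [:: 1; 1].
  have -> : I (fun x => laplacian Omega v x ^+ 2) =
      I (fun x => (weak_partials Omega [:: 0; 0] v + weak_partials Omega [:: 1; 1] v) x ^+ 2).
    by apply: eq_Rintegral => x _; rewrite /laplacian sum_ord2.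
  apply: (Rintegral_sqr_cvg (fun n => L2D oOmega (p0 n) (p1 n)) (L2D oOmega w0 w1)).
  exact: (L2_cvgD p0 p1 w0 w1 (d0 [:: 0; 0] isT) (d0 [:: 1; 1] isT)).
Qed.

End Closure.

(** * Areas *)

Section Areas.
Context {R : realType}.
Notation plane := (measurableTypeR R * measurableTypeR R)%type.
Notation mu := (@lebesgue_measure R).
Implicit Types (a b c p : R * R) (E : set plane).

Lemma areaE E : area E = (\int[mu]_x mu (xsection E x))%E.
Proof. by []. Qed.

Lemma measurable_poly (p : {poly R}) (D : set (measurableTypeR R)) : measurable D ->
  measurable_fun D (fun x => (p.[x])%:E).
Proof.
move=> mD; apply/measurable_EFinP; apply: measurable_funS (measurableT) _ _ => //.
by apply: continuous_measurable_fun => x; exact: continuous_horner.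
Qed.

Lemma integral_deriv_poly (p : {poly R}) (x y : R) : x <= y ->
  (\int[mu]_(t in `[x, y]) (p^`().[t])%:E = (p.[y] - p.[x])%:E)%E.
Proof.
rewrite le_eqVlt => /orP[/eqP ->|xy].
  by rewrite set_itv1 integral_set1 subrr.
rewrite (@continuous_FTC2 _ _ (horner p))//.
- by apply: continuous_subspaceT => t; exact: continuous_horner.
- split=> [t _||]; first exact: derivable_horner.
  + by apply: cvg_at_right_filter; exact: continuous_horner.
  + by apply: cvg_at_left_filter; exact: continuous_horner.
- by move=> t _; rewrite derive1E; have [_ ->] := is_derive_poly p t.
Qed.

Lemma area_le_poly E (p : {poly R}) (x y : R) : measurable E -> x <= y ->
  (forall t, t \notin `[x, y] -> xsection E t = set0) ->
  (forall t, t \in `[x, y] -> (mu (xsection E t) <= (p^`().[t])%:E)%E) ->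
  (area E <= (p.[y] - p.[x])%:E)%E.
Proof.
move=> mE xy out le; rewrite areaE -integral_deriv_poly// [leRHS]integral_mkcond.
apply: ge0_le_integral => //.
- exact: measurable_fun_xsection.
- by apply/(measurable_restrictT _ _).1 => //; exact: measurable_poly.
- move=> t _; rewrite patchE; case: ifPn => [|/negP h].
    by rewrite inE; exact: le.
  by rewrite out ?measure0//; apply/negP => h'; apply: h; rewrite inE.
Qed.

Lemma area_ge_poly E (p : {poly R}) (x y : R) : measurable E -> x <= y ->
  (forall t, t \in `]x, y[ -> 0 <= p^`().[t] /\
     ((p^`().[t])%:E <= mu (xsection E t))%E) ->
  ((p.[y] - p.[x])%:E <= \int[mu]_(t in `]x, y[) mu (xsection E t))%E.
Proof.
move=> mE xy le; rewrite -integral_deriv_poly//.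
rewrite -integral_itv_bndo_bndc; last exact: measurable_poly.
rewrite -integral_itv_obnd_cbnd; last exact: measurable_poly.
apply: ge0_le_integral => //.
- by move=> t /le[].
- exact: measurable_poly.
- by apply: measurable_funS (measurable_fun_xsection _ mE).
- by move=> t /le[].
Qed.

Lemma open_open_disk c (r : R) : open (open_disk c r).
Proof.
pose q : R * R -> R := affine 1 0 (- c.1) * affine 1 0 (- c.1) + affine 0 1 (- c.2) * affine 0 1 (- c.2).
have -> : open_disk c r = q @^-1` [set x | x < r ^+ 2].
  by apply/seteqP; split=> x; rewrite /open_disk /q /affine /= !fctE => h; nra.
move: (@smooth_continuous _ q) => /(_ _)/wrap[].
  by apply: smoothD; apply: smoothM; exact: smooth_affine.
by move=> /continuousP; apply; exact: open_lt.
Qed.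

Let sqrt_le (z : R) : 0 <= z <= 1 ->
  0 <= 1 - z / 2 - z ^+ 2 / 8 - z ^+ 3 / 16 - 5 * z ^+ 4 / (8 * 16) /\
  1 - z <= (1 - z / 2 - z ^+ 2 / 8 - z ^+ 3 / 16 - 5 * z ^+ 4 / (8 * 16)) ^+ 2.
Proof.
move=> /andP[z0 z1]; have p n : 0 <= z ^+ n <= 1 by rewrite exprn_ge0//= exprn_ile1.
split; first by have := p 2%N; have := p 3%N; have := p 4%N; lra.
rewrite -subr_ge0.
have -> : (1 - z / 2 - z ^+ 2 / 8 - z ^+ 3 / 16 - 5 * z ^+ 4 / (8 * 16)) ^+ 2 - (1 - z) =
  z ^+ 5 * (7 / (8 * 16) + 7 / (8 * 8 * 8) * z + 5 / (8 * 8 * 16) * z ^+ 2 + 25 / (8 * 16 * (8 * 16)) * z ^+ 3) by field.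
apply: mulr_ge0; first exact: exprn_ge0.
have c k l : 0 <= k%:R / l%:R :> R by rewrite divr_ge0.
have d : 0 <= 8 * 16 :> R by rewrite mulr_ge0.
have e : 0 <= 8 * 8 :> R by rewrite mulr_ge0.
by rewrite !addr_ge0// ?mulr_ge0 ?exprn_ge0// invr_ge0// !mulr_ge0.
Qed.

Let disk_poly (r z : R) : {poly R} := let y := 'X - z%:P in
  (2 * r) *: y - (3 * r)^-1 *: y ^+ 3 - (20 * r ^+ 3)^-1 *: y ^+ 5 -
  (56 * r ^+ 5)^-1 *: y ^+ 7 - (5 / (9 * 64 * r ^+ 7)) *: y ^+ 9.

Let deriv_disk_poly (r z x : R) : 0 < r -> (disk_poly r z)^`().[x] =
  let s := ((x - z) / r) ^+ 2 in
  2 * r * (1 - s / 2 - s ^+ 2 / 8 - s ^+ 3 / 16 - 5 * s ^+ 4 / (8 * 16)).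
Proof.
move=> r0; have rn : r != 0 by rewrite gt_eqF.
rewrite /disk_poly /= !(derivB, derivZ, deriv_exp, derivX, derivC) subr0.
rewrite !(hornerE, hornerMn) /=; field.
exact: rn.
Qed.

(* An upper bound 3.18026 of pi: 4 times the integral over [0, 1] of the Taylor
   polynomial of order 4 of sqrt (1 - z) at z = x^2. *)
Definition disk_const : R := 4 * (1 - 1 / 6 - 1 / 40 - 1 / 112 - 5 / (9 * 128)).

Lemma area_disk_le c (r : R) : 0 < r ->
  (area (open_disk c r : set plane) <=
    (disk_const * r ^+ 2)%:E)%E.
Proof.
move=> r0; have rn : r != 0 by rewrite gt_eqF.
have mB := measurable_open_plane (@open_open_disk c r).
have -> : disk_const * r ^+ 2 =
    (disk_poly r c.1).[c.1 + r] - (disk_poly r c.1).[c.1 - r].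
  rewrite /disk_const /disk_poly !hornerE /=; field.
  exact: rn.
apply: area_le_poly => //; first by lra.
- move=> t; rewrite in_itv /= => /negP tB; apply/seteqP; split=> // y.
  rewrite /xsection /= inE /open_disk /= => h; apply: tB.
  have : (t - c.1) ^+ 2 < r ^+ 2 by apply: le_lt_trans h; rewrite lerDl sqr_ge0.
  rewrite -[X in X < _]real_normK ?num_real// ltr_pXn2r ?nnegrE ?(ltW r0)// ltr_norml.
  by move=> /andP[? ?]; apply/andP; split; lra.
- move=> t; rewrite in_itv /= => /andP[t1 t2].
  rewrite deriv_disk_poly//=; set s := (_ / r) ^+ 2; set q := (1 - s / 2 - _ - _ - _).
  have s01 : 0 <= s <= 1.
    apply/andP; split; first exact: sqr_ge0.
    rewrite /s expr_div_n ler_pdivrMr ?exprn_gt0// mul1r -subr_ge0.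
    rewrite (_ : _ - _ = (r - (t - c.1)) * (r + (t - c.1))); last by ring.
    by apply: mulr_ge0; lra.
  have [q0 qs] := sqrt_le s01; rewrite -/q in q0 qs.
  apply: (@le_trans _ _ (mu `]c.2 - r * q, c.2 + r * q[)).
    apply: le_measure; rewrite ?inE//; first exact: measurable_xsection.
    move=> y; rewrite /xsection /= inE /open_disk /= in_itv /= => h.
    have h2 : (y - c.2) ^+ 2 < (r * q) ^+ 2.
      rewrite exprMn; apply: lt_le_trans (ler_wpM2l (sqr_ge0 r) qs).
      have -> : r ^+ 2 * (1 - s) = r ^+ 2 - (t - c.1) ^+ 2 by rewrite /s; field.
      by rewrite ltrBrDl.
    have rq : 0 <= r * q by rewrite mulr_ge0// ltW.
    move: h2; rewrite -[X in X < _]real_normK ?num_real// ltr_pXn2r ?nnegrE// ltr_norml.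
    by move=> /andP[? ?]; apply/andP; split; lra.
  rewrite lebesgue_measure_itv /=; case: ifP => _; rewrite -?EFinD lee_fin.
    by rewrite le_eqVlt; apply/orP; left; apply/eqP; ring.
  by rewrite mulr_ge0// mulr_ge0// ltW.
Qed.

Lemma area_disk_lty c (r : R) : 0 < r -> (area (open_disk c r : set plane) < +oo)%E.
Proof. by move=> r0; apply: le_lt_trans (area_disk_le c r0) _; exact: ltry. Qed.

End Areas.

Section TriangleArea.
Context {R : realType}.
Notation plane := (measurableTypeR R * measurableTypeR R)%type.
Notation mu := (@lebesgue_measure R).
Implicit Types (a b c p : R * R) (E : set plane).

Lemma triangle_xsection a b c (x s t : R) : det3 a b c != 0 -> 0 < s < 1 -> 0 < t < 1 ->
  x = a.1 + s * (b.1 - a.1) -> x = a.1 + t * (c.1 - a.1) ->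
  (`|s * (b.2 - a.2) - t * (c.2 - a.2)|%:E <= mu (xsection (open_triangle a b c) x))%E.
Proof.
move=> d0 s01 t01 xb xc; set y1 := a.2 + s * (b.2 - a.2); set y2 := a.2 + t * (c.2 - a.2).
have inT h : 0 < h < 1 -> open_triangle a b c (x, h * y1 + (1 - h) * y2).
  move=> h01; exists (h * (1 - s) + (1 - h) * (1 - t)), (h * s), ((1 - h) * t).
  have [[s0 s1] [t0 t1] [h0 h1]] : [/\ 0 < s /\ s < 1, 0 < t /\ t < 1 & 0 < h /\ h < 1].
    by split; apply/andP.
  split; first by rewrite addr_gt0// mulr_gt0// subr_gt0.
  - exact: mulr_gt0.
  - by rewrite mulr_gt0// subr_gt0.
  - by ring.
  have E : x = h * x + (1 - h) * x by ring.
  rewrite E {1}xb xc /y1 /y2.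
  case: a b c {d0 xb xc y1 y2 E} => [a1 a2] [b1 b2] [c1 c2].
  by congr (_, _); rewrite /= /GRing.scale /=; ring.
have -> : s * (b.2 - a.2) - t * (c.2 - a.2) = y1 - y2 by rewrite /y1 /y2; ring.
have mT : measurable (xsection (open_triangle a b c) x : set (measurableTypeR R)).
  exact: measurable_xsection (measurable_open_plane (open_open_triangle d0)).
have sub u v : (forall y, u < y < v -> open_triangle a b c (x, y)) -> u <= v ->
    ((v - u)%:E <= mu (xsection (open_triangle a b c) x))%E.
  move=> uv le; apply: (@le_trans _ _ (mu `]u, v[)).
    by rewrite lebesgue_measure_itv /= lte_fin; case: ltP => // h; rewrite lee_fin subr_le0.
  apply: le_measure; rewrite ?inE// => y /=; rewrite in_itv /= => /uv.
  by rewrite /xsection /= inE.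
have [y12|y12] := leP y1 y2.
- rewrite distrC ger0_norm ?subr_ge0//; apply: sub => // y /andP[h1 h2].
  have y0 : 0 < y2 - y1 by lra.
  have -> : y = (y2 - y) / (y2 - y1) * y1 + (1 - (y2 - y) / (y2 - y1)) * y2.
    by field; rewrite gt_eqF.
  apply: inT; apply/andP; split; first by rewrite divr_gt0// subr_gt0.
  by rewrite ltr_pdivrMr//; lra.
- rewrite gtr0_norm ?subr_gt0//; apply: sub; last exact: ltW.
  move=> y /andP[h1 h2]; have y0 : 0 < y1 - y2 by lra.
  have -> : y = (y - y2) / (y1 - y2) * y1 + (1 - (y - y2) / (y1 - y2)) * y2.
    by field; rewrite gt_eqF.
  apply: inT; apply/andP; split; first by rewrite divr_gt0// subr_gt0.
  by rewrite ltr_pdivrMr//; lra.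
Qed.

Lemma open_triangle_swap a b c : open_triangle b a c = open_triangle a b c.
Proof.
apply/seteqP; split=> p [l [m [n [l0 m0 n0 s ->]]]]; exists m, l, n; split=> //.
- by rewrite -s; ring.
- by rewrite (addrC (l *: b)).
- by rewrite -s; ring.
- by rewrite (addrC (l *: a)).
Qed.

Lemma det3_swap a b c : det3 b a c = - det3 a b c.
Proof. by rewrite /det3; ring. Qed.

Lemma triangle_sorted a b c : exists a' b' c',
  [/\ open_triangle a' b' c' = open_triangle a b c, `|det3 a' b' c'| = `|det3 a b c|,
      a'.1 <= b'.1 & b'.1 <= c'.1].
Proof.
have [ab|/ltW ba] := leP a.1 b.1; have [bc|/ltW cb] := leP b.1 c.1;
  have [ac|/ltW ca] := leP a.1 c.1.
- by exists a, b, c.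
- by exists a, b, c.
- exists a, c, b; split; [|..|exact: ac|exact: cb].
    by rewrite -(open_triangle_rot a c b) open_triangle_swap open_triangle_rot.
  by rewrite -(det3_rot a c b) det3_swap normrN det3_rot.
- exists c, a, b; split; [|..|exact: ca|exact: ab].
    exact: esym (open_triangle_rot c a b).
  by rewrite (det3_rot c a b).
- exists b, a, c; split; [|..|exact: ba|exact: ac].
    exact: open_triangle_swap.
  by rewrite det3_swap normrN.
- exists b, c, a; split; [|..|exact: bc|exact: ca].
    exact: open_triangle_rot.
  by rewrite det3_rot.
- exists c, b, a; split; [|..|exact: cb|exact: ba].
    by rewrite open_triangle_swap open_triangle_rot.
  by rewrite det3_swap normrN det3_rot.
- exists c, b, a; split; [|..|exact: cb|exact: ba].
    by rewrite open_triangle_swap open_triangle_rot.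
  by rewrite det3_swap normrN det3_rot.
Qed.

Lemma area_triangle_ge a b c : det3 a b c != 0 ->
  ((`|det3 a b c| / 2)%:E <= area (open_triangle a b c : set plane))%E.
Proof.
rewrite -normr_gt0; have [a' [b' [c' [<- <- ab bc]]]] := triangle_sorted a b c => D.
have D0 : det3 a' b' c' != 0 by rewrite -normr_gt0.
move: a' b' c' D D0 ab bc => {a b c} a b c D D0 ab bc.
have mT := measurable_open_plane (open_open_triangle D0).
have ac : a.1 < c.1.
  rewrite lt_neqAle (le_trans ab bc) andbT; apply/eqP => E.
  by move: D0; rewrite /det3 (_ : b.1 = a.1) ?E ?subrr ?mul0r ?mulr0 ?subrr ?eqxx//; lra.
set d := `|det3 a b c| in D *.
pose p (k : R) z : {poly R} := (k / 2) *: ('X - z%:P) ^+ 2.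
have dp k z x : (p k z)^`().[x] = k * (x - z).
  by rewrite derivZ deriv_exp derivB derivX derivC subr0 !(hornerE, hornerMn) /=; field.
pose k1 := d / ((b.1 - a.1) * (c.1 - a.1)); pose k2 := - (d / ((c.1 - b.1) * (c.1 - a.1))).
have h1 : ((d * (b.1 - a.1) / (2 * (c.1 - a.1)))%:E <=
    \int[mu]_(t in `]a.1, b.1[) mu (xsection (open_triangle a b c) t))%E.
  have [E|nE] := eqVneq a.1 b.1.
    by rewrite E subrr mulr0 mul0r; apply: integral_ge0.
  have b0 : 0 < b.1 - a.1 by rewrite subr_gt0 lt_neqAle nE.
  have c0 : 0 < c.1 - a.1 by rewrite subr_gt0.
  have -> : d * (b.1 - a.1) / (2 * (c.1 - a.1)) = (p k1 a.1).[b.1] - (p k1 a.1).[a.1].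
    by rewrite /p /k1 !hornerE /=; field; rewrite !gt_eqF.
  apply: area_ge_poly => // x; rewrite in_itv /= => /andP[x1 x2]; rewrite dp.
  split; first by rewrite mulr_ge0 ?subr_ge0 ?(ltW x1)// divr_ge0 ?ltW// mulr_gt0.
  have xa : 0 < x - a.1 by rewrite subr_gt0.
  have -> : k1 * (x - a.1) = `|(x - a.1) / (b.1 - a.1) * (b.2 - a.2) - (x - a.1) / (c.1 - a.1) * (c.2 - a.2)|.
    rewrite [X in `|X|](_ : _ = - det3 a b c * ((x - a.1) / ((b.1 - a.1) * (c.1 - a.1)))); last first.
      by rewrite /det3; field; rewrite !gt_eqF.
    rewrite normrM normrN (@gtr0_norm _ (_ / _)) ?divr_gt0 ?mulr_gt0// /k1 -/d; ring.
  apply: triangle_xsection => //.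
  - by rewrite divr_gt0// ltr_pdivrMr//; lra.
  - by rewrite divr_gt0// ltr_pdivrMr//; lra.
  - by field; rewrite gt_eqF.
  - by field; rewrite gt_eqF.
have h2 : ((d * (c.1 - b.1) / (2 * (c.1 - a.1)))%:E <=
    \int[mu]_(t in `]b.1, c.1[) mu (xsection (open_triangle a b c) t))%E.
  have [E|nE] := eqVneq b.1 c.1.
    by rewrite E subrr mulr0 mul0r; apply: integral_ge0.
  have b0 : 0 < c.1 - b.1 by rewrite subr_gt0 lt_neqAle nE.
  have c0 : 0 < c.1 - a.1 by rewrite subr_gt0.
  have -> : d * (c.1 - b.1) / (2 * (c.1 - a.1)) = (p k2 c.1).[c.1] - (p k2 c.1).[b.1].
    by rewrite /p /k2 !hornerE /=; field; rewrite !gt_eqF.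
  apply: area_ge_poly => // x; rewrite in_itv /= => /andP[x1 x2]; rewrite dp.
  have xa : 0 < c.1 - x by rewrite subr_gt0.
  have -> : k2 * (x - c.1) = d / ((c.1 - b.1) * (c.1 - a.1)) * (c.1 - x) by rewrite /k2; ring.
  split; first by rewrite mulr_ge0 ?(ltW xa)// divr_ge0 ?ltW// mulr_gt0.
  have -> : d / ((c.1 - b.1) * (c.1 - a.1)) * (c.1 - x) =
     `|(c.1 - x) / (c.1 - a.1) * (a.2 - c.2) - (c.1 - x) / (c.1 - b.1) * (b.2 - c.2)|.
    rewrite [X in `|X|](_ : _ = det3 a b c * ((c.1 - x) / ((c.1 - b.1) * (c.1 - a.1)))); last first.
      by rewrite /det3; field; rewrite !gt_eqF.
    rewrite normrM (@gtr0_norm _ (_ / _)) ?divr_gt0 ?mulr_gt0// -/d; ring.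
  rewrite -(open_triangle_rot a b c) -(open_triangle_rot b c a).
  apply: triangle_xsection; first by rewrite -(det3_rot c a b) -(det3_rot a b c) det3_rot.
  - by rewrite divr_gt0// ltr_pdivrMr//; lra.
  - by rewrite divr_gt0// ltr_pdivrMr//; lra.
  - by field; rewrite gt_eqF.
  - by field; rewrite gt_eqF.
have -> : d / 2 = d * (b.1 - a.1) / (2 * (c.1 - a.1)) + d * (c.1 - b.1) / (2 * (c.1 - a.1)).
  by field; rewrite subr_eq0 gt_eqF.
have mf := measurable_fun_xsection (@lebesgue_measure R) mT.
rewrite EFinD; apply: le_trans (leeD h1 h2) _.
rewrite -ge0_integral_setU//=; first (apply: ge0_subset_integral => //). 
- by apply: measurableU; exact: measurable_itv.
- by apply: measurable_funS mf.
- apply/disj_setPS => x [/=]; rewrite !in_itv /= => /andP[_ h] /andP[h' _].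
  by have := lt_trans h h'; rewrite ltxx.
Qed.

End TriangleArea.

(** * The disk *)

Section BoundedConvergence.
Context {R : realType}.
Notation plane := (measurableTypeR R * measurableTypeR R)%type.
Variable Omega : set (R * R).
Hypothesis mOmega : measurable (Omega : set plane).
Hypothesis areaOmega : (area (Omega : set plane) < +oo)%E.
Implicit Types (f g : R * R -> R) (F G : nat -> R * R -> R).

Notation I f := (\int[area]_(x in (Omega : set plane)) f x).

Definition bounded_cvg F f :=
  (exists M, forall n x, Omega x -> `|F n x| <= M) /\
  (forall x, Omega x -> (fun n => F n x) @ \oo --> f x).

Lemma bounded_cvg_cst f : (exists M, forall x, Omega x -> `|f x| <= M) ->
  bounded_cvg (fun=> f) f.
Proof. by move=> [M fM]; split=> [|x _]; [exists M|exact: cvg_cst]. Qed.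

Lemma bounded_cvgD F f G g : bounded_cvg F f -> bounded_cvg G g ->
  bounded_cvg (fun n => F n + G n) (f + g).
Proof.
move=> [[M fM] cf] [[N gN] cg]; split=> [|x Ox]; last exact: cvgD (cf x Ox) (cg x Ox).
exists (M + N) => n x Ox; apply: le_trans (ler_normD _ _) _.
by apply: lerD; [exact: fM|exact: gN].
Qed.

Lemma bounded_cvgN F f : bounded_cvg F f -> bounded_cvg (fun n => - F n) (- f).
Proof.
move=> [[M fM] cf]; split=> [|x Ox]; last exact: cvgN (cf x Ox).
by exists M => n x Ox; rewrite normrN; exact: fM.
Qed.

Lemma bounded_cvgM F f G g : bounded_cvg F f -> bounded_cvg G g ->
  bounded_cvg (fun n => F n * G n) (f * g).
Proof.
move=> [[M fM] cf] [[N gN] cg]; split=> [|x Ox]; last exact: cvgM (cf x Ox) (cg x Ox).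
exists (M * N) => n x Ox; rewrite normrM.
by apply: ler_pM; [exact: normr_ge0|exact: normr_ge0|exact: fM|exact: gN].
Qed.

Lemma bounded_cvgX F f k : bounded_cvg F f ->
  bounded_cvg (fun n => F n ^+ k) (f ^+ k).
Proof.
move=> cf; elim: k => [|k IH].
  by apply: bounded_cvg_cst; exists 1 => x _; rewrite -[leLHS]/`|1 : R| normr1.
have -> : (fun n => F n ^+ k.+1) = (fun n => F n * F n ^+ k) by apply/funext => n; exact: exprS.
by rewrite exprS; exact: bounded_cvgM.
Qed.

Lemma bounded_integrable f : measurable_fun (Omega : set plane) f ->
  (exists M, forall x, Omega x -> `|f x| <= M) ->
  area.-integrable (Omega : set plane) (EFin \o f).
Proof.
move=> mf [M fM]; apply: measurable_bounded_integrable => //.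
by exists M; split=> [|N MN x Ox /=]; [exact: num_real|apply: le_trans (ltW MN); exact: fM].
Qed.

Lemma bounded_cvg_integrable F f : (forall n, measurable_fun (Omega : set plane) (F n)) ->
  bounded_cvg F f ->
  area.-integrable (Omega : set plane) (EFin \o f) /\ (fun n => I (F n)) @ \oo --> I f.
Proof.
move=> mF [[M fM] cf].
pose M' := Num.max M 0.
have ig : area.-integrable (Omega : set plane) (EFin \o cst M').
  by apply: bounded_integrable => //; exists `|M'|.
have h1 : {ae area, forall x : plane, Omega x -> (EFin \o F n) x @[n --> \oo] --> (EFin \o f) x}.
  by apply: aeW => x Ox; apply/cvg_EFin; [exact: nearW|exact: cf].
have h2 : {ae area, forall (x : plane) n, Omega x -> (`|(EFin \o F n) x| <= (EFin \o cst M') x)%E}.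
  by apply: aeW => x n Ox; rewrite /= lee_fin le_max fM.
have mEF n : measurable_fun (Omega : set plane) (EFin \o F n) by exact/measurable_EFinP.
have mEf : measurable_fun (Omega : set plane) (EFin \o f).
  by apply/measurable_EFinP; apply: (measurable_fun_cvg mF) => x Ox; exact: cf.
have [fi _ c] := dominated_convergence mOmega mEF mEf h1 ig h2; split=> //.
apply: fine_cvg; rewrite fineK; first exact: c.
exact: integrable_fin_num fi.
Qed.

End BoundedConvergence.

Section DiskTrial.
Context {R : realType}.
Notation plane := (measurableTypeR R * measurableTypeR R)%type.
Variables (c : R * R) (r : R).
Hypothesis r0 : 0 < r.
Implicit Types (d : R) (f g : R * R -> R) (k n : nat).

Let B := open_disk c r.
Notation I f := (\int[area]_(x in (B : set plane)) f x).

Let oB : open B := @open_open_disk _ c r.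
Let mB : measurable (B : set plane) := measurable_open_plane oB.
Let aB : (area (B : set plane) < +oo)%E := area_disk_lty c r0.

Let e := @basis_vec R.
Let X (i : 'I_2) : R * R -> R :=
  affine (e i).1 (e i).2 (- ((e i).1 * c.1 + (e i).2 * c.2)).
Let q : R * R -> R := cst 1 - cst (r ^+ 2)^-1 * (X 0 * X 0 + X 1 * X 1).
Let dq i : R * R -> R := cst (- 2 * (r ^+ 2)^-1) * X i.

Let X0E x : X 0 x = x.1 - c.1.
Proof. by rewrite /X /affine /e /basis_vec /=; ring. Qed.

Let X1E x : X 1 x = x.2 - c.2.
Proof. by rewrite /X /affine /e /basis_vec /=; ring. Qed.

Let has_derive_X i x : has_derive (e i) (X i) x 1.
Proof.
apply: has_derive_eq (has_derive_affine _ _ _ _ _) _.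
by case: (ord2_cases i) => ->; rewrite /e /basis_vec /=; ring.
Qed.

Let has_derive_q i x : has_derive (e i) q x (dq i x).
Proof.
have h0 := has_derive_affine (e 0).1 (e 0).2 (- ((e 0).1 * c.1 + (e 0).2 * c.2)) (e i) x.
have h1 := has_derive_affine (e 1).1 (e 1).2 (- ((e 1).1 * c.1 + (e 1).2 * c.2)) (e i) x.
rewrite /q; eapply has_derive_eq; first by der.
rewrite /dq !fctE; case: (ord2_cases i) => ->; rewrite /X /e /basis_vec /affine /=; ring.
Qed.

Let has_derive_dq i x : has_derive (e i) (dq i) x (- 2 * (r ^+ 2)^-1).
Proof.
have h := has_derive_X i x; rewrite /dq; eapply has_derive_eq; first by der.
by rewrite !fctE; ring.
Qed.

Let smooth_X i : smooth (X i).
Proof. exact: smooth_affine. Qed.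

Let smooth_q : smooth q.
Proof.
have -> : q = cst 1 + cst (- (r ^+ 2)^-1) * (X 0 * X 0 + X 1 * X 1).
  by apply/funext => x; rewrite /q !fctE mulNr.
apply: smoothD; first exact: smooth_cst.
by apply: smoothM; [exact: smooth_cst|apply: smoothD; apply: smoothM; exact: smooth_X].
Qed.

Let Y d : R * R -> R := q - cst d.
Let E d k : R * R -> R := cutoff d k \o Y d.

Let smooth_Y d : smooth (Y d).
Proof.
have -> : Y d = q + cst (- d) by apply/funext => x.
by apply: smoothD; [exact: smooth_q|exact: smooth_cst].
Qed.

Let has_derive_Y d i x : has_derive (e i) (Y d) x (dq i x).
Proof.
have h := has_derive_q i x; rewrite /Y; eapply has_derive_eq; first by der.
by rewrite oppr0 addr0.
Qed.

Let has_derive_E d k i x : 0 < d ->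
  has_derive (e i) (E d k) x ((d * E d k.+2 x - k%:R * E d k.+1 x) * dq i x).
Proof.
move=> d0; have dY y : differentiable (Y d) y by exact: smooth_differentiable.
split; first exact/diff_derivable/differentiable_cutoff.
rewrite -[LHS]/(partial i (cutoff d k \o Y d) x) partial_cutoff//.
by have [_ <-] := has_derive_Y d i x; rewrite !fctE mulNr.
Qed.

Let YE d k x : Y d x * E d k.+1 x = E d k x.
Proof.
rewrite /E /= /cutoff; case: ifPn => [y0|_]; last by rewrite mulr0.
by rewrite exprS !mulrA mulfV ?gt_eqF// mul1r.
Qed.

Let qE x : q x = 1 - ((x.1 - c.1) ^+ 2 + (x.2 - c.2) ^+ 2) / r ^+ 2.
Proof. by rewrite /q !fctE X0E X1E; ring. Qed.

Let q_le1 x : q x <= 1.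
Proof. by rewrite qE gerBl divr_ge0// ?addr_ge0// sqr_ge0. Qed.

Let BE x : B x <-> 0 < q x.
Proof.
rewrite qE subr_gt0 ltr_pdivrMr ?exprn_gt0// mul1r.
by split.
Qed.

Let X_le x i : 0 <= q x -> `|X i x| <= r.
Proof.
rewrite qE subr_ge0 ler_pdivrMr ?exprn_gt0// mul1r => h.
have : X i x ^+ 2 <= r ^+ 2.
  apply: le_trans h; case: (ord2_cases i) => ->; rewrite ?X0E ?X1E.
    by rewrite lerDl sqr_ge0.
  by rewrite lerDr sqr_ge0.
by rewrite -[X in X <= _]real_normK ?num_real// ler_pXn2r ?nnegrE ?(ltW r0).
Qed.

Let disk_test d f : 0 < d -> smooth f -> test_function B (f * E d 0).
Proof.
move=> d0 sf; pose K := [set x | d <= q x].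
have clK : closed K.
  have /continuousP cq := smooth_continuous smooth_q.
  have -> : K = ~` (q @^-1` [set t | t < d]).
    by apply/seteqP; split=> x; rewrite /K /= leNgt => /negP.
  by apply: open_closedC; apply: cq; exact: open_lt.
apply: (@test_functionI _ _ K) => [||x|x].
- by apply: smoothM => //; apply: smooth_cutoff.
- apply: (subclosed_compact clK (B := closed_box (c.1 - r) (c.1 + r) (c.2 - r) (c.2 + r))).
    by apply: compact_setX; exact: segment_compact.
  move=> x /(le_trans (ltW d0)) q0; have := X_le 0 q0; have := X_le 1 q0.
  rewrite X0E X1E !ler_norml => /andP[? ?] /andP[? ?].
  by split; rewrite /= in_itv /=; apply/andP; split; lra.
- by move=> /(lt_le_trans d0) /BE.
- move=> /negP; rewrite -ltNge => qd; rewrite !fctE /E /= cutoff_le0 ?mulr0//.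
  by rewrite /Y !fctE subr_le0 ltW.
Qed.

Let d_ n : R := n.+1%:R^-1.

Let d_gt0 n : 0 < d_ n. Proof. by rewrite invr_gt0. Qed.

Let d_le1 n : d_ n <= 1. Proof. by rewrite invf_le1// ler1n. Qed.

Let cvg_d : d_ @ \oo --> (0 : R).
Proof. exact: cvg_harmonic. Qed.

Notation bcvg F f := (bounded_cvg B F f).

Let bcvg_d : bcvg (fun n => cst (d_ n)) (cst 0).
Proof.
split=> [|x _]; last exact: cvg_d.
by exists 1 => n x _; rewrite ger0_norm ?d_le1// ltW// d_gt0.
Qed.

Let bcvg_cst a : bcvg (fun=> cst a) (cst a).
Proof. by apply: bounded_cvg_cst; exists `|a|. Qed.

Let bcvg_X i : bcvg (fun=> X i) (X i).
Proof. by apply: bounded_cvg_cst; exists r => x /BE/ltW; exact: X_le. Qed.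

Let bcvg_Y : bcvg (fun n => Y (d_ n)) q.
Proof.
rewrite -[q]subr0 /Y; apply: bounded_cvgD; last exact: bounded_cvgN bcvg_d.
by apply: bounded_cvg_cst; exists 1 => x /BE q0; rewrite ger0_norm ?q_le1// ltW.
Qed.

Let bcvg_E k : bcvg (fun n => cst (d_ n) ^+ k * E (d_ n) k) (cst (0 ^+ k)).
Proof.
split=> [|x /BE q0].
  exists k`!%:R => n x _; rewrite !fctE normrM (ger0_norm (exprn_ge0 _ (ltW (d_gt0 n)))).
  by rewrite mulrC -ler_pdivlMr ?exprn_gt0 ?d_gt0//; apply: cutoff_le; exact: d_gt0.
have cY : (fun n => Y (d_ n) x) @ \oo --> q x by case: bcvg_Y => _ /(_ x); apply; exact/BE.
have cz : (fun n => d_ n / Y (d_ n) x) @ \oo --> (0 : R).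
  rewrite -(mul0r (q x)^-1); apply: cvgM; first exact: cvg_d.
  by apply: cvgV => //; rewrite gt_eqF.
have ce : (fun n => expR (- (d_ n / Y (d_ n) x))) @ \oo --> (1 : R).
  rewrite -[X in _ --> X]expR0 -[X in _ --> expR X]oppr0.
  by apply: continuous_cvg; [exact: continuous_expR|exact: cvgN].
have : (fun n => (d_ n / Y (d_ n) x) ^+ k * expR (- (d_ n / Y (d_ n) x))) @ \oo --> (0 : R) ^+ k.
  rewrite -[X in _ --> X]mulr1; apply: cvgM ce.
  exact: (cvg_comp _ _ cz (@exprn_continuous R k 0)).
move=> H; 
have E0 : \forall n \near \oo, (d_ n / Y (d_ n) x) ^+ k * expR (- (d_ n / Y (d_ n) x)) =
    (cst (d_ n) ^+ k * E (d_ n) k) x.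
  have /cvgr_gt /(_ 0 q0) := cY; apply: filterS => n yn.
  by rewrite !fctE /E /= /cutoff yn exprMn mulrA.
apply: cvg_trans H; exact: near_eq_cvg.
Qed.

Let mtest f : test_function B f -> measurable_fun (B : set plane) f.
Proof.
move=> tf; apply: measurable_funS (measurable_fun_continuous _) => //.
exact/smooth_continuous/(test_smooth tf).
Qed.

Let smooth_YX d k : smooth (Y d ^+ k).
Proof.
elim: k => [|k IH]; first by rewrite expr0; exact: (smooth_cst 1).
by rewrite exprS; apply: smoothM => //; exact: smooth_Y.
Qed.

Let psi i k d : R * R -> R := (X i * Y d ^+ k.+1) * E d 0.

Let dpsi i k d : R * R -> R := Y d ^+ k.+1 * (cst d ^+ 0 * E d 0) + X i * dq i *
  (cst k.+1%:R * Y d ^+ k * (cst d ^+ 0 * E d 0) + Y d ^+ k * (cst d ^+ 1 * E d 1)).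

Let has_derive_psi i k d x : 0 < d -> has_derive (e i) (psi i k d) x (dpsi i k d x).
Proof.
move=> d0; have hE := has_derive_E 0 i x d0; have hX := has_derive_X i x.
have hY := has_deriveX k (has_derive_Y d i x).
rewrite /psi; eapply has_derive_eq; first by der.
rewrite /dpsi !fctE -(YE d 0 x) -(YE d 1 x) !exprS; ring.
Qed.

Let integral_dpsi i k d : 0 < d -> test_function B (dpsi i k d) /\ I (dpsi i k d) = 0.
Proof.
move=> d0; have tp : test_function B (psi i k d).
  by apply: disk_test => //; apply: smoothM; [exact: smooth_X|exact: smooth_YX].
have -> : dpsi i k d = dird (e i) (psi i k d).
  by apply/funext => x; have [_ <-] := has_derive_psi i k x d0.
by split; [exact: test_dird|exact: integral_test_derive].
Qed.

Let bcvg_dq i : bcvg (fun=> dq i) (dq i).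
Proof. by apply: bounded_cvgM; [exact: bcvg_cst|exact: bcvg_X]. Qed.

Let integral_dpsi_lim i k :
  area.-integrable (B : set plane)
    (EFin \o (fun x => q x ^+ k.+1 + X i x * dq i x * (k.+1%:R * q x ^+ k))) /\
  I (fun x => q x ^+ k.+1 + X i x * dq i x * (k.+1%:R * q x ^+ k)) = 0.
Proof.
have cF : bcvg (fun n => dpsi i k (d_ n)) (q ^+ k.+1 * cst (0 ^+ 0) + X i * dq i *
    (cst k.+1%:R * q ^+ k * cst (0 ^+ 0) + q ^+ k * cst (0 ^+ 1))).
  have h0 := bcvg_E 0; have h1 := bcvg_E 1; have hY := bcvg_Y.
  have hX := bcvg_X i; have hdq := bcvg_dq i; have hc := bcvg_cst k.+1%:R.
  have hk := bounded_cvgX k hY; have hk1 := bounded_cvgX k.+1 hY.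
  apply: bounded_cvgD; first exact: bounded_cvgM.
  apply: bounded_cvgM; first exact: bounded_cvgM.
  by apply: bounded_cvgD; [apply: bounded_cvgM => //; exact: bounded_cvgM|exact: bounded_cvgM].
have td n := integral_dpsi i k (d_gt0 n).
have [fi cI] := bounded_cvg_integrable mB aB (fun n => mtest (td n).1) cF.
have eqf : (q ^+ k.+1 * cst (0 ^+ 0) + X i * dq i *
    (cst k.+1%:R * q ^+ k * cst (0 ^+ 0) + q ^+ k * cst (0 ^+ 1))) =
    (fun x => q x ^+ k.+1 + X i x * dq i x * (k.+1%:R * q x ^+ k)).
  by apply/funext => x; rewrite !fctE expr0 expr1; ring.
rewrite eqf in fi cI; split=> //.
have cI0 : (fun n => I (dpsi i k (d_ n))) @ \oo --> (0 : R).
  by under eq_fun => n do rewrite (td n).2; exact: cvg_cst.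
exact: cvg_unique cI cI0.
Qed.

Let bounded_poly (p : {poly R}) : exists M, forall x, B x -> `|p.[q x]| <= M.
Proof.
exists (\sum_(i < size p) `|p`_i|) => x /BE q0; rewrite horner_coef.
apply: le_trans (ler_norm_sum _ _ _) _; apply: ler_sum => i _.
by rewrite normrM ler_piMr// normrX exprn_ile1// ger0_norm ?q_le1// ltW.
Qed.

Let integrable_poly (p : {poly R}) :
  area.-integrable (B : set plane) (EFin \o (fun x => p.[q x])).
Proof.
apply: (bounded_integrable mB aB _ (bounded_poly p)).
apply: measurable_funS (measurable_fun_continuous _) => // x.
apply: continuous_comp; first exact: smooth_continuous.
exact: continuous_horner.
Qed.

Let M (p : {poly R}) := I (fun x => p.[q x]).

Let MD p1 p2 : M (p1 + p2) = M p1 + M p2.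
Proof.
rewrite /M -(RintegralD mB (integrable_poly p1) (integrable_poly p2)).
by apply: eq_Rintegral => x _; rewrite hornerD.
Qed.

Let MZ a p : M (a *: p) = a * M p.
Proof.
rewrite /M -(RintegralZl _ mB (integrable_poly p)).
by apply: eq_Rintegral => x _; rewrite hornerZ.
Qed.

(* In the limit, the integral of the divergence of (x - c) q^(k + 1) vanishes,
   whence (k + 2) M 'X^(k + 1) = (k + 1) M 'X^k. *)
Let MXn k : M 'X^k = fine (area (B : set plane)) / k.+1%:R.
Proof.
elim: k => [|k IH].
  rewrite divr1 -[RHS]mul1r -Rintegral_cst//.
  by apply: eq_Rintegral => x _; rewrite expr0 hornerC.
have [i0 e0] := integral_dpsi_lim 0 k; have [i1 e1] := integral_dpsi_lim 1 k.
have h : M ((2 * k.+2%:R) *: 'X^(k.+1) + (- 2 * k.+1%:R) *: 'X^k) = 0.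
  have e01 := RintegralD mB i0 i1; rewrite e0 e1 addr0 in e01; apply: etrans e01.
  apply: eq_Rintegral => x _; rewrite hornerD !hornerZ !hornerXn.
  have -> : X 0 x * dq 0 x = - 2 * (r ^+ 2)^-1 * X 0 x ^+ 2 by rewrite /dq !fctE; ring.
  have -> : X 1 x * dq 1 x = - 2 * (r ^+ 2)^-1 * X 1 x ^+ 2 by rewrite /dq !fctE; ring.
  have Q : (r ^+ 2)^-1 * (X 0 x ^+ 2 + X 1 x ^+ 2) = 1 - q x by rewrite /q !fctE; ring.
  transitivity (2 * q x ^+ k.+1 - 2 * ((r ^+ 2)^-1 * (X 0 x ^+ 2 + X 1 x ^+ 2)) * (k.+1%:R * q x ^+ k)); last by ring.
  by rewrite Q exprS -!natr1; ring.
rewrite MD !MZ IH in h.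
have k2 : 2 * k.+2%:R != 0 :> R by rewrite mulf_neq0// pnatr_eq0.
apply: (mulfI k2); move/eqP: h; rewrite addr_eq0 => /eqP ->.
have a0 : k.+1%:R != 0 :> R by rewrite pnatr_eq0.
have b0 : k.+2%:R != 0 :> R by rewrite pnatr_eq0.
move: a0 b0; move: (k.+1%:R : R) (k.+2%:R : R) => a b a0 b0.
by field; rewrite a0 b0.
Qed.

(* The factor exp (- d / Y) gives the trial function compact support; T1 and T2
   are its first two derivatives with respect to Y. *)
Let T0 d : R * R -> R := (cst 5 * Y d ^+ 2 - Y d ^+ 3) * E d 0.
Let T1 d : R * R -> R :=
  (cst 10 * Y d - cst 3 * Y d ^+ 2 + cst d * (cst 5 - Y d)) * (cst d ^+ 0 * E d 0).
Let T2 d : R * R -> R := (cst 10 - cst 6 * Y d - cst 4 * cst d) * (cst d ^+ 0 * E d 0) +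
  ((cst 10 - cst d) * (cst d ^+ 1 * E d 1) + cst 5 * (cst d ^+ 2 * E d 2)).

Let T0_test d : 0 < d -> test_function B (T0 d).
Proof.
move=> d0; apply: disk_test => //.
have -> : cst 5 * Y d ^+ 2 - Y d ^+ 3 = cst 5 * Y d ^+ 2 + cst (-1) * Y d ^+ 3.
  by apply/funext => x; rewrite !fctE mulN1r.
by apply: smoothD; apply: smoothM; by [exact: smooth_cst|exact: smooth_YX].
Qed.

Let partial_T0 i d : 0 < d -> partial i (T0 d) = T1 d * dq i.
Proof.
move=> d0; apply/funext => x.
have hE := has_derive_E 0 i x d0; have hY := has_derive_Y d i x.
have hY2 := has_deriveX 1 hY; have hY3 := has_deriveX 2 hY.
suff [_ h] : has_derive (e i) (T0 d) x ((T1 d * dq i) x) by exact: h.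
rewrite /T0; eapply has_derive_eq; first by der.
rewrite /T1 !fctE -(YE d 0 x) -(YE d 1 x); ring.
Qed.

Let partial_T1 i d : 0 < d ->
  partial i (T1 d * dq i) = T2 d * dq i * dq i + T1 d * cst (- 2 * (r ^+ 2)^-1).
Proof.
move=> d0; apply/funext => x.
have hE := has_derive_E 0 i x d0; have hY := has_derive_Y d i x.
have hY2 := has_deriveX 1 hY; have hdq := has_derive_dq i x.
suff [_ h] : has_derive (e i) (T1 d * dq i) x
  ((T2 d * dq i * dq i + T1 d * cst (- 2 * (r ^+ 2)^-1)) x) by exact: h.
rewrite /T1 expr0 mul1r; eapply has_derive_eq; first by der.
rewrite /T2 !fctE expr0 -(YE d 0 x) -(YE d 1 x); ring.
Qed.

Let bcvg_T0 : bcvg (fun n => T0 (d_ n)) (fun x => 5 * q x ^+ 2 - q x ^+ 3).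
Proof.
have h0 := bcvg_E 0; have hY := bcvg_Y; have hc := bcvg_cst.
have -> : (fun n => T0 (d_ n)) =
    (fun n => (cst 5 * Y (d_ n) ^+ 2 - Y (d_ n) ^+ 3) * (cst (d_ n) ^+ 0 * E (d_ n) 0)).
  by apply/funext => n; rewrite expr0 mul1r.
have -> : (fun x => 5 * q x ^+ 2 - q x ^+ 3) = (cst 5 * q ^+ 2 - q ^+ 3) * cst (0 ^+ 0).
  by apply/funext => x; rewrite !fctE expr0 mulr1.
have hY2 := bounded_cvgX 2 hY; have hY3 := bounded_cvgX 3 hY.
apply: bounded_cvgM => //; apply: bounded_cvgD; first exact: bounded_cvgM.
exact: bounded_cvgN.
Qed.

Let bcvg_T1 : bcvg (fun n => T1 (d_ n)) (fun x => 10 * q x - 3 * q x ^+ 2).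
Proof.
have h0 := bcvg_E 0; have hY := bcvg_Y; have hc := bcvg_cst; have hd := bcvg_d.
have -> : (fun x => 10 * q x - 3 * q x ^+ 2) =
    (cst 10 * q - cst 3 * q ^+ 2 + cst 0 * (cst 5 - q)) * cst (0 ^+ 0).
  by apply/funext => x; rewrite !fctE expr0 mulr1 mul0r addr0.
have hY2 := bounded_cvgX 2 hY.
apply: bounded_cvgM => //; apply: bounded_cvgD.
  by apply: bounded_cvgD; [exact: bounded_cvgM|apply: bounded_cvgN; exact: bounded_cvgM].
by apply: bounded_cvgM => //; apply: bounded_cvgD => //; exact: bounded_cvgN.
Qed.

Let bcvg_T2 : bcvg (fun n => T2 (d_ n)) (fun x => 10 - 6 * q x).
Proof.
have h0 := bcvg_E 0; have h1 := bcvg_E 1; have h2 := bcvg_E 2.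
have hY := bcvg_Y; have hc := bcvg_cst; have hd := bcvg_d.
have -> : (fun x => 10 - 6 * q x) = (cst 10 - cst 6 * q - cst 4 * cst 0) * cst (0 ^+ 0) +
    ((cst 10 - cst 0) * cst (0 ^+ 1) + cst 5 * cst (0 ^+ 2)).
  by apply/funext => x; rewrite !fctE; ring.
apply: bounded_cvgD; first apply: bounded_cvgM => //.
  apply: bounded_cvgD; last by apply: bounded_cvgN; exact: bounded_cvgM.
  by apply: bounded_cvgD => //; apply: bounded_cvgN; exact: bounded_cvgM.
apply: bounded_cvgD; last exact: bounded_cvgM.
by apply: bounded_cvgM => //; apply: bounded_cvgD => //; exact: bounded_cvgN.
Qed.

Let sqr_test f : test_function B f -> measurable_fun (B : set plane) (f ^+ 2).
Proof. by move=> tf; apply: mtest; rewrite expr2; exact: testM. Qed.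

Let A := fine (area (B : set plane)).

Let X2 x : (r ^+ 2)^-1 * (X 0 x ^+ 2 + X 1 x ^+ 2) = 1 - q x.
Proof. by rewrite /q !fctE; ring. Qed.

Lemma disk_trial : exists phi : nat -> R * R -> R,
  [/\ forall n, test_function B (phi n),
   (fun n => I (fun x => phi n x ^+ 2)) @ \oo --> 73 / 21 * A,
   (fun n => I (fun x => partial 0 (phi n) x ^+ 2) +
      I (fun x => partial 1 (phi n) x ^+ 2)) @ \oo --> 338 / 15 * (A / r ^+ 2) &
   (fun n => I (fun x => (partial 0 (partial 0 (phi n)) x +
      partial 1 (partial 1 (phi n)) x) ^+ 2)) @ \oo --> 16 * 16 * 23 / 15 * (A / r ^+ 4)].
Proof.
have rn : r != 0 by rewrite gt_eqF.
exists (fun n => T0 (d_ n)).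
have tT n : test_function B (T0 (d_ n)) by exact: T0_test.
have p1 n i : partial i (T0 (d_ n)) = T1 (d_ n) * dq i by exact: partial_T0.
have p2 n i : partial i (partial i (T0 (d_ n))) =
    T2 (d_ n) * dq i * dq i + T1 (d_ n) * cst (- 2 * (r ^+ 2)^-1).
  by rewrite p1 partial_T1.
split=> //.
- have [_ h] := bounded_cvg_integrable mB aB (fun n => sqr_test (tT n)) (bounded_cvgX 2 bcvg_T0).
  have <- : M (25 *: 'X^4 + (-10) *: 'X^5 + 'X^6) = 73 / 21 * A.
    by rewrite !MD !MZ !MXn -/A; field.
  have -> : M (25 *: 'X^4 + (-10) *: 'X^5 + 'X^6) = I ((fun x => 5 * q x ^+ 2 - q x ^+ 3) ^+ 2).
    by apply: eq_Rintegral => x _; rewrite !hornerD !hornerZ !hornerXn !fctE; ring.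
  exact: h.
- have h i : area.-integrable (B : set plane)
      (EFin \o (fun x => ((10 * q x - 3 * q x ^+ 2) * dq i x) ^+ 2)) /\
      (fun n => I (fun x => partial i (T0 (d_ n)) x ^+ 2)) @ \oo -->
      I (fun x => ((10 * q x - 3 * q x ^+ 2) * dq i x) ^+ 2).
    have tp n := sqr_test (test_partials [:: i] (tT n)).
    have cp : bcvg (fun n => (partial i (T0 (d_ n))) ^+ 2)
        (((fun x => 10 * q x - 3 * q x ^+ 2) * dq i) ^+ 2).
      under eq_fun => n do rewrite p1.
      by apply: bounded_cvgX; apply: bounded_cvgM; [exact: bcvg_T1|exact: bcvg_dq].
    exact: (bounded_cvg_integrable mB aB tp cp).
  have [i0 c0] := h 0; have [i1 c1] := h 1.
  have <- : (4 / r ^+ 2) * M (100 *: 'X^2 + (- 160) *: 'X^3 + 69 *: 'X^4 + (- 9) *: 'X^5) =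
      338 / 15 * (A / r ^+ 2).
    by rewrite !MD !MZ !MXn -/A; field.
  suff -> : (4 / r ^+ 2) * M (100 *: 'X^2 + (- 160) *: 'X^3 + 69 *: 'X^4 + (- 9) *: 'X^5) =
      I (fun x => ((10 * q x - 3 * q x ^+ 2) * dq 0 x) ^+ 2) +
      I (fun x => ((10 * q x - 3 * q x ^+ 2) * dq 1 x) ^+ 2) by exact: cvgD c0 c1.
  rewrite -MZ; apply: etrans (RintegralD mB i0 i1); apply: eq_Rintegral => x _.
  rewrite !(hornerD, hornerZ, hornerXn).
  transitivity (4 / r ^+ 2 * (10 * q x - 3 * q x ^+ 2) ^+ 2 * (1 - q x)); first by ring.
  by rewrite -X2 /dq !fctE; field.
- have tp n : measurable_fun (B : set plane) ((partial 0 (partial 0 (T0 (d_ n))) +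
     partial 1 (partial 1 (T0 (d_ n)))) ^+ 2).
    by apply: sqr_test; apply: testD; [exact: (test_partials [:: 0; 0] (tT n))|exact: (test_partials [:: 1; 1] (tT n))].
  have cp : bcvg (fun n => (partial 0 (partial 0 (T0 (d_ n))) +
     partial 1 (partial 1 (T0 (d_ n)))) ^+ 2)
     (((fun x => 10 - 6 * q x) * dq 0 * dq 0 + (fun x => 10 * q x - 3 * q x ^+ 2) * cst (- 2 * (r ^+ 2)^-1) +
      ((fun x => 10 - 6 * q x) * dq 1 * dq 1 + (fun x => 10 * q x - 3 * q x ^+ 2) * cst (- 2 * (r ^+ 2)^-1))) ^+ 2).
    under eq_fun => n do rewrite !p2.
    have h i : bcvg (fun n => T2 (d_ n) * dq i * dq i + T1 (d_ n) * cst (- 2 * (r ^+ 2)^-1))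
      ((fun x => 10 - 6 * q x) * dq i * dq i + (fun x => 10 * q x - 3 * q x ^+ 2) * cst (- 2 * (r ^+ 2)^-1)).
      have hT1 := bcvg_T1; have hT2 := bcvg_T2; have hd := bcvg_dq i; have hc := bcvg_cst.
      apply: bounded_cvgD; last exact: bounded_cvgM.
      by apply: bounded_cvgM => //; exact: bounded_cvgM.
    by apply: bounded_cvgX; apply: bounded_cvgD; exact: h.
  have [_ h] := bounded_cvg_integrable mB aB tp cp.
  have <- : (16 / r ^+ 4) * M (100 *: 'X^0 + (- 520) *: 'X^1 + 856 *: 'X^2 + (- 468) *: 'X^3 + 81 *: 'X^4) =
      16 * 16 * 23 / 15 * (A / r ^+ 4).
    by rewrite !MD !MZ !MXn -/A; field.
  move: h; set F := (X in I X); set G := (X in _ --> X); set H := (X in _ -> _ --> X).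
  suff -> : H = G by [].
  rewrite /H -MZ; apply: eq_Rintegral => x _.
  rewrite !(hornerD, hornerZ, hornerXn).
  transitivity ((4 / r ^+ 2 * (10 - 6 * q x) * (1 - q x) - 4 / r ^+ 2 * (10 * q x - 3 * q x ^+ 2)) ^+ 2).
    by field.
  by rewrite -X2 /dq !fctE; field.
Qed.

End DiskTrial.

(** * Comparison *)

Section GammaBounds.
Context {R : realType}.
Notation plane := (measurableTypeR R * measurableTypeR R)%type.
Variable Omega : set (R * R).
Hypothesis oOmega : open Omega.
Hypothesis areaOmega : (area (Omega : set plane) < +oo)%E.
Implicit Types (f g u v phi : R * R -> R).

Notation test := (test_function Omega).
Notation I f := (\int[area]_(x in (Omega : set plane)) f x).

Let mOmega : measurable (Omega : set plane) := measurable_open_plane oOmega.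

Lemma rayleigh_test phi tau : test phi -> rayleigh Omega tau phi =
  (I (fun x => (partial 0 (partial 0 phi) x + partial 1 (partial 1 phi) x) ^+ 2) +
   tau * (I (fun x => partial 0 phi x ^+ 2) + I (fun x => partial 1 phi x ^+ 2))) /
  I (fun x => phi x ^+ 2).
Proof.
move=> tphi; rewrite /rayleigh; congr ((_ + tau * _) / _).
- have w0 := weak_partials_test oOmega areaOmega [:: 0; 0] tphi.
  have w1 := weak_partials_test oOmega areaOmega [:: 1; 1] tphi.
  have H := test_H2 oOmega tphi.
  have L0 := @H2_L2 _ _ [:: 0; 0] _ H isT.
  have L1 := @H2_L2 _ _ [:: 1; 1] _ H isT.
  have P0 := test_L2 oOmega (test_partials [:: 0; 0] tphi).
  have P1 := test_L2 oOmega (test_partials [:: 1; 1] tphi).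
  have E := Rintegral_sqr_ae oOmega (L2D oOmega L0 L1) (L2D oOmega P0 P1).
  transitivity (I (fun x => (weak_partials Omega [:: 0; 0] phi + weak_partials Omega [:: 1; 1] phi) x ^+ 2)).
    by apply: eq_Rintegral => x _; rewrite /laplacian sum_ord2.
  apply: E; apply: filterS2 w0 w1 => x h0 h1 Ox.
  by rewrite !fctE h0// h1.
- have H := test_H2 oOmega tphi.
  have L0 := @H2_L2 _ _ [:: 0] _ H isT.
  have L1 := @H2_L2 _ _ [:: 1] _ H isT.
  have P0 := test_L2 oOmega (test_partials [:: 0] tphi).
  have P1 := test_L2 oOmega (test_partials [:: 1] tphi).
  have E0 := Rintegral_sqr_ae oOmega L0 P0 (weak_partials_test oOmega areaOmega [:: 0] tphi).
  have E1 := Rintegral_sqr_ae oOmega L1 P1 (weak_partials_test oOmega areaOmega [:: 1] tphi).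
  have E := RintegralD mOmega (L2_sqr_integrable L0) (L2_sqr_integrable L1).
  apply: etrans (etrans E (f_equal2 (fun a b => a + b) E0 E1)).
  by apply: eq_Rintegral => x _; rewrite /sqr_norm_grad sum_ord2.
Qed.

Lemma rayleigh_ge0 tau v : 0 <= tau -> 0 <= rayleigh Omega tau v.
Proof.
move=> t0; rewrite /rayleigh divr_ge0// ?addr_ge0 ?mulr_ge0//;
  apply: Rintegral_ge0 => x _; rewrite ?sqr_ge0//.
by apply: sumr_ge0 => i _; exact: sqr_ge0.
Qed.

Lemma Gamma_le_rayleigh tau v : 0 <= tau -> H20 Omega v -> nonzero_on Omega v ->
  Gamma Omega tau <= rayleigh Omega tau v.
Proof.
move=> t0 Hv nv; apply: ge_inf; last by exists v.
by exists 0 => _ [w _ <-]; exact: rayleigh_ge0.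
Qed.

Lemma box_fun_gt0 (a b c d e : R) x : box a b c d x -> 0 < box_fun a b c d e x.
Proof.
move=> []; rewrite /= !in_itv /= => /andP[? ?] /andP[? ?]; rewrite box_funE /cutoff.
by rewrite !subr_gt0 !ifT// !mulr_gt0 ?expR_gt0.
Qed.

Lemma H20_nonempty : Omega !=set0 -> exists v, H20 Omega v /\ nonzero_on Omega v.
Proof.
move=> [x Ox]; have [q [qx sub]] := open_rat_box oOmega Ox; move: qx sub.
move: (ratr q.1.1) (ratr q.1.2) (ratr q.2.1) (ratr q.2.2) => a b c d bx sub.
exists (box_fun a b c d 1); have t := box_test ltr01 sub; split; first exact: test_H20.
move=> [N [mN N0 hN]].
have bN : box a b c d `<=` N.
  move=> y by'; apply: hN => /= h; have := box_fun_gt0 1 by'.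
  rewrite h ?ltxx//; apply: sub; case: by' => h1 h2; split; [move: h1|move: h2];
    by rewrite /= !in_itv /= => /andP[/ltW -> /ltW ->].
have : area (box a b c d : set plane) = 0%E.
  exact: subset_measure0 (measurable_box a b c d) mN bN N0.
rewrite /box area_setX// !lebesgue_measure_itv /= !lte_fin.
case: bx; rewrite /= !in_itv /= => /andP[? ?] /andP[? ?].
rewrite !ifT; [|lra|lra]; rewrite -EFinM => -[] /eqP.
by rewrite mulf_eq0 !subr_eq0 => /orP[] /eqP; lra.
Qed.

End GammaBounds.

Section Comparison.
Context {R : realType}.
Notation plane := (measurableTypeR R * measurableTypeR R)%type.
Notation sigma := (@disk_const R).
Implicit Types (a b c : R * R) (tau r s : R).

Let cvg_quotient (L G N : nat -> R) (l g m t : R) : L @ \oo --> l -> G @ \oo --> g ->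
  N @ \oo --> m -> m != 0 ->
  (fun n => (L n + t * G n) / N n) @ \oo --> (l + t * g) / m.
Proof.
move=> cL cG cN m0; apply: cvgM; last exact: cvgV.
by apply: cvgD => //; apply: cvgM => //; exact: cvg_cst.
Qed.

(* 16 * 16 * 161 / 365 = K1 and 26 * 91 / 365 = K2. *)
Lemma Gamma_disk_le c r tau : 0 < r -> 0 <= tau ->
  Gamma (open_disk c r) tau <=
  (16 * 16 * 161) / 365 / r ^+ 4 + tau * (26 * 91 / 365 / r ^+ 2).
Proof.
move=> r0 t0; set B := open_disk c r.
have oB : open B := @open_open_disk _ c r.
have mB := measurable_open_plane oB; have aB := area_disk_lty c r0.
have [phi [tphi cN cG cL]] := disk_trial c r0.
set A := fine (area (B : set plane)) in cN cG cL.
have A0 : 0 < A.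
  have B0 : B !=set0 by exists c; rewrite /B /open_disk /= !subrr expr0n addr0 exprn_gt0.
  rewrite fine_gt0// aB andbT lt0e measure_ge0 andbT; apply/eqP => E0.
  have [v [_ nv]] := H20_nonempty oB aB B0; apply: nv.
  by exists B; split=> // x /= nx; apply: contrapT => Bx; apply: nx.
have N0 : 0 < 73 / 21 * A by rewrite !mulr_gt0// invr_gt0.
have rn : r != 0 by rewrite gt_eqF.
have An : A != 0 by rewrite gt_eqF.
have <- : (16 * 16 * 23 / 15 * (A / r ^+ 4) + tau * (338 / 15 * (A / r ^+ 2))) /
    (73 / 21 * A) = (16 * 16 * 161) / 365 / r ^+ 4 + tau * (26 * 91 / 365 / r ^+ 2).
  by field; rewrite rn An.
have cR := @cvg_quotient _ _ _ _ _ _ tau cL cG cN (lt0r_neq0 N0).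
have cG0 : (fun _ : nat => Gamma B tau) @ \oo --> Gamma B tau by exact: cvg_cst.
apply: (ler_cvg_to cG0 cR).
have /cvgr_gt /(_ 0 N0) := cN; apply: filterS => n Nn.
have h := Gamma_le_rayleigh t0 (test_H20 oB aB (tphi n))
  (sqr_nonzero_on oB aB Nn (test_L2 oB (tphi n))).
by apply: le_trans h _; rewrite (rayleigh_test oB aB tau (tphi n)).
Qed.

Lemma triangle_longest a b c : exists a' b' c',
  [/\ open_triangle a' b' c' = open_triangle a b c, det3 a' b' c' = det3 a b c,
      sqr_dist a' c' <= sqr_dist a' b' & sqr_dist b' c' <= sqr_dist a' b'].
Proof.
have C (p q : R * R) : sqr_dist p q = sqr_dist q p by rewrite /sqr_dist; ring.
have [h1|/ltW h1] := leP (sqr_dist a c) (sqr_dist a b);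
  have [h2|/ltW h2] := leP (sqr_dist b c) (sqr_dist a b);
  have [h3|/ltW h3] := leP (sqr_dist b c) (sqr_dist a c).
- by exists a, b, c.
- by exists a, b, c.
- exists b, c, a; split; [exact: open_triangle_rot|exact: det3_rot|by rewrite (C b a)|].
  by rewrite (C c a); exact: le_trans h2.
- exists b, c, a; split; [exact: open_triangle_rot|exact: det3_rot|by rewrite (C b a)|].
  by rewrite (C c a).
- exists c, a, b; split; [exact: esym (open_triangle_rot c a b)|exact: esym (det3_rot c a b)| |].
    by rewrite (C c b) (C c a).
  by rewrite (C c a).
- exists b, c, a; split; [exact: open_triangle_rot|exact: det3_rot| |].
    by rewrite (C b a); exact: le_trans h3.
  by rewrite (C c a).
- exists c, a, b; split; [exact: esym (open_triangle_rot c a b)|exact: esym (det3_rot c a b)| |].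
    by rewrite (C c b) (C c a).
  by rewrite (C c a).
- exists b, c, a; split; [exact: open_triangle_rot|exact: det3_rot|by rewrite (C b a)|].
  by rewrite (C c a).
Qed.

Lemma triangle_H20 a b c v : det3 a b c != 0 ->
  let T := open_triangle a b c in
  (area (T : set plane) < +oo)%E -> H20 T v ->
  16 * 22 * 13 * \int[area]_(x in (T : set plane)) (v x ^+ 2) <=
    det3 a b c ^+ 2 * \int[area]_(x in (T : set plane)) (laplacian T v x ^+ 2) /\
  1700 * (\int[area]_(x in (T : set plane)) (v x ^+ 2)) ^+ 2 <=
    det3 a b c ^+ 2 * (\int[area]_(x in (T : set plane)) (sqr_norm_grad T v x)) ^+ 2.
Proof.
have [a' [b' [c' [<- <- h1 h2]]]] := triangle_longest a b c.
move: a' b' c' h1 h2 => {a b c} a b c h1 h2 D0 T aT Hv.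
have oT : open T := open_open_triangle D0.
have mT := measurable_open_plane oT.
have [phi [tphi cN cG cL]] := H20_cvg oT aT Hv.
have c2 (k : R) (u_ : nat -> R) (u : R) : u_ @ \oo --> u -> (fun n => k * u_ n) @ \oo --> k * u.
  by move=> ?; apply: cvgM => //; exact: cvg_cst.
split.
- apply: (ler_cvg_to (c2 _ _ _ cN) (c2 _ _ _ cL)); apply: nearW => n.
  rewrite (_ : \int[area]_(x in _) (phi n x ^+ 2) =
    \int[area]_(x in (T : set plane)) (phi n * phi n) x); last first.
    by apply: eq_Rintegral => x _; rewrite expr2.
  apply: le_trans (triangle_lap D0 (conj h1 h2) (tphi n)) _.
  rewrite le_eqVlt; apply/orP; left; apply/eqP.
  by congr (_ * _); apply: eq_Rintegral => x _; rewrite !fctE expr2.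
- have sq (u_ : nat -> R) (u : R) : u_ @ \oo --> u -> (fun n => u_ n ^+ 2) @ \oo --> u ^+ 2.
    by move=> h; under eq_fun do rewrite expr2; rewrite expr2; exact: cvgM.
  apply: (ler_cvg_to (c2 _ _ _ (sq _ _ cN)) (c2 _ _ _ (sq _ _ cG))); apply: nearW => n.
  rewrite (_ : \int[area]_(x in _) (phi n x ^+ 2) =
    \int[area]_(x in (T : set plane)) (phi n * phi n) x); last first.
    by apply: eq_Rintegral => x _; rewrite expr2.
  apply: le_trans (triangle_grad D0 (tphi n)) _.
  rewrite le_eqVlt; apply/orP; left; apply/eqP.
  congr (_ * _ ^+ 2).
  have t i := test_integrable mT (testM (test_partials [:: i] (tphi n)) (test_partials [:: i] (tphi n))).
  apply: etrans (RintegralD mT (t 0) (t 1)) _.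
  by congr (_ + _); apply: eq_Rintegral => x _; rewrite !fctE expr2.
Qed.

Let numeric_bounds (s : R) : 0 <= s -> s <= 3 + 18 / 100 + 3 / (100 * 100) ->
  s ^+ 2 * (16 * 16 * 161 / 365) <= 4 * 22 * 13 /\
  (s * (2 * (26 * 91 / 365))) ^+ 2 <= 1700.
Proof.
move=> s0 s1; have s2 : s ^+ 2 <= (3 + 18 / 100 + 3 / (100 * 100)) ^+ 2.
  by rewrite lerXn2r// nnegrE; exact: le_trans s1.
by rewrite exprMn; split; lra.
Qed.

Let sigma_bounds : 0 < sigma /\ sigma ^+ 2 * (16 * 16 * 161 / 365) <= 4 * 22 * 13 /\
  (sigma * (2 * (26 * 91 / 365))) ^+ 2 <= 1700.
Proof.
have h : sigma <= 3 + 18 / 100 + 3 / (100 * 100) by rewrite /disk_const; lra.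
have h0 : 0 < sigma by rewrite /disk_const; lra.
by split=> //; exact: numeric_bounds (ltW h0) h.
Qed.

Lemma quotient_ge (D r L G N tau : R) : 0 < r -> 0 <= tau -> 0 < N -> 0 <= L -> 0 <= G ->
  `|D| / 2 <= sigma * r ^+ 2 ->
  16 * 22 * 13 * N <= D ^+ 2 * L -> 1700 * N ^+ 2 <= D ^+ 2 * G ^+ 2 ->
  (16 * 16 * 161) / 365 / r ^+ 4 + tau * (26 * 91 / 365 / r ^+ 2) <= (L + tau * G) / N.
Proof.
move=> r0 t0 N0 L0 G0 hD hL hG; have [s0 [s1 s2]] := sigma_bounds.
have r2 : 0 < r ^+ 2 by exact: exprn_gt0.
have hD2 : D ^+ 2 <= 4 * sigma ^+ 2 * (r ^+ 2) ^+ 2.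
  rewrite -[D ^+ 2]real_normK ?num_real//.
  have -> : 4 * sigma ^+ 2 * (r ^+ 2) ^+ 2 = (2 * (sigma * r ^+ 2)) ^+ 2 by ring.
  have sr : 0 <= 2 * (sigma * r ^+ 2) by apply: mulr_ge0 => //; apply: mulr_ge0; apply: ltW.
  rewrite (@ler_pXn2r _ 2 isT _ _ (normr_ge0 D) sr).
  by rewrite mulrC -ler_pdivrMr.
have L2 := ler_wpM2r L0 hD2; have G2 := ler_wpM2r (sqr_ge0 G) hD2.
rewrite [leRHS]mulrDl; apply: lerD.
- rewrite (_ : r ^+ 4 = (r ^+ 2) ^+ 2); last by ring.
  rewrite ler_pdivrMr ?exprn_gt0// [leRHS]mulrAC ler_pdivlMr//.
  have s4 : 0 < 4 * sigma ^+ 2 by rewrite mulr_gt0// exprn_gt0.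
  rewrite -(ler_pM2l s4); have := ler_wpM2r (ltW N0) s1.
  move: L2 hL; move: (D ^+ 2 * L) ((r ^+ 2) ^+ 2) (sigma ^+ 2) (16 * 16 * 161 / 365) => P Q S K.
  by move=> h1 h2 h3; lra.
- rewrite -[leRHS]mulrA; apply: ler_wpM2l => //.
  rewrite ler_pdivrMr// [leRHS]mulrAC ler_pdivlMr//.
  have s4 : 0 < 2 * sigma by rewrite mulr_gt0.
  rewrite -(ler_pM2l s4); have := ler_wpM2r (sqr_ge0 N) s2.
  have k0 : 0 <= 26 * 91 / 365 :> R by lra.
  move: k0; move: (26 * 91 / 365) => k k0 h.
  have x0 := mulr_ge0 (ltW s4) (mulr_ge0 k0 (ltW N0)).
  have y0 := mulr_ge0 (ltW s4) (mulr_ge0 G0 (ltW r2)).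
  rewrite -(@ler_pXn2r _ 2 isT _ _ x0 y0).
  rewrite [leLHS](_ : _ = (sigma * (2 * k)) ^+ 2 * N ^+ 2); last by ring.
  apply: le_trans h _; apply: le_trans hG _; apply: le_trans G2 _.
  by rewrite le_eqVlt; apply/orP; left; apply/eqP; ring.
Qed.

End Comparison.

Theorem corollary3p4 (R : realType) (T B : set (R * R)) (tau : R) :
  is_triangle T -> is_disk B -> area T = area B -> 0 <= tau ->
  Gamma T tau >= Gamma B tau.
Proof.
move=> [a [b [c [D0 ->]]]] [d [r [r0 ->]]] areaE t0.
apply: le_trans (Gamma_disk_le d r0 t0) _; rewrite -/(det3 a b c) in D0.
have aB := area_disk_lty d r0; have aT := aB; rewrite -areaE in aT.
have oT := open_open_triangle D0.
apply: lb_le_inf.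
  have [|v [Hv nv]] := H20_nonempty oT aT; last by exists (rayleigh (open_triangle a b c) tau v), v.
  exists (3^-1 *: a + 3^-1 *: b + 3^-1 *: c), 3^-1, 3^-1, 3^-1.
  by split; rewrite ?invr_gt0//; field.
move=> _ [v [Hv nv] <-].
have [hL hG] := triangle_H20 D0 aT Hv.
have N0 := nonzero_on_sqr oT Hv.1.1 nv.
have hD : `|det3 a b c| / 2 <= disk_const * r ^+ 2.
  rewrite -lee_fin; apply: le_trans (area_triangle_ge D0) _.
  by rewrite areaE; exact: area_disk_le.
apply: (quotient_ge r0 t0 N0 _ _ hD hL hG); apply: Rintegral_ge0 => x _; first exact: sqr_ge0.
by apply: sumr_ge0 => i _; exact: sqr_ge0.
Qed.
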